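(* Let $W_E=x_0^2+f(x_1,x_2)$ and $W_S=y_0^2+g(y_1,y_2,y_3)$ be admissible potentials (see context) with weights sequences $(u_0,u)=(u_0,u_1,u_2)$ and $(v_0,v)=(v_0,v_1,v_2,v_3)$, defining the elliptic curve $E=\{W_E=0\}\subset\mathbb{P}(u_0,u)$ and the (possibly singular) K3 surface $S=\{W_S=0\}\subset\mathbb{P}(v_0,v)$. Let $(u_0^\top,u^\top)$, $(v_0^\top,v^\top)$ be the weights sequences of the transposed potentials $W_E^\top$, $W_S^\top$, and let $E^\top\subset\mathbb{P}(u_0^\top,u^\top)$, $S^\top\subset\mathbb{P}(v_0^\top,v^\top)$ be their zero sets. Assume $\gcd(u_0,v_0)=1$ and $\gcd(u_0^\top,v_0^\top)=1$. Let $G_E\subset\widetilde{\mathrm{SL}}(W_E)$ and $G_S\subset\widetilde{\mathrm{SL}}(W_S)$ be subgroups, let $G_E^\top,G_S^\top$ be their transposed groups, and put $G_{E,S}:=\tilde\theta^{-1}(G_E\times G_S)\subset\widetilde{\mathrm{SL}}(W_{E,S})$, with transposed group $G_{E,S}^\top\subset\widetilde{\mathrm{SL}}(W_{E,S}^\top)$. Then: (i) $Z_{E/G_E,\,S_{G_S}}$ is birational to $X_{W_{E,S}}/G_{E,S}$; (ii) $Z_{E^\top/G_E^\top,\,S^\top_{G_S^\top}}$ is birational to $X_{W_{E,S}^\top}/G_{E,S}^\top$.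
   Context: All varieties are over $\mathbb{C}$. Potentials. Let $W$ be a polynomial in $n$ variables with $n$ monomials (Delsarte type), with exponent matrix $A=(a_{ij})$: up to rescaling the variables, $W=\sum_{i=1}^n\prod_{j=1}^n x_j^{a_{ij}}$. Assume $A$ is invertible over $\mathbb{Q}$. The charges sequence is $q=A^{-1}\mathbf{1}$, where $\mathbf 1$ is the column vector of ones; the weights sequence $w=dq$ is the smallest positive multiple of $q$ with integer entries, and $W$ is $w$-weighted homogeneous of degree $d$. $W$ is called admissible if $A$ is invertible over $\mathbb{Q}$, $w$ is normalized ($\gcd(w_1,\dots,\widehat{w_i},\dots,w_n)=1$ for all $i$), $W$ is non-degenerate (the affine cone $\{W=0\}\subset\mathbb{C}^n$ is smooth outside the origin), and $\sum_i w_i=d$ (Calabi--Yau condition). Then $X_W:=\{W=0\}\subset\mathbb{P}(w)$. The transposed potential $W^\top$ is the polynomial with exponent matrix $A^\top$; its weights sequence is denoted $w^\top$, and $X_{W^\top}\subset\mathbb{P}(w^\top)$. Groups. $\mathrm{Aut}(W)$ is the group of diagonal linear automorphisms of $\mathbb{C}^n$ leaving $W$ invariant, $\mathrm{SL}(W)$ its subgroup of elements of determinant one, $J_W\subset\mathrm{SL}(W)$ the cyclic subgroup generated by $j_W=\mathrm{diag}(e^{2\pi i q_1},\dots,e^{2\pi i q_n})$ (the elements acting trivially on $\mathbb{P}(w)$), and $\widetilde{\mathrm{SL}}(W)=\mathrm{SL}(W)/J_W$, which acts on $X_W$. $\mathrm{Aut}(W)$ is identified with $A^{-1}\mathbb{Z}^n/\mathbb{Z}^n$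 via $v\mapsto\mathrm{diag}(e^{2\pi i v_j})$. There is a well-defined bilinear form $\widetilde{\mathrm{SL}}(W^\top)\times\widetilde{\mathrm{SL}}(W)\to\mathbb{Q}/\mathbb{Z}$, $(a,b)\mapsto a^\top A b$. The transposed group of a subgroup $G\subset\widetilde{\mathrm{SL}}(W)$ is $G^\top=\{a\in\widetilde{\mathrm{SL}}(W^\top)\mid a^\top A b=0\ \forall b\in G\}$. The threefold potential. $W_{E,S}:=f(x_1,x_2)-g(y_1,y_2,y_3)$ defines $X_{W_{E,S}}\subset\mathbb{P}(v_0u,u_0v)=\mathbb{P}(v_0u_1,v_0u_2,u_0v_1,u_0v_2,u_0v_3)$; its exponent matrix is $\mathrm{diag}(\hat A_E,\hat A_S)$, where $\hat A_E,\hat A_S$ are the exponent matrices of $W_E,W_S$ with first row and column deleted (signs of coefficients are immaterial for the groups above and can be removed by rescaling variables). Its transpose is $W_{E,S}^\top=f^\top-g^\top$, where $W_E^\top=x_0^2+f^\top$ and $W_S^\top=y_0^2+g^\top$. The map $\tilde\theta$. Writing an element of $\mathrm{SL}(W_{E,S})$ by its diagonal entries $(\alpha,\beta)=(\alpha_1,\alpha_2,\beta_1,\beta_2,\beta_3)$, every class in $\widetilde{\mathrm{SL}}(W_{E,S})$ has a representative with $\alpha_1\alpha_2=\beta_1\beta_2\beta_3=1$, and with this choice the isomorphism $\tilde\theta:\widetilde{\mathrm{SL}}(W_{E,S})\to\widetilde{\mathrm{SL}}(W_E)\times\widetilde{\mathrm{SL}}(W_S)$ is $[(\alpha,\beta)]\mapsto([(1,\alpha)],[(1,\beta)])$.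 Borcea--Voisin threefolds. $E$ and $S$ carry the involutions $\sigma_E:x_0\mapsto-x_0$ and $\sigma_S:y_0\mapsto-y_0$, and similarly for $E^\top,S^\top$. $S_{G_S}$ denotes the minimal resolution of $S/G_S$ and $S^\top_{G_S^\top}$ that of $S^\top/G_S^\top$; these are K3 surfaces with non-symplectic involutions induced by $y_0\mapsto-y_0$. The quotients $E/G_E$ and $E^\top/G_E^\top$ are elliptic curves with the involution induced by $x_0\mapsto-x_0$. For an elliptic curve $E'$ with involution $\sigma_{E'}$ and a K3 surface $S'$ with non-symplectic involution $\sigma_{S'}$ (where $\sigma_{E'}$ acts as $-1$ on $H^{1,0}(E')$), $Z_{E',S'}$ denotes a crepant resolution of $(E'\times S')/\langle\sigma_{E'}\times\sigma_{S'}\rangle$. *)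

(* Defs.v *)
From HB Require Import structures.
From mathcomp Require Import all_boot all_order all_algebra.
From mathcomp Require Import complex.
From mathcomp Require Import boolp classical_sets reals trigo.
From mathcomp Require Import -(notations) mpoly.
Set Implicit Arguments.
Unset Strict Implicit.
Unset Printing Implicit Defensive.
Import Order.TTheory GRing.Theory Num.Theory.
Local Open Scope classical_set_scope.
Local Open Scope ring_scope.

(* Varieties are spaces with functions (Serre, Kempf, Springer): a space is a
   set of points with its open sets and, for every open U, the functions that
   are regular on U. A regular function is represented by a total function of
   which only the values on U matter. The record carries bare data; the axioms
   are in [is_space]. *)
Record fspace (C : Type) := FSpace {
  point :> Type;
  opn : set (set point);
  reg : set point -> set (point -> C) }.

Section Spaces.
Variable C : fieldType.
Implicit Types X Y Z T : fspace C.

Definition is_space X : Prop :=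
  [/\ [/\ opn (@setT X),
          (forall U V : set X, opn U -> opn V -> opn (U `&` V)) &
          (forall F : set (set X), F `<=` @opn C X -> opn (\bigcup_(U in F) U))],
      (forall (U V : set X) f, opn U -> opn V -> V `<=` U -> reg U f -> reg V f) &
      (forall (U : set X) f, opn U ->
         (forall p, U p -> exists V g,
            [/\ opn V, V p, reg V g & forall q, U q -> V q -> f q = g q]) ->
         reg U f)].

Definition closed_in X (F : set X) : Prop := opn (~` F).

Definition dense_in X (U : set X) : Prop :=
  forall V : set X, opn V -> V !=set0 -> (V `&` U) !=set0.

Definition irreducible_in X (F : set X) : Prop :=
  F !=set0 /\ forall A B : set X, closed_in A -> closed_in B ->
    F `<=` A `|` B -> F `<=` A \/ F `<=` B.

Definition morphism X Y (phi : X -> Y) : Prop :=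
  (forall V : set Y, opn V -> opn (phi @^-1` V)) /\
  (forall (V : set Y) f, opn V -> reg V f -> reg (phi @^-1` V) (f \o phi)).

Definition isomorphic X Y : Prop :=
  exists (phi : X -> Y) (psi : Y -> X),
    [/\ morphism phi, morphism psi, cancel phi psi & cancel psi phi].

(* The subspace on a locally closed subset. *)
Definition sub X (A : set X) : fspace C :=
  @FSpace C {x : X | A x}
    [set V | exists2 U : set X, opn U & V = [set p | U (sval p)]]
    (fun V => [set f | forall p, V p -> exists (U : set X) g,
       [/\ opn U, U (sval p), reg U g &
           forall q, V q -> U (sval q) -> f q = g (sval q)]]).

(* The quotient by an equivalence relation, with the quotient topology; a
   function is regular when its pull-back is. Its points are the classes. *)
Definition quot_pt X (r : X -> X -> Prop) : Type :=
  {c : set X | exists x, c = r x}.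

Definition qproj X (r : X -> X -> Prop) (x : X) : quot_pt r :=
  exist _ (r x : set X) (ex_intro _ x erefl).

Definition quot X (r : X -> X -> Prop) : fspace C :=
  @FSpace C (quot_pt r)
    [set V | opn (@qproj X r @^-1` V)]
    (fun V => [set f : quot_pt r -> C | reg (@qproj X r @^-1` V) (f \o @qproj X r)]).

(* The product of varieties: locally, regular functions are the quotients of
   finite sums of products f(x) g(y). *)
Definition tensor_fun X Y (U : set X) (V : set Y) (a : X * Y -> C) : Prop :=
  exists (k : nat) (f : 'I_k -> X -> C) (g : 'I_k -> Y -> C),
    [/\ forall i, reg U (f i), forall i, reg V (g i) &
        a = fun p => \sum_i f i p.1 * g i p.2].

Definition prod_space X Y : fspace C :=
  @FSpace C (X * Y)%type
    [set O | forall p, O p -> exists (U : set X) (V : set Y) b,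
       [/\ opn U, opn V & tensor_fun U V b] /\
       [/\ U p.1, V p.2, b p != 0 &
           forall q, U q.1 -> V q.2 -> b q != 0 -> O q]]
    (fun O => [set h | forall p, O p -> exists (U : set X) (V : set Y) a b,
       [/\ opn U, opn V, tensor_fun U V a & tensor_fun U V b] /\
       [/\ U p.1, V p.2, b p != 0 &
           forall q, O q -> U q.1 -> V q.2 -> b q != 0 -> h q = a q / b q]]).

Definition ev n (p : mpoly n C) (x : 'rV[C]_n) : C := meval (x 0) p.

Definition zeros n (I : set (mpoly n C)) : set 'rV[C]_n :=
  [set x : 'rV[C]_n | forall p, I p -> ev p x = 0].

Definition affine_space n : fspace C :=
  @FSpace C 'rV[C]_n
    [set U | exists I, U = ~` zeros I]
    (fun U => [set f | forall x, U x -> exists a b : mpoly n C,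
       ev b x != 0 /\
       forall y, U y -> ev b y != 0 -> f y = ev a y / ev b y]).

Definition is_affine X : Prop :=
  exists n (I : set (mpoly n C)),
    isomorphic X (sub (zeros I : set (affine_space n))).

Definition is_variety X : Prop :=
  [/\ is_space X,
      exists (k : nat) (U : 'I_k -> set X),
        (forall i, opn (U i) /\ is_affine (sub (U i))) /\
        (forall x, exists i, U i x),
      closed_in ([set p | p.1 = p.2] : set (prod_space X X)) &
      irreducible_in (@setT X)].

Definition birational X Y : Prop :=
  exists (U : set X) (V : set Y),
    [/\ opn U, dense_in U, opn V, dense_in V & isomorphic (sub U) (sub V)].

Definition birational_morphism X Y (phi : X -> Y) : Prop :=
  morphism phi /\
  exists V : set Y,
    [/\ opn V, dense_in V, dense_in (phi @^-1` V) &
        exists psi : sub V -> X,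
          [/\ morphism psi, forall y, phi (psi y) = sval y &
              forall x y, sval y = phi x -> psi y = x]].

(* Separated and of finite type are automatic between varieties, so that proper
   means universally closed. The closed subsets of the fibre product of phi and
   h are the traces of the closed subsets F of X x T. *)
Definition proper X Y (phi : X -> Y) : Prop :=
  morphism phi /\
  forall (T : fspace C) (h : T -> Y), is_variety T -> morphism h ->
    forall F : set (prod_space X T), closed_in F ->
      closed_in [set t : T | exists x, phi x = h t /\ F (x, t)].

Definition closed_chain X (d : nat) : Prop :=
  exists F : nat -> set X,
    (forall i, (i <= d)%N -> closed_in (F i) /\ irreducible_in (F i)) /\
    (forall i, (i < d)%N -> F i `<` F i.+1).

(* Krull dimension. *)
Definition dim_is X (d : nat) : Prop :=
  closed_chain X d /\ ~ closed_chain X d.+1.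

Definition regular_near X (p : X) (f : X -> C) : Prop :=
  exists U : set X, [/\ opn U, U p & reg U f].

(* Tangent vectors are derivations at p of the local ring at p. A vector is a
   function on all f : X -> C, of which only the values at germs of regular
   functions matter. *)
Definition is_tangent X (p : X) (D : (X -> C) -> C) : Prop :=
  [/\ (forall f g, regular_near p f -> regular_near p g ->
         (exists U : set X, [/\ opn U, U p & forall x, U x -> f x = g x]) ->
         D f = D g),
      (forall a f g, regular_near p f -> regular_near p g ->
         D (fun x => a * f x + g x) = a * D f + D g) &
      (forall f g, regular_near p f -> regular_near p g ->
         D (fun x => f x * g x) = D f * g p + f p * D g)].

Definition tangent_dim X (p : X) (d : nat) : Prop :=
  exists B : 'I_d -> (X -> C) -> C,
    (forall i, is_tangent p (B i)) /\
    forall D, is_tangent p D -> exists! a : 'rV[C]_d,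
      forall f, regular_near p f -> D f = \sum_i a 0 i * B i f.

Definition smooth_at X (p : X) : Prop :=
  exists d, dim_is X d /\ tangent_dim p d.

Definition push X Y (phi : X -> Y) (D : (X -> C) -> C) : (Y -> C) -> C :=
  fun g => D (g \o phi).

(* Differential d-forms, as functions of d tangent vectors at each point. *)
Definition form_data X d := X -> ('I_d -> (X -> C) -> C) -> C.

(* Locally omega is a sum of forms h df_1 /\ ... /\ df_d. *)
Definition regular_form X d (U : set X) (omega : form_data X d) : Prop :=
  forall p, U p -> exists V : set X, [/\ opn V, V p, V `<=` U &
    exists (k : nat) (h : 'I_k -> X -> C) (f : 'I_k -> 'I_d -> X -> C),
      [/\ forall i, reg V (h i), forall i j, reg V (f i j) &
          forall q D, V q -> (forall i, is_tangent q (D i)) ->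
            omega q D = \sum_(l < k) h l q * \det (\matrix_(i, j) D i (f l j))]].

(* With d the dimension: a generator on U of the sheaf of top forms. *)
Definition generating_form X d (U : set X) (omega : form_data X d) : Prop :=
  regular_form U omega /\
  forall p, U p -> exists D, (forall i, is_tangent p (D i)) /\ omega p D != 0.

Definition is_resolution X Y (phi : X -> Y) : Prop :=
  [/\ is_variety X, forall p : X, smooth_at p, proper phi &
      birational_morphism phi].

Definition is_minimal_resolution X Y (phi : X -> Y) : Prop :=
  is_resolution phi /\
  forall X' (phi' : X' -> Y), is_resolution phi' ->
    exists psi : X' -> X, morphism psi /\ phi \o psi = phi'.

(* K_Y is Cartier and K_X = phi^* K_Y, for Y normal: locally on Y there is a
   generator omega of the top forms on the smooth locus whose pull-back extends
   to a generator eta of the top forms of X. *)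
Definition crepant X Y (phi : X -> Y) : Prop :=
  exists d, [/\ dim_is X d, dim_is Y d &
    forall y : Y, exists (U : set Y) (omega : form_data Y d) (eta : form_data X d),
      [/\ opn U, U y,
          generating_form (U `&` [set q | smooth_at q]) omega,
          generating_form (phi @^-1` U) eta &
          forall x D, U (phi x) -> smooth_at (phi x) ->
            (forall i, is_tangent x (D i)) ->
            eta x D = omega (phi x) (fun i => push phi (D i))]].

Definition is_crepant_resolution X Y (phi : X -> Y) : Prop :=
  is_resolution phi /\ crepant phi.

Definition is_involution X (s : X -> X) : Prop := morphism s /\ involutive s.

Definition pair_orbit X Y (s : X -> X) (t : Y -> Y) (p q : prod_space X Y) :=
  q = p \/ q = (s p.1, t p.2).

(* Z is a Borcea-Voisin threefold Z_{E,S} of (E, sE) and (S, sS). *)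
Definition is_borcea_voisin (E S : fspace C) (sE : E -> E) (sS : S -> S) Z : Prop :=
  exists rho : Z -> quot (@pair_orbit E S sE sS), is_crepant_resolution rho.

(* Weighted projective space P(w) and its hypersurface {W = 0}. *)
Definition punctured n : fspace C :=
  sub ([set x | x != 0] : set (affine_space n)).

Definition weighted_rel n (w : 'rV[nat]_n) (x y : punctured n) : Prop :=
  exists2 t : C, t != 0 & forall i, sval y 0 i = t ^+ w 0 i * sval x 0 i.

Definition wproj n (w : 'rV[nat]_n) : fspace C := quot (@weighted_rel n w).

Definition whyp n (w : 'rV[nat]_n) (W : mpoly n C) : fspace C :=
  sub ([set p | forall x, sval p x -> ev W (sval x) = 0] : set (wproj w)).

Definition dmul n (a x : 'rV[C]_n) : 'rV[C]_n := \row_i (a 0 i * x 0 i).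

(* The graph of the action on {W = 0} of the diagonal matrix with entries a. *)
Definition diag_act n (w : 'rV[nat]_n) (W : mpoly n C) (a : 'rV[C]_n)
    (p q : whyp w W) : Prop :=
  exists x y : punctured n,
    [/\ sval (sval p) x, sval (sval q) y & sval y = dmul a (sval x)].

(* Here and below a set G of cosets of diagonal matrices acts through
   representatives. *)
Definition orbit_rel n (w : 'rV[nat]_n) (W : mpoly n C)
    (G : set (set 'rV[C]_n)) (p q : whyp w W) : Prop :=
  exists2 P, G P & exists2 a, P a & diag_act a p q.

Definition whyp_quot n (w : 'rV[nat]_n) (W : mpoly n C)
    (G : set (set 'rV[C]_n)) : fspace C := quot (@orbit_rel n w W G).

Definition induced_by n (w : 'rV[nat]_n) (W : mpoly n C)
    (G : set (set 'rV[C]_n)) (a : 'rV[C]_n)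
    (s : whyp_quot w W G -> whyp_quot w W G) : Prop :=
  forall p q : whyp w W, diag_act a p q ->
    s (qproj (@orbit_rel n w W G) p) = qproj (@orbit_rel n w W G) q.

(* The diagonal matrix changing the sign of the first variable. *)
Definition flip0 n : 'rV[C]_(1 + n) := row_mx (const_mx (-1)) (const_mx 1).

(* Z is a Z_{E', S'} with E' = {WE = 0}/GE and S' the minimal resolution of
   {WS = 0}/GS, for the involutions induced by changing the sign of the first
   variable. *)
Definition is_Z_quotients m n
    (wE : 'rV[nat]_(1 + m)) (WE : mpoly (1 + m) C) (GE : set (set 'rV[C]_(1 + m)))
    (wS : 'rV[nat]_(1 + n)) (WS : mpoly (1 + n) C) (GS : set (set 'rV[C]_(1 + n)))
    (Z : fspace C) : Prop :=
  exists (sE : whyp_quot wE WE GE -> whyp_quot wE WE GE)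
         (s0 : whyp_quot wS WS GS -> whyp_quot wS WS GS)
         (S' : fspace C) (pi : S' -> whyp_quot wS WS GS) (sS : S' -> S'),
    [/\ induced_by (flip0 m) sE, induced_by (flip0 n) s0,
        is_minimal_resolution pi,
        is_involution sS /\ (forall x, pi (sS x) = s0 (pi x)) &
        is_borcea_voisin sE sS Z].

(* The polynomial sum_i c_i prod_j x_j^(A i j). *)
Definition delsarte n (c : 'rV[C]_n) (A : 'M[nat]_n) : mpoly n C :=
  \sum_i c 0 i *: \prod_j mpolyX C (mnm1 j) ^+ A i j.

Definition nondegenerate n (W : mpoly n C) : Prop :=
  forall x : 'rV[C]_n, x != 0 -> ev W x = 0 -> exists i, ev (mderiv i W) x != 0.

Definition Aut n (W : mpoly n C) : set 'rV[C]_n :=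
  [set a : 'rV[C]_n | (forall i, a 0 i != 0) /\ forall x, ev W (dmul a x) = ev W x].

Definition SL n (W : mpoly n C) : set 'rV[C]_n :=
  [set a : 'rV[C]_n | Aut W a /\ \prod_i a 0 i = 1].

End Spaces.

Definition mxQ n (A : 'M[nat]_n) : 'M[rat]_n := map_mx (fun k : nat => k%:R) A.

Definition charges n (A : 'M[nat]_n) : 'cV[rat]_n := invmx (mxQ A) *m const_mx 1.

(* w = d q is the smallest positive multiple of the charges sequence q with
   integer entries. *)
Definition is_weights n (A : 'M[nat]_n) (w : 'rV[nat]_n) (d : nat) : Prop :=
  [/\ (0 < d)%N,
      forall i, (w 0 i)%:R = d%:R * charges A i 0 &
      forall d' : rat, 0 < d' ->
        (forall i, d' * charges A i 0 \is a Num.int) -> d%:R <= d'].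

Definition weights_sequence n (A : 'M[nat]_n) (w : 'rV[nat]_n) : Prop :=
  exists d, is_weights A w d.

Section Potentials.
Variable R : realType.
Local Notation C := R[i].

Definition admissible n (c : 'rV[C]_n) (A : 'M[nat]_n) : Prop :=
  mxQ A \in unitmx /\
  exists w d,
    [/\ is_weights A w d,
        forall i, \big[gcdn/0%N]_(j | j != i) w ord0 j = 1%N,
        nondegenerate (delsarte c A) &
        (\sum_i w ord0 i)%N = d].

Definition expi (q : rat) : C :=
  (cos (2 * pi * ratr q) +i* sin (2 * pi * ratr q))%C.

Definition diag_exp n (v : 'cV[rat]_n) : 'rV[C]_n := \row_i expi (v i 0).

Definition J n (A : 'M[nat]_n) : set 'rV[C]_n :=
  [set a : 'rV[C]_n | exists k : int, forall i, a 0 i = diag_exp (charges A) 0 i ^ k].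

(* The coset a J_W. *)
Definition coset n (A : 'M[nat]_n) (a : 'rV[C]_n) : set 'rV[C]_n :=
  [set b : 'rV[C]_n | exists2 j, J A j & b = dmul a j].

(* SL(W)/J_W, for W = delsarte c A. *)
Definition SLt n (c : 'rV[C]_n) (A : 'M[nat]_n) : set (set 'rV[C]_n) :=
  [set P | exists2 a, SL (delsarte c A) a & P = coset A a].

Definition SLt_subgroup n (c : 'rV[C]_n) (A : 'M[nat]_n)
    (G : set (set 'rV[C]_n)) : Prop :=
  [/\ G `<=` SLt c A,
      G (coset A (const_mx 1)),
      (forall a b, G (coset A a) -> G (coset A b) -> G (coset A (dmul a b))) &
      (forall a, G (coset A a) -> G (coset A (map_mx GRing.inv a)))].

(* The vanishing in Q/Z of v^T A w, for v and w in Q^n representing the class P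
   of SL(W^T)/J and the class Q of SL(W)/J. *)
Definition pairing_zero n (A : 'M[nat]_n) (P Q : set 'rV[C]_n) : Prop :=
  exists v w : 'cV[rat]_n,
    [/\ P (diag_exp v), Q (diag_exp w) & (v^T *m mxQ A *m w) 0 0 \is a Num.int].

(* The transposed group of G, where cT are the coefficients of the transposed
   potential. *)
Definition transposed n (cT : 'rV[C]_n) (A : 'M[nat]_n)
    (G : set (set 'rV[C]_n)) : set (set 'rV[C]_n) :=
  [set P | SLt cT A^T P /\ forall Q, G Q -> pairing_zero A P Q].

(* x_0^2 + (the polynomial with coefficients c and exponent matrix A). *)
Definition exp_double n (A : 'M[nat]_n) : 'M[nat]_(1 + n) :=
  block_mx (const_mx 2%N) (const_mx 0%N) (const_mx 0%N) A.

Definition coef_double n (c : 'rV[C]_n) : 'rV[C]_(1 + n) :=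
  row_mx (const_mx 1) c.

(* f - g, in separate variables. *)
Definition exp_sum m n (A : 'M[nat]_m) (B : 'M[nat]_n) : 'M[nat]_(m + n) :=
  block_mx A (const_mx 0%N) (const_mx 0%N) B.

Definition coef_diff m n (c : 'rV[C]_m) (c' : 'rV[C]_n) : 'rV[C]_(m + n) :=
  row_mx c (- c').

(* The graph of theta, sending the class of (alpha, beta) with
   det alpha = det beta = 1 to the classes of (1, alpha) and (1, beta). *)
Definition theta m n (A : 'M[nat]_m) (B : 'M[nat]_n)
    (P : set 'rV[C]_(m + n)) (Q : set 'rV[C]_(1 + m)) (Q' : set 'rV[C]_(1 + n)) :=
  exists (alpha : 'rV[C]_m) (beta : 'rV[C]_n),
    [/\ P (row_mx alpha beta), \prod_i alpha 0 i = 1, \prod_i beta 0 i = 1,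
        Q = coset (exp_double A) (row_mx (const_mx 1) alpha) &
        Q' = coset (exp_double B) (row_mx (const_mx 1) beta)].

Definition theta_preimage m n (c : 'rV[C]_m) (A : 'M[nat]_m)
    (c' : 'rV[C]_n) (B : 'M[nat]_n)
    (GE : set (set 'rV[C]_(1 + m))) (GS : set (set 'rV[C]_(1 + n))) :
    set (set 'rV[C]_(m + n)) :=
  [set P | SLt (coef_diff c c') (exp_sum A B) P /\
           exists Q Q', [/\ theta A B P Q Q', GE Q & GS Q']].

End Potentials.

(* Main.v *)
Require Import Defs.
From HB Require Import structures.
From mathcomp Require Import all_boot all_order all_algebra.
From mathcomp Require Import complex.
From mathcomp Require Import boolp classical_sets reals trigo.
From mathcomp Require Import -(notations) mpoly.
From mathcomp Require Import ring.
Set Implicit Arguments.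
Unset Strict Implicit.
Unset Printing Implicit Defensive.
Import Order.TTheory GRing.Theory Num.Theory.
Local Open Scope classical_set_scope.
Local Open Scope ring_scope.

(** Where x_0 is nonzero, a point of {x_0^2 + f = 0} can be scaled to x_0 = z for
    any prescribed z <> 0. Hence, over the locus x_0 y_0 <> 0, the quotient of
    E/G_E x S/G_S by the paired involutions consists of the vectors (z, X, z, Y)
    with f(X) = g(Y) = -z^2, up to scalings, diagonal symmetries and the sign of
    z. Since z is determined up to sign by X, forgetting it gives the points (X, Y)
    of {f - g = 0} with f(X) = g(Y) <> 0, up to scalings and symmetries, that is an
    open subset of X_W / G_W. The scalings that preserve the slice are pairs (t, s)
    with t^u0 = s^v0, and they come from P(v0 u, u0 v) because u0 and v0 are
    coprime ([common_root], [slice_quotients]). In one direction the map is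
    given by monomials ([Rel_Fmap]); in the other one it involves a square root of
    -f, which disappears from invariant functions because the even and the odd
    part of a numerator and of a denominator represent the same fraction
    ([parity_parts], [locmorph_psi]).

    All these varieties are built from cones in affine spaces by subspaces,
    quotients and products. They are handled through [coordinates]: a space is
    described by vectors, defined up to a group of diagonal matrices, and its open
    sets and regular functions are those given locally by polynomials in the
    vectors. That this is compatible with subspaces and products
    ([coordinates_sub], [coordinates_prod]) rests on [semi_invariant_fraction]: by
    independence of characters an invariant fraction can be rewritten with all
    monomials in its terms belonging to one character.

    The resolutions S' of S/G_S and Z of the quotient of E/G_E x S' enter through
    the dense open sets over which they are isomorphisms
    ([birational_assembly]). On the side of Z density comes from irreducibility;
    on the other side it is the density of {F = G <> 0} in {F = G}
    ([nonzero_locus_dense]).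

    It remains to compare the groups. The classes in the preimage of G_E x G_S
    under theta are by definition those of pairs (alpha, beta) such that
    (1, alpha) and (1, beta) belong to classes in G_E and G_S
    ([union_theta_preimage]). For the second part the same has to be shown of the
    transposed groups ([perp_of_pair], [perp_split_pair]): the pairing of W_{E,S}
    is the sum of those of W_E and W_S, and each class has a representative whose
    two blocks have determinant one, again by coprimality of u0 and v0. Finally
    the weights of the transposed sum define the same scalings as their multiple
    (v0 u, u0 v) formed from the transposed potentials ([scalings_weights]). *)

(** * Monomials as characters of diagonal groups *)

Section Monomials.
Variable C : fieldType.

Definition mon n (m : multinom n) (x : 'rV[C]_n) : C := \prod_i x 0 i ^+ m i.

Lemma dmulE n (a x : 'rV[C]_n) i : dmul a x 0 i = a 0 i * x 0 i.
Proof. by rewrite mxE. Qed.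

Lemma dmulA n (a b x : 'rV[C]_n) : dmul a (dmul b x) = dmul (dmul a b) x.
Proof. by apply/rowP => i; rewrite !mxE mulrA. Qed.

Lemma dmulC n (a b : 'rV[C]_n) : dmul a b = dmul b a.
Proof. by apply/rowP => i; rewrite !mxE mulrC. Qed.

Lemma dmul1 n (x : 'rV[C]_n) : dmul (const_mx 1) x = x.
Proof. by apply/rowP => i; rewrite !mxE mul1r. Qed.

Lemma mon_dmul n (m : multinom n) (t x : 'rV[C]_n) :
  mon m (dmul t x) = mon m t * mon m x.
Proof.
by rewrite /mon -big_split; apply: eq_bigr => i _; rewrite dmulE exprMn.
Qed.

Lemma mon_neq0 n (m : multinom n) (t : 'rV[C]_n) :
  (forall i, t 0 i != 0) -> mon m t != 0.
Proof. by move=> t0; apply/prodf_neq0 => i _; rewrite expf_neq0. Qed.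

Lemma evD n (p q : mpoly n C) x : ev (p + q) x = ev p x + ev q x.
Proof. exact: mevalD. Qed.
Lemma evM n (p q : mpoly n C) x : ev (p * q) x = ev p x * ev q x.
Proof. exact: mevalM. Qed.
Lemma evC n (c : C) (x : 'rV_n) : ev (mpolyC n c) x = c.
Proof. exact: mevalC. Qed.
Lemma ev1 n (x : 'rV[C]_n) : ev (1 : mpoly n C) x = 1.
Proof. exact: meval1. Qed.
Lemma ev0 n (x : 'rV[C]_n) : ev (0 : mpoly n C) x = 0.
Proof. exact: meval0. Qed.
Lemma evXn n (p : mpoly n C) k x : ev (p ^+ k) x = ev p x ^+ k.
Proof. by rewrite /ev rmorphXn. Qed.
Lemma evV n i (x : 'rV[C]_n) : ev (mpolyX C (mnm1 i)) x = x 0 i.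
Proof. exact: mevalXU. Qed.
Lemma ev_sum n I (r : seq I) (P : pred I) (F : I -> mpoly n C) x :
  ev (\sum_(i <- r | P i) F i) x = \sum_(i <- r | P i) ev (F i) x.
Proof. by rewrite /ev raddf_sum. Qed.
Lemma evZ n c (p : mpoly n C) x : ev (c *: p) x = c * ev p x.
Proof. exact: mevalZ. Qed.
Lemma evX n m (x : 'rV[C]_n) : ev (mpolyX C m) x = mon m x.
Proof. exact: mevalX. Qed.

Lemma ev_expand n k (p : mpoly n C) x : (mmeasure (@mdeg n) p <= k)%N ->
  ev p x = \sum_(m : bmultinom n k) mcoeff m p * mon m x.
Proof.
move=> /mpolywE {1}->; rewrite ev_sum.
by apply: eq_bigr => m _; rewrite evZ evX.
Qed.

Definition diag_monoid n (T : set 'rV[C]_n) : Prop :=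
  [/\ T (const_mx 1), (forall s t, T s -> T t -> T (dmul s t)) &
      forall t, T t -> forall i, t 0 i != 0].

Definition same_char n (T : set 'rV[C]_n) (m m' : multinom n) : Prop :=
  forall t, T t -> mon m t = mon m' t.

(** Independence of characters: a vanishing linear combination of monomials on
    T vanishes separately on each class of monomials with equal restriction. *)
Lemma char_independence n (T : set 'rV[C]_n) (I : finType)
    (mn : I -> multinom n) (c : I -> C) (m0 : multinom n) : diag_monoid T ->
  (forall t, T t -> \sum_i c i * mon (mn i) t = 0) ->
  \sum_(i | `[< same_char T (mn i) m0 >]) c i = 0.
Proof.
move=> [T1 TM T0] sum0.
have nsame i : ~ same_char T (mn i) m0 -> exists t, T t /\ mon (mn i) t != mon m0 t.
  move=> h; apply: contrapT => h'; apply: h => t Tt.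
  by apply: contrapT => /eqP h; apply: h'; exists t.
pose tau i : 'rV[C]_n :=
  if pselect (~ same_char T (mn i) m0) is left h then projT1 (cid (nsame i h))
  else const_mx 1.
have tauP i : ~ same_char T (mn i) m0 -> T (tau i) /\ mon (mn i) (tau i) != mon m0 (tau i).
  rewrite /tau; case: pselect => // h _; exact: (projT2 (cid (nsame i h))).
pose l := [seq i <- enum I | ~~ `[< same_char T (mn i) m0 >]].
pose coef i := \prod_(j <- l) (mon (mn i) (tau j) - mon (mn j) (tau j)).
have Tl j : j \in l -> T (tau j) /\ mon (mn j) (tau j) != mon m0 (tau j).
  by rewrite mem_filter => /andP[/asboolPn /tauP].
(* Each j in l yields the operator t |-> tau j * t minus a scalar, which kills
   the character of j and multiplies that of m0 by a nonzero scalar. *)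
have killed (s : seq I) : {subset s <= l} -> forall t, T t ->
    \sum_i c i * (\prod_(j <- s) (mon (mn i) (tau j) - mon (mn j) (tau j)))
           * mon (mn i) t = 0.
  elim: s => [|j s IH] sl t Tt.
    rewrite -[RHS](sum0 t Tt); apply: eq_bigr => i _.
    by rewrite big_nil mulr1.
  have sl' : {subset s <= l} by move=> k ks; apply: sl; rewrite inE ks orbT.
  have [Tj _] := Tl j (sl j (mem_head _ _)).
  have e1 := IH sl' (dmul (tau j) t) (TM _ _ Tj Tt).
  have /(congr1 (fun z => mon (mn j) (tau j) * z)) /= := IH sl' t Tt.
  rewrite mulr0 => e2; move/eqP: e1.
  rewrite -[X in _ == X]e2 -subr_eq0 mulr_sumr -sumrB => /eqP e1.
  rewrite -[RHS]e1; apply: eq_bigr => i _.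
  rewrite big_cons mon_dmul mulrBl !mulrBr mulrBl; congr (_ - _).
    by rewrite -!mulrA; congr (_ * _); rewrite mulrC -!mulrA; congr (_ * _); rewrite mulrC.
  by rewrite !mulrA [_ * c i]mulrC.
have := killed l (fun _ h => h) _ T1.
rewrite (bigID (fun i => `[< same_char T (mn i) m0 >])) /= [X in _ + X]big1 ?addr0.
  pose d := \prod_(j <- l) (mon m0 (tau j) - mon (mn j) (tau j)).
  have d0 : d != 0.
    rewrite /d prodf_seq_neq0; apply/allP => j jl /=.
    by rewrite subr_eq0 eq_sym; case: (Tl j jl).
  rewrite (eq_bigr (fun i => c i * (d * mon m0 (const_mx 1)))) => [|i /asboolP im].
    rewrite -mulr_suml => /eqP; rewrite mulf_eq0 => /orP[/eqP //|].
    rewrite mulf_eq0 (negPf d0) /= (negPf (mon_neq0 _ _)) // => i; exact: T0.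
  rewrite -mulrA (im _ T1); congr (_ * (_ * _)).
  by apply: eq_big_seq => j jl; rewrite im //; case: (Tl j jl).
move=> i ni; rewrite (big_rem i) /= ?subrr ?mul0r ?mulr0 ?mul0r //.
by rewrite mem_filter ni mem_enum.
Qed.

(** The sum is the total of its parts over the characters that occur, and a
    nonzero part has a nonzero term. *)
Lemma pick_char n (T : set 'rV[C]_n) (I : finType)
    (mn : I -> multinom n) (F : I -> C) : \sum_i F i != 0 ->
  exists i0, F i0 != 0 /\ \sum_(i | `[< same_char T (mn i) (mn i0) >]) F i != 0.
Proof.
move=> F0.
have [//|none] := pselect (exists i0, F i0 != 0 /\ 
  \sum_(i | `[< same_char T (mn i) (mn i0) >]) F i != 0).
have zero i0 : F i0 != 0 -> \sum_(i | `[< same_char T (mn i) (mn i0) >]) F i = 0.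
  by move=> h; apply: contrapT => /eqP h'; apply: none; exists i0.
case/eqP: F0.
have small k : forall P : pred I, (#|P| <= k)%N ->
    (forall i j, same_char T (mn i) (mn j) -> P i = P j) ->
    \sum_(i | P i) F i = 0.
  elim: k => [|k IH] P Pk Psat.
    by rewrite big_pred0 // => i; apply/negbTE/negP => Pi;
       rewrite leqn0 in Pk; move/eqP/card0_eq: Pk => /(_ i); rewrite unfold_in Pi.
  have [[i0 [Pi0 Fi0]]|no] := pselect (exists i0, P i0 /\ F i0 != 0); last first.
    apply: big1 => i Pi; apply: contrapT => /eqP Fi; apply: no; by exists i.
  rewrite (bigID (fun i => `[< same_char T (mn i) (mn i0) >])) /=.
  rewrite (eq_bigl (fun i => `[< same_char T (mn i) (mn i0) >])) => [|i].
    rewrite zero // add0r; apply: IH.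
      rewrite -ltnS; apply: leq_trans Pk; apply: proper_card.
      apply/properP; split; first by apply/fintype.subsetP => i; rewrite !unfold_in => /andP[].
      exists i0; rewrite !unfold_in // Pi0 /= negbK; apply/asboolP => t _ //.
    move=> i j ij /=; rewrite (Psat i j ij); congr (_ && ~~ _).
    by apply/asboolP/asboolP => h t Tt; rewrite -h // ij.
  by apply/andP/idP => [[]//|/asboolP h]; rewrite (Psat _ _ h) Pi0; split=> //; apply/asboolP.
by apply: (small #|I|); rewrite ?max_card.
Qed.

(** A fraction a/b that represents a T-invariant function can be replaced by
    one whose numerator and denominator are sums of monomials with a single
    common character of T: the equation h b = a splits into its isotypic parts
    by independence of characters, and one part of b does not vanish at x. The
    common character is that of a monomial m0 with m0(x) <> 0, by which one may
    divide near x. The fourth clause carries over the vanishing of b, for the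
    description of open sets. *)
Lemma semi_invariant_fraction n (T : set 'rV[C]_n) (D : set 'rV[C]_n)
    (h : 'rV[C]_n -> C) (a b : mpoly n C) (x : 'rV[C]_n) : diag_monoid T ->
  (forall t y, T t -> D y -> D (dmul t y) /\ h (dmul t y) = h y) ->
  ev b x != 0 -> (forall y, D y -> ev b y != 0 -> h y = ev a y / ev b y) ->
  exists (m0 : multinom n) (I : finType) (mn : I -> multinom n) (ca cb : I -> C),
    [/\ forall i, same_char T (mn i) m0, mon m0 x != 0,
        \sum_i cb i * mon (mn i) x != 0,
        (forall y, (forall t, T t -> ev b (dmul t y) = 0) ->
          \sum_i cb i * mon (mn i) y = 0) &
        forall y, D y ->
          h y * (\sum_i cb i * mon (mn i) y) = \sum_i ca i * mon (mn i) y].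
Proof.
move=> mT hT bx hab.
(* After multiplying by b, the equation also holds where b vanishes. *)
pose b2 := b ^+ 2; pose a2 := a * b.
have hab2 y : D y -> h y * ev b2 y = ev a2 y.
  move=> Dy; rewrite evXn evM; have [->|by0] := eqVneq (ev b y) 0.
    by rewrite expr0n /= !mulr0.
  by rewrite hab // expr2 mulrA divfK.
pose k := maxn (mmeasure (@mdeg n) a2) (mmeasure (@mdeg n) b2).
have a2E y := @ev_expand n k a2 y (leq_maxl _ _).
have b2E y := @ev_expand n k b2 y (leq_maxr _ _).
have : ev b2 x != 0 by rewrite evXn expf_neq0.
rewrite b2E => /(@pick_char _ T _ (fun m : bmultinom n k => m : multinom n)) [m0 [m0x m0c]].
pose P (m : bmultinom n k) := `[< same_char T m m0 >].
pose I : finType := {m : bmultinom n k | P m}.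
pose vl (i : I) : bmultinom n k := sval i.
have sumI (F : bmultinom n k -> C) : \sum_(m | P m) F m = \sum_(i : I) F (vl i).
  by rewrite -big_sub.
exists m0, I, (fun i => vl i : multinom n),
  (fun i => mcoeff (vl i) a2), (fun i => mcoeff (vl i) b2).
split.
- by move=> i; apply/asboolP; exact: (svalP i).
- by move: m0x; rewrite mulf_eq0 negb_or => /andP[].
- by rewrite -(sumI (fun m => mcoeff m b2 * mon m x)).
- move=> y b0; rewrite -(sumI (fun m => mcoeff m b2 * mon m y)).
  apply: (char_independence (mn := fun m : bmultinom n k => m : multinom n)
    (c := fun m => mcoeff m b2 * mon m y) m0 mT) => t /b0 bt.
  rewrite -[RHS](_ : ev b2 (dmul t y) = 0); last by rewrite evXn bt expr0n.
  by rewrite b2E; apply: eq_bigr => m _; rewrite mon_dmul -mulrA [mon m y * _]mulrC.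
- move=> y Dy.
  rewrite -(sumI (fun m => mcoeff m b2 * mon m y)) -(sumI (fun m => mcoeff m a2 * mon m y)).
  apply/eqP; rewrite -subr_eq0 mulr_sumr -sumrB; apply/eqP.
  apply: (char_independence (mn := fun m : bmultinom n k => m : multinom n)
    (c := fun m => h y * (mcoeff m b2 * mon m y) - mcoeff m a2 * mon m y) m0 mT).
  move=> t Tt; have [Dty hty] := hT t y Tt Dy.
  have /eqP := hab2 _ Dty; rewrite -subr_eq0 hty a2E b2E mulr_sumr -sumrB => /eqP h0.
  rewrite -[RHS]h0; apply: eq_bigr => m _.
  by rewrite !mon_dmul mulrBl -!mulrA [mon m y * _]mulrC.
Qed.

End Monomials.

(** * Spaces with homogeneous coordinates *)

Section Coordinates.
Variable C : fieldType.
Implicit Types X Y : fspace C.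

Lemma poly_subst m k (p : mpoly m C) (q : 'I_m -> mpoly k C) :
  exists p' : mpoly k C, forall x, ev p' x = ev p (\row_i ev (q i) x).
Proof.
exists (\sum_(mm <- msupp p) mcoeff mm p *: \prod_i q i ^+ mm i) => x.
rewrite /ev [in RHS]mevalE -/(ev _ x) ev_sum; apply: eq_bigr => mm _.
rewrite evZ; congr (_ * _); rewrite /ev rmorph_prod; apply: eq_bigr => i _.
by rewrite rmorphXn mxE.
Qed.

Definition psum n (I : finType) (mn : I -> multinom n) (c : I -> C) : mpoly n C :=
  \sum_i c i *: mpolyX C (mn i).

Lemma ev_psum n (I : finType) (mn : I -> multinom n) (c : I -> C) x :
  ev (psum mn c) x = \sum_i c i * mon (mn i) x.
Proof. by rewrite ev_sum; apply: eq_bigr => i _; rewrite evZ evX. Qed.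

Lemma ev_psum_dmul n (T : set 'rV[C]_n) (m0 : multinom n) (I : finType)
    (mn : I -> multinom n) (c : I -> C) t x :
  (forall i, same_char T (mn i) m0) -> T t ->
  ev (psum mn c) (dmul t x) = mon m0 t * ev (psum mn c) x.
Proof.
move=> sc Tt; rewrite !ev_psum mulr_sumr; apply: eq_bigr => i _.
by rewrite mon_dmul (sc i _ Tt) mulrCA.
Qed.

Definition rational_at n X (rep : 'rV[C]_n -> X -> Prop) (V : set X)
    (f : X -> C) (x : 'rV[C]_n) : Prop :=
  exists a b : mpoly n C, ev b x != 0 /\
    forall y q, rep y q -> V q -> ev b y != 0 -> f q = ev a y / ev b y.

Definition zariski_nbhs n X (rep : 'rV[C]_n -> X -> Prop) (V : set X)
    (x : 'rV[C]_n) : Prop :=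
  exists b : mpoly n C, ev b x != 0 /\
    forall y q, rep y q -> ev b y != 0 -> V q.

(** [rep x p] reads: x is a vector of coordinates of the point p. Coordinates
    of a point are not unique, as for the points of a weighted projective space
    or of its quotients; the topology and the regular functions of X are those
    of the set of coordinate vectors, descended to X. *)
Definition coordinates n X (rep : 'rV[C]_n -> X -> Prop) : Prop :=
  [/\ forall p, exists x, rep x p,
      forall x p q, rep x p -> rep x q -> p = q,
      forall V : set X, opn V <-> forall x p, rep x p -> V p -> zariski_nbhs rep V x &
      forall (V : set X) f, opn V ->
        (reg V f <-> forall x p, rep x p -> V p -> rational_at rep V f x)].

Definition torus_orbits n X (T : set 'rV[C]_n) (rep : 'rV[C]_n -> X -> Prop) : Prop :=
  [/\ diag_monoid T, forall t x p, T t -> rep x p -> rep (dmul t x) p &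
      forall x y p, rep x p -> rep y p -> exists2 t, T t & y = dmul t x].

Lemma zariski_nbhsI n X (rep : 'rV[C]_n -> X -> Prop) (U V : set X) x :
  zariski_nbhs rep U x -> zariski_nbhs rep V x -> zariski_nbhs rep (U `&` V) x.
Proof.
move=> [b [bx bU]] [b' [b'x b'V]]; exists (b * b'); rewrite evM mulf_neq0 //.
split=> // y q yq; rewrite evM mulf_eq0 negb_or => /andP[h h'].
by split; [exact: bU yq h|exact: b'V yq h'].
Qed.

Lemma zariski_nbhs_sub n X (rep : 'rV[C]_n -> X -> Prop) (U V : set X) x :
  U `<=` V -> zariski_nbhs rep U x -> zariski_nbhs rep V x.
Proof.
by move=> UV [b [bx bU]]; exists b; split=> // y q yq /(bU _ _ yq) /UV.
Qed.

Lemma rational_at_loc n X (rep : 'rV[C]_n -> X -> Prop) (U V : set X) f g x :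
  zariski_nbhs rep U x -> rational_at rep V f x ->
  (forall q, U q -> V q -> f q = g q) -> rational_at rep V g x.
Proof.
move=> [b [bx bU]] [a' [b' [b'x h]]] fg.
exists (a' * b), (b' * b); rewrite evM mulf_neq0 //; split=> // y q yq Vq.
rewrite !evM mulf_eq0 negb_or => /andP[b'y by0].
by rewrite -fg ?(h y q yq) //; [rewrite -mulf_div divff ?mulr1|exact: bU yq _].
Qed.

Lemma rational_at_sub n X (rep : 'rV[C]_n -> X -> Prop) (U V W : set X) f x :
  U `&` W `<=` V -> zariski_nbhs rep U x -> rational_at rep V f x ->
  rational_at rep W f x.
Proof.
move=> UV [b [bx bU]] [a' [b' [b'x h]]].
exists (a' * b), (b' * b); rewrite evM mulf_neq0 //; split=> // y q yq Wq.
rewrite !evM mulf_eq0 negb_or => /andP[b'y by0].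
rewrite (h y q yq) //; first by rewrite -mulf_div divff ?mulr1.
by apply: UV; split=> //; exact: bU yq _.
Qed.

Lemma rational_at_cst n X (rep : 'rV[C]_n -> X -> Prop) (V : set X) c x :
  rational_at rep V (fun=> c) x.
Proof. by exists (mpolyC n c), 1; split=> [|y q _ _ _]; rewrite ev1 ?evC ?oner_eq0 ?divr1. Qed.

Lemma rational_atD n X (rep : 'rV[C]_n -> X -> Prop) (V : set X) f g x :
  rational_at rep V f x -> rational_at rep V g x ->
  rational_at rep V (fun q => f q + g q) x.
Proof.
move=> [a [b [bx h]]] [a' [b' [b'x h']]].
exists (a * b' + a' * b), (b * b'); rewrite evM mulf_neq0 //; split=> // y q yq Vq.
rewrite !evD !evM mulf_eq0 negb_or => /andP[by0 b'y0].
by rewrite (h y q) // (h' y q) // addf_div.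
Qed.

Lemma rational_atM n X (rep : 'rV[C]_n -> X -> Prop) (V : set X) f g x :
  rational_at rep V f x -> rational_at rep V g x ->
  rational_at rep V (fun q => f q * g q) x.
Proof.
move=> [a [b [bx h]]] [a' [b' [b'x h']]].
exists (a * a'), (b * b'); rewrite evM mulf_neq0 //; split=> // y q yq Vq.
rewrite !evM mulf_eq0 negb_or => /andP[by0 b'y0].
by rewrite (h y q) // (h' y q) // mulf_div.
Qed.

Lemma rational_at_sum n X (rep : 'rV[C]_n -> X -> Prop) (V : set X) k
    (F : 'I_k -> X -> C) x :
  (forall i, rational_at rep V (F i) x) ->
  rational_at rep V (fun q => \sum_i F i q) x.
Proof.
elim: k F => [|k IH] F h.
  have -> : (fun q => \sum_i F i q) = (fun=> 0) by apply/funext => q; rewrite big_ord0.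
  exact: rational_at_cst.
have -> : (fun q => \sum_i F i q) = (fun q => F ord0 q + \sum_i F (lift ord0 i) q).
  by apply/funext => q; rewrite big_ord_recl.
by apply: rational_atD => //; apply: IH.
Qed.

Lemma coordinates_space n X (rep : 'rV[C]_n -> X -> Prop) :
  coordinates rep -> is_space X.
Proof.
move=> [surj _ oX rX]; split; first split.
- by apply/oX => x p _ _; exists 1; rewrite ev1 oner_eq0.
- move=> U V oU oV; apply/oX => x p xp [Up Vp]; apply: zariski_nbhsI.
    exact: (oX U).1 oU _ _ xp Up.
  exact: (oX V).1 oV _ _ xp Vp.
- move=> F oF; apply/oX => x p xp [U FU Up].
  apply: (@zariski_nbhs_sub _ _ _ U) => [q Uq|]; first by exists U.
  exact: (oX U).1 (oF _ FU) _ _ xp Up.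
- move=> U V f oU oV VU /(rX U f oU) fU; apply/rX => // x p xp Vp.
  apply: (@rational_at_sub _ _ _ V U) (fU x p xp (VU _ Vp)).
    by move=> q [/VU].
  exact: (oX V).1 oV _ _ xp Vp.
- move=> U f oU loc; apply/rX => // x p xp Up.
  have [V [g [oV Vp rg fg]]] := loc p Up.
  have Vx := (oX V).1 oV _ _ xp Vp.
  apply: (@rational_at_loc _ _ _ V _ g) => //.
    apply: (rational_at_sub _ Vx ((rX V g oV).1 rg x p xp Vp)).
    by move=> q [].
  by move=> q Vq Uq; rewrite fg.
Qed.

Lemma coordinates_affine n :
  coordinates (fun (x : 'rV[C]_n) (p : affine_space C n) => x = p).
Proof.
split=> [p|x p q -> //|V|V f oV]; first by exists p.
- split=> [[I ->] x _ <- nx|h].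
    have : exists b, I b /\ ev b x != 0.
      apply: contrapT => no; apply: nx => b Ib; apply: contrapT => /eqP bx.
      by apply: no; exists b.
    by move=> [b [Ib bx]]; exists b; split=> // y _ <- /eqP by0 /(_ b Ib).
  exists [set b | forall y, ~ V y -> ev b y = 0]; apply/seteqP; split=> x.
    move=> Vx zx; have [b [bx hb]] := h x x erefl Vx.
    move/eqP: bx; apply; apply: zx => y nVy; apply: contrapT => /eqP by0.
    by apply: nVy; apply: hb by0.
  by move=> nz; apply: contrapT => nV; apply: nz => b; apply.
- split=> [h x _ <- Vx|h x Vx].
    by have [a [b [bx hb]]] := h x Vx; exists a, b; split=> // y _ <-; apply: hb.
  by have [a [b [bx hb]]] := h x x erefl Vx; exists a, b; split=> // y; apply: hb.
Qed.

Lemma torus_orbits_affine n :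
  torus_orbits [set const_mx 1] (fun (x : 'rV[C]_n) (p : affine_space C n) => x = p).
Proof.
split; first split=> [|s t -> ->|t -> i]; rewrite ?dmul1 ?mxE ?oner_eq0 //.
  by move=> t x p -> ->; rewrite dmul1.
by move=> x y p -> ->; exists (const_mx 1); rewrite ?dmul1.
Qed.

Definition quot_rep n X (rep : 'rV[C]_n -> X -> Prop) (r : X -> X -> Prop)
    (x : 'rV[C]_n) (c : quot r) : Prop :=
  exists2 p, rep x p & c = qproj r p.

(** The record of a class contains a proof, whence the appeal to proof
    irrelevance here and for subspaces. *)
Lemma qproj_surj X (r : X -> X -> Prop) (c : quot r) : exists p, c = qproj r p.
Proof.
case: c => c [p cp]; exists p; rewrite /qproj; subst c.
by congr exist; exact: Prop_irrelevance.
Qed.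

Lemma qproj_eq X (r : X -> X -> Prop) p q : qproj r p = qproj r q <-> r p = r q.
Proof.
split=> [/(congr1 sval) //|e]; rewrite /qproj; move: (ex_intro _ p _) (ex_intro _ q _).
by rewrite -e => h h'; congr exist; exact: Prop_irrelevance.
Qed.

Lemma coordinates_quot n X (rep : 'rV[C]_n -> X -> Prop) (r : X -> X -> Prop) :
  coordinates rep -> coordinates (@quot_rep n X rep r).
Proof.
move=> [surj fn oX rX]; split.
- move=> c; have [p ->] := qproj_surj c; have [x xp] := surj p.
  by exists x, p.
- by move=> x _ _ [p xp ->] [q xq ->]; rewrite (fn x p q).
- move=> V; split=> [/oX h x _ [p xp ->] Vp|h].
    have [b [bx hb]] := h x p xp Vp; exists b; split=> // y _ [q yq ->].
    exact: hb.
  apply/oX => x p xp Vp; have [b [bx hb]] := h x _ (ex_intro2 _ _ p xp erefl) Vp.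
  by exists b; split=> // y q yq by0; apply: (hb y _ _ by0); exists q.
- move=> V f oV; split=> [/(rX _ _ oV) h x _ [p xp ->] Vp|h].
    have [a [b [bx hb]]] := h x p xp Vp; exists a, b; split=> // y _ [q yq ->].
    exact: hb.
  apply/(rX _ _ oV) => x p xp Vp.
  have [a [b [bx hb]]] := h x _ (ex_intro2 _ _ p xp erefl) Vp.
  by exists a, b; split=> // y q yq Vq by0; apply: (hb y _ _ _ by0) => //; exists q.
Qed.

(** The quotient by any relation has coordinates, but its fibres are orbits of a
    diagonal monoid T only if the relation is the trace of an action of T. *)
Lemma torus_orbits_quot n X (rep : 'rV[C]_n -> X -> Prop) (r : X -> X -> Prop)
    (T : set 'rV[C]_n) : diag_monoid T ->
  (forall t x p, T t -> rep x p -> exists q, rep (dmul t x) q) ->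
  (forall x p y q, rep x p -> rep y q ->
     (qproj r p = qproj r q <-> exists2 t, T t & y = dmul t x)) ->
  torus_orbits T (@quot_rep n X rep r).
Proof.
move=> mT stab orb; split=> // [t x c Tt [p xp ->]|x y c [p xp ->] [q yq]].
  have [q txq] := stab t x p Tt xp; exists q => //.
  by apply/(orb x p _ q xp txq); exists t.
by move/(orb x p y q xp yq).
Qed.

(** The function f read on coordinate vectors, extended by a0 to the vectors
    that are not coordinates of any point. *)
Definition on_coord n X A (rep : 'rV[C]_n -> X -> Prop) (a0 : A) (f : X -> A)
    (x : 'rV[C]_n) : A :=
  if pselect (exists p, rep x p) is left h then f (projT1 (cid h)) else a0.

Lemma on_coordE n X A (rep : 'rV[C]_n -> X -> Prop) (a0 : A) f x p :
  (forall x p q, rep x p -> rep x q -> p = q) ->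
  rep x p -> on_coord rep a0 f x = f p.
Proof.
move=> fn xp; rewrite /on_coord; case: pselect => [h|[]]; last by exists p.
by congr f; apply: fn xp; exact: (projT2 (cid h)).
Qed.

(** [semi_invariant_fraction], applied to the pull-back of f to coordinate
    vectors. *)
Lemma rational_at_semi n X (T : set 'rV[C]_n) (rep : 'rV[C]_n -> X -> Prop)
    (V : set X) f x :
  (forall x p q, rep x p -> rep x q -> p = q) -> torus_orbits T rep ->
  rational_at rep V f x ->
  exists (m0 : multinom n) (I : finType) (mn : I -> multinom n) (ca cb : I -> C),
    [/\ forall i, same_char T (mn i) m0, mon m0 x != 0, ev (psum mn cb) x != 0 &
        forall y q, rep y q -> V q -> f q * ev (psum mn cb) y = ev (psum mn ca) y].
Proof.
move=> fn [mT stab orb] [a [b [bx hab]]].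
pose D : set 'rV[C]_n := [set y | exists q, rep y q /\ V q].
have [|y [q [yq Vq]] by0|m0 [I [mn [ca [cb [sc m0x cbx _ h]]]]]] :=
  @semi_invariant_fraction C n T D (on_coord rep 0 f) a b x mT _ bx.
- move=> t y Tt [q [yq Vq]]; have tyq := stab _ _ _ Tt yq.
  split; first by exists q.
  by rewrite (on_coordE _ _ fn tyq) (on_coordE _ _ fn yq).
- by rewrite (on_coordE _ _ fn yq); apply: hab.
exists m0, I, mn, ca, cb; split=> //; first by rewrite ev_psum.
move=> y q yq Vq; rewrite !ev_psum -h; last by exists q.
by rewrite (on_coordE _ _ fn yq).
Qed.

Lemma zariski_nbhs_semi n X (T : set 'rV[C]_n) (rep : 'rV[C]_n -> X -> Prop)
    (V : set X) x :
  (forall x p q, rep x p -> rep x q -> p = q) -> torus_orbits T rep ->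
  zariski_nbhs rep V x ->
  exists (m0 : multinom n) (I : finType) (mn : I -> multinom n) (c : I -> C),
    [/\ forall i, same_char T (mn i) m0, mon m0 x != 0, ev (psum mn c) x != 0 &
        forall y q, rep y q -> ev (psum mn c) y != 0 -> V q].
Proof.
move=> fn [mT stab _] [b [bx hb]].
have [|//|m0 [I [mn [_ [cb [sc m0x cbx b0 _]]]]]] :=
  @semi_invariant_fraction C n T set0 (fun=> 0) 0 b x mT _ bx; first by [].
exists m0, I, mn, cb; split=> //; first by rewrite ev_psum.
move=> y q yq; rewrite ev_psum => cby; apply: contrapT => nVq.
case/eqP: cby; apply: b0 => t Tt; apply: contrapT => /eqP bty.
exact: nVq (hb _ q (stab _ _ _ Tt yq) bty).
Qed.

End Coordinates.

(** * Subspaces and products *)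

Section SubAndProduct.
Variable C : fieldType.
Implicit Types X Y : fspace C.

Definition sub_rep n X (rep : 'rV[C]_n -> X -> Prop) (A : set X)
    (x : 'rV[C]_n) (p : sub A) : Prop := rep x (sval p).

Lemma sub_inj X (A : set X) (p q : sub A) : sval p = sval q -> p = q.
Proof.
case: p q => [p Ap] [q Aq] /= pq; subst q; congr exist; exact: Prop_irrelevance.
Qed.

Lemma torus_orbits_sub n X (T : set 'rV[C]_n) (rep : 'rV[C]_n -> X -> Prop) (A : set X) :
  torus_orbits T rep -> torus_orbits T (@sub_rep n X rep A).
Proof.
move=> [mT stab orb]; split=> // [t x p Tt|x y p]; first exact: stab.
exact: orb.
Qed.

(** The structure of a subspace is given by local extensions to X, and an
    extension must be invariant. A semi-invariant fraction extends as it stands: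
    its denominator is nonzero on a T-stable set, and the quotient is constant
    on the orbits there. *)
Lemma coordinates_sub n X (T : set 'rV[C]_n) (rep : 'rV[C]_n -> X -> Prop) (A : set X) :
  coordinates rep -> torus_orbits T rep -> coordinates (@sub_rep n X rep A).
Proof.
move=> [surj fn oX rX] Trep; have [mT stab orb] := Trep.
have Tsub := torus_orbits_sub A Trep.
have fn' x (p q : sub A) : sub_rep rep x p -> sub_rep rep x q -> p = q.
  by move=> xp xq; apply: sub_inj; exact: fn xp xq.
have chi0 (m : multinom n) t : T t -> mon m t != 0.
  by move=> Tt; apply: mon_neq0; case: mT => _ _ /(_ t Tt).
split=> // [p|V|V f oV]; first by have [x xp] := surj (sval p); exists x.
- split=> [[U oU ->] x p xp Up|h].
    have [b [bx hb]] := (oX U).1 oU _ _ xp Up.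
    by exists b; split=> // y q yq /(hb _ _ yq).
  exists [set q | exists x, rep x q /\ exists b,
    [/\ ev b x != 0, (forall t y, T t -> (ev b (dmul t y) != 0) = (ev b y != 0)) &
        forall y q', sub_rep rep y q' -> ev b y != 0 -> V q']].
    apply/oX => x q xq [x0 [x0q [b [bx0 bT hb]]]].
    have [t Tt xt] := orb _ _ _ x0q xq; exists b; split; first by rewrite xt bT.
    by move=> y q' yq' by0; exists y; split=> //; exists b.
  apply/seteqP; split=> [p Vp|p [x [xp [b [bx _ hb]]]]]; last exact: hb bx.
  have [x xp] := surj (sval p).
  have [m0 [I [mn [c [sc _ cx hc]]]]] := zariski_nbhs_semi fn' Tsub (h x p xp Vp).
  exists x; split=> //; exists (psum mn c); split=> // t y Tt.
  by rewrite (ev_psum_dmul c y sc Tt) mulf_eq0 (negPf (chi0 _ _ Tt)).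
- have oVh : forall x p, sub_rep rep x p -> V p -> zariski_nbhs (@sub_rep n X rep A) V x.
    case: oV => U oU VU x p xp; rewrite VU => Up.
    have [b [bx hb]] := (oX U).1 oU _ _ xp Up.
    by exists b; split=> // y q yq /(hb _ _ yq).
  split=> [rf x p xp Vp|h p Vp].
    have [U [g [oU Up rg fg]]] := rf p Vp.
    have [b [bx bU]] := (oX U).1 oU _ _ xp Up.
    have [a [b' [b'x h]]] := (rX U g oU).1 rg _ _ xp Up.
    exists (a * b), (b' * b); rewrite evM mulf_neq0 //; split=> // y q yq Vq.
    rewrite !evM mulf_eq0 negb_or => /andP[b'y by0].
    have Uq : U (sval q) by exact: bU yq by0.
    by rewrite fg // (h y _ yq) // -mulf_div divff ?mulr1.
  have [x xp] := surj (sval p).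
  have [m0 [I [mn [ca [cb [sc _ cbx hc]]]]]] := rational_at_semi fn' Tsub (h x p xp Vp).
  pose cd q := projT1 (cid (surj q)).
  have cdP q : rep (cd q) q := projT2 (cid (surj q)).
  pose g q := ev (psum mn ca) (cd q) / ev (psum mn cb) (cd q).
  have gE y q : rep y q -> g q = ev (psum mn ca) y / ev (psum mn cb) y.
    move=> yq; have [t Tt cdt] := orb _ _ _ yq (cdP q).
    rewrite /g cdt !(ev_psum_dmul _ y sc Tt) -mulf_div divff ?mul1r //; exact: chi0.
  pose U := [set q | exists y, rep y q /\ ev (psum mn cb) y != 0].
  have Unz y q : rep y q -> U q -> ev (psum mn cb) y != 0.
    move=> yq [y' [y'q y'0]]; have [t Tt ->] := orb _ _ _ y'q yq.
    by rewrite (ev_psum_dmul cb y' sc Tt) mulf_neq0 // chi0.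
  have oU : opn U.
    apply/oX => y q yq Uq; exists (psum mn cb); split; first exact: Unz yq Uq.
    by move=> z q' zq' z0; exists z.
  exists U, g; split=> //.
  + by exists x.
  + apply/rX => // y q yq Uq; exists (psum mn ca), (psum mn cb).
    by split; [exact: Unz yq Uq|move=> z q' /gE].
  + move=> q Vq [y [yq y0]]; rewrite (gE y) //.
    by apply: (canRL (mulfK y0)); apply: hc.
Qed.

Definition prod_rep m n X Y (repX : 'rV[C]_m -> X -> Prop) (repY : 'rV[C]_n -> Y -> Prop)
    (z : 'rV[C]_(m + n)) (p : prod_space X Y) : Prop :=
  repX (lsubmx z) p.1 /\ repY (rsubmx z) p.2.

Definition prod_torus m n (S : set 'rV[C]_m) (T : set 'rV[C]_n) : set 'rV[C]_(m + n) :=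
  [set z | S (lsubmx z) /\ T (rsubmx z)].

Lemma dmul_row_mx m n (s x : 'rV[C]_m) (t y : 'rV[C]_n) :
  dmul (row_mx s t) (row_mx x y) = row_mx (dmul s x) (dmul t y).
Proof.
apply/rowP => i; rewrite !mxE; case: splitP => j _; by rewrite !mxE.
Qed.

Lemma lsubmx_dmul m n (t z : 'rV[C]_(m + n)) :
  lsubmx (dmul t z) = dmul (lsubmx t) (lsubmx z).
Proof. by apply/rowP => i; rewrite !mxE. Qed.

Lemma rsubmx_dmul m n (t z : 'rV[C]_(m + n)) :
  rsubmx (dmul t z) = dmul (rsubmx t) (rsubmx z).
Proof. by apply/rowP => i; rewrite !mxE. Qed.

Lemma const_row_mx (A : Type) m n (a : A) :
  const_mx a = row_mx (const_mx a) (const_mx a) :> 'rV[A]_(m + n).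
Proof. by rewrite row_mx_const. Qed.

Lemma torus_orbits_prod m n X Y (S : set 'rV[C]_m) (T : set 'rV[C]_n)
    (repX : 'rV[C]_m -> X -> Prop) (repY : 'rV[C]_n -> Y -> Prop) :
  torus_orbits S repX -> torus_orbits T repY ->
  torus_orbits (prod_torus S T) (@prod_rep m n X Y repX repY).
Proof.
move=> [[S1 SM S0] stS oS] [[T1 TM T0] stT oT]; split; first split.
- by rewrite /prod_torus /= const_row_mx row_mxKl row_mxKr.
- by move=> s t [? ?] [? ?]; split; rewrite ?lsubmx_dmul ?rsubmx_dmul; [apply: SM|apply: TM].
- move=> t [Sl Tr] i; rewrite -(hsubmxK t) mxE.
  by case: splitP => j _; [exact: S0|exact: T0].
- move=> t z p [Sl Tr] [? ?]; split; rewrite ?lsubmx_dmul ?rsubmx_dmul.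
    exact: stS.
  exact: stT.
- move=> x y p [xl xr] [yl yr].
  have [s Ss es] := oS _ _ _ xl yl; have [t Tt et] := oT _ _ _ xr yr.
  exists (row_mx s t); first by rewrite /prod_torus /= row_mxKl row_mxKr.
  by rewrite -(hsubmxK x) -(hsubmxK y) dmul_row_mx es et.
Qed.

Definition lmnm m n (mm : multinom (m + n)) : multinom m :=
  Multinom [tuple mm (lshift n i) | i < m].
Definition rmnm m n (mm : multinom (m + n)) : multinom n :=
  Multinom [tuple mm (rshift m i) | i < n].

Lemma mon_split m n (mm : multinom (m + n)) (z : 'rV[C]_(m + n)) :
  mon mm z = mon (lmnm mm) (lsubmx z) * mon (rmnm mm) (rsubmx z).
Proof.
rewrite /mon big_split_ord; congr (_ * _); apply: eq_bigr => i _;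
by rewrite mnmE mxE.
Qed.

Lemma poly_lsubmx m n (p : mpoly m C) :
  exists p' : mpoly (m + n) C, forall z, ev p' z = ev p (lsubmx z).
Proof.
have [p' hp] := poly_subst p (fun i => mpolyX C (mnm1 (lshift n i))).
by exists p' => z; rewrite hp; congr ev; apply/rowP => i; rewrite !mxE evV.
Qed.

Lemma poly_rsubmx m n (p : mpoly n C) :
  exists p' : mpoly (m + n) C, forall z, ev p' z = ev p (rsubmx z).
Proof.
have [p' hp] := poly_subst p (fun i => mpolyX C (mnm1 (rshift m i))).
by exists p' => z; rewrite hp; congr ev; apply/rowP => i; rewrite !mxE evV.
Qed.

Lemma poly_slice_l m n (p : mpoly (m + n) C) (y : 'rV[C]_n) :
  exists p' : mpoly m C, forall x, ev p' x = ev p (row_mx x y).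
Proof.
have [p' hp'] := poly_subst p (fun i => match split i with
  inl j => mpolyX C (mnm1 j) | inr j => mpolyC m (y 0 j) end).
exists p' => x; rewrite hp'; congr ev; apply/rowP => i; rewrite !mxE.
by case: splitP => j _; rewrite ?evC ?evV.
Qed.

Lemma poly_slice_r m n (p : mpoly (m + n) C) (x : 'rV[C]_m) :
  exists p' : mpoly n C, forall y, ev p' y = ev p (row_mx x y).
Proof.
have [p' hp'] := poly_subst p (fun i => match split i with
  inl j => mpolyC n (x 0 j) | inr j => mpolyX C (mnm1 j) end).
exists p' => y; rewrite hp'; congr ev; apply/rowP => i; rewrite !mxE.
by case: splitP => j _; rewrite ?evC ?evV.
Qed.

Section Product.
Variables (m n : nat) (X Y : fspace C).
Variables (S : set 'rV[C]_m) (T : set 'rV[C]_n).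
Variables (repX : 'rV[C]_m -> X -> Prop) (repY : 'rV[C]_n -> Y -> Prop).
Hypotheses (cX : coordinates repX) (cY : coordinates repY).
Hypotheses (SX : torus_orbits S repX) (TY : torus_orbits T repY).
Notation rep := (@prod_rep m n X Y repX repY).
Notation "A `** B" := ([set p : prod_space X Y | A p.1 /\ B p.2]) (at level 40).

Lemma prod_nbhs U V z :
  zariski_nbhs repX U (lsubmx z) -> zariski_nbhs repY V (rsubmx z) ->
  zariski_nbhs rep (U `** V) z.
Proof.
move=> [b [bx hb]] [b' [b'x hb']].
have [p hp] := @poly_lsubmx m n b; have [p' hp'] := @poly_rsubmx m n b'.
exists (p * p'); rewrite evM hp hp' mulf_neq0 //; split=> // y q [yl yr].
rewrite evM hp hp' mulf_eq0 negb_or => /andP[/(hb _ _ yl) ? /(hb' _ _ yr) ?].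
by split.
Qed.

Lemma rational_fst U V f z : rational_at repX U f (lsubmx z) ->
  rational_at rep (U `** V) (fun q => f q.1) z.
Proof.
move=> [a [b [bx h]]].
have [p hp] := @poly_lsubmx m n a; have [p' hp'] := @poly_lsubmx m n b.
exists p, p'; rewrite hp'; split=> // y q [yl yr] [Uq _].
by rewrite hp hp'; apply: h.
Qed.

Lemma rational_snd U V f z : rational_at repY V f (rsubmx z) ->
  rational_at rep (U `** V) (fun q => f q.2) z.
Proof.
move=> [a [b [bx h]]].
have [p hp] := @poly_rsubmx m n a; have [p' hp'] := @poly_rsubmx m n b.
exists p, p'; rewrite hp'; split=> // y q [yl yr] [_ Vq].
by rewrite hp hp'; apply: h.
Qed.

Lemma rational_tensor U V a z p : opn U -> opn V -> rep z p -> U p.1 -> V p.2 ->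
  tensor_fun U V a -> rational_at rep (U `** V) a z.
Proof.
case: cX cY => [_ _ oX rX] [_ _ oY rY] oU oV [zl zr] Up Vp [k [f [g [rf rg ->]]]].
apply: rational_at_sum => i; apply: rational_atM.
  by apply: rational_fst; exact: (rX U _ oU).1 (rf i) _ _ zl Up.
by apply: rational_snd; exact: (rY V _ oV).1 (rg i) _ _ zr Vp.
Qed.

(** Two monomials with the same character have an invariant quotient, which is a
    regular function on the open set where the denominator is nonzero. *)
Lemma monomial_quotients k (Z : fspace C) (W : set 'rV[C]_k)
    (repZ : 'rV[C]_k -> Z -> Prop) (mm0 : multinom k) :
  coordinates repZ -> torus_orbits W repZ ->
  [/\ opn [set q : Z | exists x, repZ x q /\ mon mm0 x != 0],
      (forall x q, repZ x q -> (exists x, repZ x q /\ mon mm0 x != 0) -> mon mm0 x != 0) &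
      forall mm, same_char W mm mm0 -> exists f,
        reg [set q : Z | exists x, repZ x q /\ mon mm0 x != 0] f /\
        forall x q, repZ x q -> f q = mon mm x / mon mm0 x].
Proof.
move=> [sZ fZ oZ rZ] [mW stW oW].
have chi0 (mm : multinom k) t : W t -> mon mm t != 0.
  by move=> Wt; apply: mon_neq0; case: mW => _ _ /(_ t Wt).
have nz x q : repZ x q -> (exists x, repZ x q /\ mon mm0 x != 0) -> mon mm0 x != 0.
  move=> xq [x' [x'q x'0]]; have [t Wt ->] := oW _ _ _ x'q xq.
  by rewrite mon_dmul mulf_neq0 // chi0.
have op : opn [set q : Z | exists x, repZ x q /\ mon mm0 x != 0].
  apply/oZ => x q xq /(nz x q xq) x0; exists (mpolyX C mm0); rewrite evX; split=> //.
  by move=> y q' yq'; rewrite evX => y0; exists y.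
split=> // mm smm.
pose cd q := projT1 (cid (sZ q)).
have cdP q : repZ (cd q) q := projT2 (cid (sZ q)).
have fE x q : repZ x q -> mon mm (cd q) / mon mm0 (cd q) = mon mm x / mon mm0 x.
  move=> xq; have [t Wt ->] := oW _ _ _ xq (cdP q).
  by rewrite !mon_dmul (smm _ Wt) -mulf_div divff ?mul1r ?chi0.
exists (fun q => mon mm (cd q) / mon mm0 (cd q)); split=> //.
apply/(rZ _ _ op) => x q xq /(nz x q xq) x0.
exists (mpolyX C mm), (mpolyX C mm0); rewrite evX; split=> // y q' yq' _ _.
by rewrite !evX (fE y).
Qed.

(** Semi-invariant fractions are what makes the product compatible with the
    passage to quotients: dividing both terms by a monomial of the same
    character turns them into sums of products of invariant functions. *)
Lemma tensor_semi z p (m0 : multinom (m + n)) (I : finType) (mn : I -> multinom (m + n)) :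
  rep z p -> mon m0 z != 0 ->
  (forall i, same_char (prod_torus S T) (mn i) m0) ->
  exists U V, [/\ opn U, opn V, U p.1, V p.2 &
    forall c : I -> C, exists2 t, tensor_fun U V t &
      forall y q, rep y q -> U q.1 -> V q.2 ->
        mon m0 y != 0 /\ t q = ev (psum mn c) y / mon m0 y].
Proof.
case: cX cY SX TY => [sX fX oX rX] [sY fY oY rY] [mS stS oS] [mT stT oT].
move=> [zl zr] m0z sc.
have scl i : same_char S (lmnm (mn i)) (lmnm m0).
  move=> s Ss; have [T1 _ _] := mT.
  have := sc i (row_mx s (const_mx 1)); rewrite !mon_split row_mxKl row_mxKr.
  have one mm : mon mm (const_mx 1) = 1 :> C.
    by rewrite /mon big1 // => j _; rewrite mxE expr1n.
  by rewrite !one !mulr1; apply; rewrite /prod_torus /= row_mxKl row_mxKr.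
have scr i : same_char T (rmnm (mn i)) (rmnm m0).
  move=> s Ss; have [S1 _ _] := mS.
  have := sc i (row_mx (const_mx 1) s); rewrite !mon_split row_mxKl row_mxKr.
  have one mm : mon mm (const_mx 1) = 1 :> C.
    by rewrite /mon big1 // => j _; rewrite mxE expr1n.
  by rewrite !one !mul1r; apply; rewrite /prod_torus /= row_mxKl row_mxKr.
have [oU nU fU] := monomial_quotients (lmnm m0) cX SX.
have [oV nV fV] := monomial_quotients (rmnm m0) cY TY.
move: m0z; rewrite mon_split mulf_eq0 negb_or => /andP[lz rz].
exists [set q | exists x, repX x q /\ mon (lmnm m0) x != 0],
       [set q | exists x, repY x q /\ mon (rmnm m0) x != 0]; split=> //.
- by exists (lsubmx z).
- by exists (rsubmx z).
move=> c.
have [f hf] := choice (fun i => fU _ (scl i)).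
have [g hg] := choice (fun i => fV _ (scr i)).
exists (fun q => \sum_(i < #|I|) (c (enum_val i) * f (enum_val i) q.1) * g (enum_val i) q.2).
  exists #|I|, (fun i q => c (enum_val i) * f (enum_val i) q), (fun i => g (enum_val i)).
  split=> // i; last by case: (hg (enum_val i)).
  apply/(rX _ _ oU) => x q xq Uq; apply: rational_atM; first exact: rational_at_cst.
  by apply: (rX _ _ oU).1 xq Uq; case: (hf (enum_val i)).
move=> y q [yl yr] Uq Vq.
have ly0 := nU _ _ yl Uq; have ry0 := nV _ _ yr Vq.
rewrite mon_split mulf_neq0 //; split=> //.
rewrite ev_psum -(big_enum_val (fun i => c i * f i q.1 * g i q.2)) /=.
rewrite mulr_suml; apply: eq_bigr => i _.
have [_ fE] := hf i; have [_ gE] := hg i.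
by rewrite (fE _ _ yl) (gE _ _ yr) mon_split -mulrA mulf_div mulrA.
Qed.

Lemma coordinates_prod : coordinates rep.
Proof.
have Trep := torus_orbits_prod SX TY.
case: (cX) (cY) => [sX fX oX rX] [sY fY oY rY].
have fn x p q : rep x p -> rep x q -> p = q.
  case: p q => [p1 p2] [q1 q2] [/= xl xr] [/= xl' xr'].
  by rewrite (fX _ _ _ xl xl') (fY _ _ _ xr xr').
have surj p : exists x, rep x p.
  have [x xp] := sX p.1; have [y yp] := sY p.2.
  by exists (row_mx x y); split; rewrite ?row_mxKl ?row_mxKr.
have nbhsUV U V x p : opn U -> opn V -> rep x p -> U p.1 -> V p.2 ->
    zariski_nbhs rep (U `** V) x.
  move=> oU oV [xl xr] Up Vp; apply: prod_nbhs.
    exact: (oX _).1 oU _ _ xl Up.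
  exact: (oY _).1 oV _ _ xr Vp.
split=> //.
- move=> O; split=> [oO x p xp Op|h p Op].
    have [U [V [b [[oU oV tb] [Up Vp bp hb]]]]] := oO p Op.
    have [b1 [b1x hb1]] := nbhsUV U V x p oU oV xp Up Vp.
    have [a' [b' [b'x h']]] := rational_tensor oU oV xp Up Vp tb.
    have a'x : ev a' x != 0.
      apply/eqP => a0; case/eqP: bp.
      by rewrite (h' x p xp) ?a0 ?mul0r //; split.
    exists (b1 * b' * a'); rewrite !evM !mulf_neq0 //; split=> // y q yq.
    rewrite !evM !mulf_eq0 !negb_or -andbA => /and3P[b1y b'y a'y].
    have [Uq Vq] := hb1 y q yq b1y.
    apply: hb => //; rewrite (h' y q yq) //.
    by rewrite mulf_neq0 // invr_eq0.
  have [x xp] := surj p.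
  have [m0 [I [mn [c [sc m0x cx hc]]]]] := zariski_nbhs_semi fn Trep (h x p xp Op).
  have [U [V [oU oV Up Vp tens]]] := tensor_semi xp m0x sc.
  have [t tt ht] := tens c.
  exists U, V, t; split; split=> //.
    by have [_ ->] := ht x p xp Up Vp; rewrite mulf_neq0 // invr_eq0.
  move=> q Uq Vq; have [y yq] := surj q.
  have [y0 ->] := ht y q yq Uq Vq.
  by rewrite mulf_eq0 negb_or => /andP[/(hc y q yq)].
- move=> O f oO; split=> [rf x p xp Op|h p Op].
    have [U [V [a [b [[oU oV ta tb] [Up Vp bp hb]]]]]] := rf p Op.
    have [b1 [b1x hb1]] := nbhsUV U V x p oU oV xp Up Vp.
    have [a' [b' [b'x h']]] := rational_tensor oU oV xp Up Vp tb.
    have [a'' [b'' [b''x h'']]] := rational_tensor oU oV xp Up Vp ta.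
    have a'x : ev a' x != 0.
      apply/eqP => a0; case/eqP: bp.
      by rewrite (h' x p xp) ?a0 ?mul0r //; split.
    exists (b1 * b' * (a'' * b')), (b1 * b' * (b'' * a')); rewrite !evM !mulf_neq0 //.
    split=> // y q yq Oq.
    rewrite !evM !mulf_eq0 !negb_or => /andP[/andP[b1y b'y] /andP[b''y a'y]].
    have [Uq Vq] := hb1 y q yq b1y.
    rewrite hb //; last by rewrite (h' y q yq) // mulf_neq0 ?invr_eq0.
    rewrite (h' y q yq) // (h'' y q yq) //.
    by rewrite invf_div mulf_div -[RHS]mulf_div divff ?mul1r // mulf_neq0.
  have [x xp] := surj p.
  have [m0 [I [mn [ca [cb [sc m0x cbx hc]]]]]] := rational_at_semi fn Trep (h x p xp Op).
  have [U [V [oU oV Up Vp tens]]] := tensor_semi xp m0x sc.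
  have [t tt ht] := tens ca; have [t' tt' ht'] := tens cb.
  exists U, V, t, t'; split; split=> //.
    by have [_ ->] := ht' x p xp Up Vp; rewrite mulf_neq0 // invr_eq0.
  move=> q Oq Uq Vq; have [y yq] := surj q.
  have [y0 ->] := ht' y q yq Uq Vq; have [_ ->] := ht y q yq Uq Vq.
  rewrite mulf_eq0 negb_or => /andP[cy _].
  by rewrite -[f q](mulfK cy) (hc y q yq Oq) invf_div mulrA divfK.
Qed.

End Product.
End SubAndProduct.

(** * Gluing birational maps *)

Section LocalMorphisms.
Variable C : fieldType.
Implicit Types X Y Z : fspace C.

(** A rational map is a total function of which only the restriction to the
    open set U matters; this avoids subtypes when composing. *)
Definition locmorph X Y (U : set X) (phi : X -> Y) : Prop :=
  (forall O, opn O -> opn (U `&` phi @^-1` O)) /\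
  (forall O f, opn O -> reg O f -> reg (U `&` phi @^-1` O) (f \o phi)).

Lemma morphism_locmorph X Y (phi : X -> Y) : morphism phi <-> locmorph setT phi.
Proof.
by split=> [[h1 h2]|[h1 h2]]; split=> [O oO|O f oO rf];
  move: (h1 O) (h2 O); rewrite ?setTI; auto.
Qed.

Lemma locmorph_comp X Y Z U V (phi : X -> Y) (psi : Y -> Z) :
  locmorph U phi -> locmorph V psi -> locmorph (U `&` phi @^-1` V) (psi \o phi).
Proof.
move=> [o1 r1] [o2 r2].
have e O : U `&` phi @^-1` V `&` (psi \o phi) @^-1` O =
    U `&` phi @^-1` (V `&` psi @^-1` O).
  by rewrite preimage_setI setIA.
split=> [O oO|O f oO rf]; rewrite e; first by apply: o1; apply: o2.
by apply: (r1 _ (f \o psi)); [exact: o2|exact: r2].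
Qed.

Lemma opnI X (U V : set X) : is_space X -> opn U -> opn V -> opn (U `&` V).
Proof. by move=> [[_ oI _] _ _]; apply: oI. Qed.

Lemma reg_restrict X (U V : set X) f :
  is_space X -> opn U -> opn V -> V `<=` U -> reg U f -> reg V f.
Proof. by move=> [_ h _]; apply: h. Qed.

Lemma reg_ext X (U : set X) f g : is_space X -> opn U ->
  (forall p, U p -> f p = g p) -> reg U f -> reg U g.
Proof.
move=> [_ _ glue] oU fg rf; apply: glue => // p Up; exists U, f; split=> //.
by move=> q Uq _; rewrite fg.
Qed.

Lemma locmorph_restrict X Y (U V : set X) (phi : X -> Y) :
  is_space X -> opn V -> V `<=` U -> locmorph U phi -> locmorph V phi.
Proof.
move=> sX oV VU [o r].
have e O : V `&` phi @^-1` O = V `&` (U `&` phi @^-1` O).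
  by rewrite setIA (setIidl VU).
split=> [O oO|O f oO rf]; first by rewrite e; apply: opnI => //; apply: o.
apply: (reg_restrict sX _ _ _ (r O f oO rf)); first exact: o.
  by rewrite e; apply: opnI => //; apply: o.
by move=> x [/VU Ux Ox].
Qed.

Lemma morphism_sub X Y (U : set X) (V : set Y) (phi : X -> Y)
    (UV : forall x, U x -> V (phi x)) : locmorph U phi ->
  @morphism C (sub U) (sub V) (fun x => exist V (phi (sval x)) (UV _ (svalP x))).
Proof.
move=> [o r]; split=> [_ [O oO ->]|O f _ rf p Op].
  exists (U `&` phi @^-1` O); first exact: o.
  by apply/seteqP; split=> -[x Ux] //= [].
have [O' [g [oO' O'p rg fg]]] := rf _ Op.
exists (U `&` phi @^-1` O'), (g \o phi); split.
- exact: o.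
- by split=> //; exact: (svalP p).
- exact: r.
- by move=> q Oq [_ O'q] /=; apply: fg.
Qed.

Lemma birational_intro X Y (U : set X) (V : set Y) (phi : X -> Y) (psi : Y -> X) :
  opn U -> dense_in U -> opn V -> dense_in V -> locmorph U phi -> locmorph V psi ->
  (forall x, U x -> V (phi x)) -> (forall y, V y -> U (psi y)) ->
  (forall x, U x -> psi (phi x) = x) -> (forall y, V y -> phi (psi y) = y) ->
  birational X Y.
Proof.
move=> oU dU oV dV lphi lpsi UV VU phiK psiK; exists U, V; split=> //.
exists (fun x => exist V (phi (sval x)) (UV _ (svalP x))).
exists (fun y => exist U (psi (sval y)) (VU _ (svalP y))).
split; [exact: morphism_sub|exact: morphism_sub| |].
  by case=> x Ux; apply: sub_inj; rewrite /= phiK.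
by case=> y Vy; apply: sub_inj; rewrite /= psiK.
Qed.

(** The extension of psi by a constant, so that it can be composed. *)
Definition total X Y (V : set X) (psi : sub V -> Y) (y0 : Y) (x : X) : Y :=
  if pselect (V x) is left h then psi (exist V x h) else y0.

Lemma totalE X Y (V : set X) (psi : sub V -> Y) y0 (x : sub V) :
  total psi y0 (sval x) = psi x.
Proof.
rewrite /total; case: pselect => [h|]; last by case; exact: (svalP x).
by congr psi; apply: sub_inj.
Qed.

(** The source X has to be a space, because regularity on a subspace is a local
    condition and has to be glued. *)
Lemma locmorph_total X Y Z (U : set X) (V : set Y) (phi : X -> Y) (psi : sub V -> Z) z0 :
  is_space X -> opn U -> opn V -> locmorph U phi -> morphism psi ->
  locmorph (U `&` phi @^-1` V) (total psi z0 \o phi).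
Proof.
move=> sX oU oV [o1 r1] [o2 r2].
have oUV : opn (U `&` phi @^-1` V) by exact: o1.
have o3 O : opn O -> opn (U `&` phi @^-1` V `&` (total psi z0 \o phi) @^-1` O).
  move=> oO; have [O' oO' e] := o2 O oO.
  have -> : U `&` phi @^-1` V `&` (total psi z0 \o phi) @^-1` O =
      U `&` phi @^-1` V `&` (U `&` phi @^-1` O').
    apply/seteqP; split=> x [[Ux Vx]].
      rewrite /preimage /= -[phi x]/(sval (exist V _ Vx)) totalE => Ox.
      split=> //; split=> //; suff : (psi @^-1` O) (exist V _ Vx) by rewrite e.
      exact: Ox.
    move=> [_ O'x]; split=> //.
    rewrite /preimage /= -[phi x]/(sval (exist V _ Vx)) totalE.
    suff : (psi @^-1` O) (exist V _ Vx) by [].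
    by rewrite e.
  by apply: opnI => //; apply: o1.
split=> // O f oO rf.
have [_ _ glue] := sX; apply: glue => [|x [[Ux Vx] Ox]]; first exact: o3.
have Ox' : (psi @^-1` O) (exist V _ Vx).
  by move: Ox; rewrite /preimage /= -[phi x]/(sval (exist V _ Vx)) totalE.
have [O' [g [oO' O'x rg fg]]] := r2 O f oO rf _ Ox'.
exists (U `&` phi @^-1` O'), (g \o phi); split=> //; [exact: o1|exact: r1|].
move=> q [[Uq Vq] Oq] [_ O'q]; have := fg (exist V _ Vq) _ O'q.
rewrite /= -[in X in total _ _ X]/(sval (exist V _ Vq)) totalE; apply.
by move: Oq; rewrite /preimage /= -[phi q]/(sval (exist V _ Vq)) totalE.
Qed.

Lemma prod_locmorph X Y Z (V : set Y) (psi : Y -> Z) : locmorph V psi ->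
  @locmorph (prod_space X Y) (prod_space X Z) [set p | V p.2] (fun p => (p.1, psi p.2)).
Proof.
move=> [o r].
have tens (U : set X) W b : opn W -> tensor_fun U W b ->
    tensor_fun U (V `&` psi @^-1` W) (fun p => b (p.1, psi p.2)).
  move=> oW [k [f [g [rf rg ->]]]]; exists k, f, (fun i => g i \o psi).
  by split=> // i; apply: r.
split=> [O oO p [Vp Op]|O f oO rf p [Vp Op]].
  have [U [W [b [[oU oW tb] [Up Wp bp hb]]]]] := oO _ Op.
  exists U, (V `&` psi @^-1` W), (fun p => b (p.1, psi p.2)); split.
    by split=> //; [exact: o|exact: tens].
  by split=> // q Uq [Vq Wq] bq; split=> //; apply: (hb (q.1, psi q.2)).
have [U [W [a [b [[oU oW ta tb] [Up Wp bp hb]]]]]] := rf _ Op.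
exists U, (V `&` psi @^-1` W), (fun p => a (p.1, psi p.2)), (fun p => b (p.1, psi p.2)).
split; first by split=> //; [exact: o|exact: tens|exact: tens].
by split=> // q [Vq Oq] Uq [_ Wq] bq; apply: (hb (q.1, psi q.2)).
Qed.

Lemma irreducible_dense X (U : set X) :
  irreducible_in (@setT X) -> opn U -> U !=set0 -> dense_in U.
Proof.
move=> [_ irr] oU [u Uu] V oV [v Vv]; apply: contrapT => no.
case: (irr (~` V) (~` U)); rewrite /closed_in ?setCK //.
- move=> x _; have [Vx|] := pselect (V x); last by left.
  by right=> Ux; apply: no; exists x.
- by move=> /(_ v I).
- by move=> /(_ u I).
Qed.

Lemma qproj_pair X Y (s : X -> X) (t : Y -> Y) p q :
  involutive s -> involutive t ->
  qproj (@pair_orbit C X Y s t) p = qproj (@pair_orbit C X Y s t) q <->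
  q = p \/ q = (s p.1, t p.2).
Proof.
move=> sK tK; rewrite qproj_eq; split.
  by move=> e; have : pair_orbit s t p q by rewrite e; left.
case: p q => [p1 p2] [q1 q2] pq; apply/funext => -[x1 x2]; apply/propext.
rewrite /pair_orbit /=.
case: pq => [[-> ->] //|[-> ->]] /=; rewrite sK tK.
by split=> -[|] ->; [right|left|right|left].
Qed.

Definition pick_pt X (r : X -> X -> Prop) (c : quot r) : X := projT1 (cid (qproj_surj c)).

Lemma pick_ptK X (r : X -> X -> Prop) (c : quot r) : qproj r (pick_pt c) = c.
Proof. by rewrite /pick_pt; case: cid. Qed.

Lemma slice_opn m n X Y (repX : 'rV[C]_m -> X -> Prop) (repY : 'rV[C]_n -> Y -> Prop)
    (O : set (prod_space X Y)) (e : X) :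
  coordinates repX -> coordinates repY -> coordinates (@prod_rep C m n X Y repX repY) ->
  opn O -> opn [set y | O (e, y)].
Proof.
move=> [sX _ _ _] [_ _ oY _] [_ _ oXY _] oO; have [x xe] := sX e.
apply/oY => y q yq Oq.
have [|b [bxy hb]] := (oXY O).1 oO (row_mx x y) (e, q) _ Oq.
  by split; rewrite ?row_mxKl ?row_mxKr.
have [b' b'E] := poly_slice_r b x.
exists b'; rewrite b'E; split=> // z q' zq'; rewrite b'E => bz.
by apply: hb bz; split; rewrite ?row_mxKl ?row_mxKr.
Qed.

Section Assembly.
Variables (m n : nat) (E S0 S' Z XG : fspace C).
Variables (repE : 'rV[C]_m -> E -> Prop) (repS : 'rV[C]_n -> S0 -> Prop).
Hypotheses (cE : coordinates repE) (cS : coordinates repS).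
Hypothesis cES : coordinates (@prod_rep C m n E S0 repE repS).
Variables (sE : E -> E) (s0 : S0 -> S0) (sS : S' -> S').
Hypotheses (sEK : involutive sE) (s0K : involutive s0) (sSK : involutive sS).
Hypothesis s0_opn : forall V, opn V -> opn (s0 @^-1` V).
Variables (pi : S' -> S0) (rho : Z -> quot (@pair_orbit C E S' sE sS)).
Hypotheses (pi_bir : birational_morphism pi) (rho_bir : birational_morphism rho).
Hypothesis pi_sS : forall x, pi (sS x) = s0 (pi x).
Hypothesis Z_space : is_space Z.
Hypothesis Z_irr : irreducible_in (@setT Z).
Notation Q0 := (quot (@pair_orbit C E S0 sE s0)).
Notation Q' := (quot (@pair_orbit C E S' sE sS)).
Notation q0 := (qproj (@pair_orbit C E S0 sE s0)).
Notation q' := (qproj (@pair_orbit C E S' sE sS)).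
Variables (phi : Q0 -> XG) (psi : XG -> Q0) (D : set Q0) (DX : set XG).
Hypotheses (XG_space : is_space XG) (oD : opn D) (dD : dense_in D).
Hypotheses (oDX : opn DX) (dDX : dense_in DX).
Hypotheses (lphi : locmorph D phi) (lpsi : locmorph DX psi).
Hypotheses (D_DX : forall x, D x -> DX (phi x)) (DX_D : forall y, DX y -> D (psi y)).
Hypotheses (phiK : forall x, D x -> psi (phi x) = x).
Hypotheses (psiK : forall y, DX y -> phi (psi y) = y).

(** The resolution S' -> S0 induces a birational map between the quotients of
    E x S' and E x S0 by the paired involutions, and Z is birational to the
    first. All compositions are done on the side of Q0, whose structure is
    given by coordinates; on the side of Z irreducibility makes every nonempty
    open set dense. *)
Lemma birational_assembly : birational Z XG.
Proof.
have [z0 _] := Z_irr.1.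
have [lpi [V [oV dV _ [psi1 [mpsi1 pi_psi1 psi1_pi]]]]] := pi_bir.
have [lrho [V' [oV' dV' _ [psi2 [mpsi2 rho_psi2 psi2_rho]]]]] := rho_bir.
have S0_space := coordinates_space cS.
have ES_space := coordinates_space cES.
have Q0_coord := coordinates_quot (@pair_orbit C E S0 sE s0) cES.
have Q0_space := coordinates_space Q0_coord.
pose s'0 : S' := (pick_pt (rho z0)).2.
pose chi1 := total psi1 s'0.
have lchi1 : locmorph V chi1.
  have oT : opn (@setT S0) by have [[]] := S0_space.
  have lid : locmorph (@setT S0) id by apply/morphism_locmorph; split.
  by have := locmorph_total s'0 S0_space oT oV lid mpsi1; rewrite setTI.
have pi_chi1 y : V y -> pi (chi1 y) = y.
  by move=> Vy; rewrite /chi1 -[y]/(sval (exist V y Vy)) totalE pi_psi1.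
have chi1_pi x : V (pi x) -> chi1 (pi x) = x.
  by move=> Vx; rewrite /chi1 -[pi x]/(sval (exist V _ Vx)) totalE; exact: psi1_pi.
pose V1 := V `&` s0 @^-1` V.
have oV1 : opn V1 by apply: opnI => //; apply: s0_opn.
have V1s y : V1 y -> V1 (s0 y) by move=> [? ?]; split=> //; rewrite /preimage /= s0K.
have dV1 : dense_in V1.
  move=> N oN N0; have [y [Ny Vy]] := dV N oN N0.
  have oNV : opn (s0 @^-1` (N `&` V)) by apply: s0_opn; apply: opnI.
  have [|y' [[Ny' Vy'] Vy'']] := dV _ oNV.
    by exists (s0 y); rewrite /preimage /= s0K.
  by exists (s0 y'); split=> //; split=> //; rewrite /preimage /= s0K.
have chi1_s y : V1 y -> chi1 (s0 y) = sS (chi1 y).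
  by move=> [Vy Vsy]; rewrite -{1}(pi_chi1 _ Vy) -pi_sS chi1_pi // pi_sS pi_chi1.
(* Pi is induced by pi on orbits. In the other direction chi is induced by chi1,
   which commutes with the involutions over V1, the largest s0-stable part of V. *)
pose Pi (c : Q') : Q0 := q0 ((pick_pt c).1, pi (pick_pt c).2).
have PiE e s : Pi (q' (e, s)) = q0 (e, pi s).
  rewrite /Pi; have := pick_ptK (q' (e, s)); case: (pick_pt _) => e1 s1 /=.
  move=> /(qproj_pair _ _ sEK sSK) [[-> ->] //|[-> ->]].
  by apply/qproj_pair => //; right; rewrite /= pi_sS.
pose chi (c : Q0) : Q' := q' ((pick_pt c).1, chi1 (pick_pt c).2).
pose V0 : set Q0 := [set c : Q0 | V1 (pick_pt c).2].
have V0E e y : V0 (q0 (e, y)) = V1 y.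
  rewrite /V0 /=; have := pick_ptK (q0 (e, y)); case: (pick_pt _) => e1 y1 /=.
  move=> /(qproj_pair _ _ sEK s0K) [[_ ->] //|[_ ->]] /=.
  by apply/propext; split=> [/V1s //|/V1s]; rewrite s0K.
have chiE e y : V1 y -> chi (q0 (e, y)) = q' (e, chi1 y).
  move=> Vy; rewrite /chi; have := pick_ptK (q0 (e, y)); case: (pick_pt _) => e1 y1 /=.
  move=> /(qproj_pair _ _ sEK s0K) [[-> ->] //|[-> ey]].
  have Vy1 : V1 y1 by rewrite -(s0K y1) -ey; exact: V1s.
  by apply/qproj_pair => //; right; rewrite /= ey chi1_s.
have chi_Pi c : V0 (Pi c) -> chi (Pi c) = c.
  have [[e s] ->] := qproj_surj c; rewrite PiE V0E => Vs.
  by rewrite chiE // chi1_pi //; case: Vs.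
have Pi_chi c : V0 c -> Pi (chi c) = c.
  have [[e s] ->] := qproj_surj c; rewrite V0E => Vs.
  by rewrite chiE // PiE pi_chi1 //; case: Vs.
have q0surj (c : Q0) : exists e y, c = q0 (e, y).
  by have [[e y] ->] := qproj_surj c; exists e, y.
have mPi : morphism Pi.
  have [o r] := @prod_locmorph E _ _ _ _ ((morphism_locmorph pi).1 lpi).
  have pre (O : set Q0) : q' @^-1` (Pi @^-1` O) =
      [set p : prod_space E S' | setT p.2] `&`
      (fun p : prod_space E S' => (p.1, pi p.2) : prod_space E S0) @^-1` (q0 @^-1` O).
    apply/seteqP; split=> -[e s]; rewrite /preimage /= PiE => //; by case.
  split=> [O oO|O f oO rf].
    change (@opn C (prod_space E S') (q' @^-1` (Pi @^-1` O))).
    by rewrite pre; exact: o.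
  change (@reg C (prod_space E S') (q' @^-1` (Pi @^-1` O)) ((f \o Pi) \o q')).
  rewrite pre.
  have -> : (f \o Pi) \o q' = (f \o q0) \o (fun p : prod_space E S' => (p.1, pi p.2) : prod_space E S0).
    by apply/funext => -[e s]; rewrite /= PiE.
  exact: r.
have oV0 : opn V0.
  have lid : locmorph V1 (@id S0).
    apply: (@locmorph_restrict _ _ setT) => //.
    by apply/morphism_locmorph; split.
  have [o _] := @prod_locmorph E _ _ _ _ lid.
  have [[oT _ _] _ _] := ES_space.
  have := o setT oT; rewrite preimage_setT setIT.
  change (@opn C (prod_space E S0) [set p | V1 p.2] ->
    @opn C (prod_space E S0) (q0 @^-1` V0)).
  suff -> : q0 @^-1` V0 = [set p : prod_space E S0 | V1 p.2] by [].
  by apply/seteqP; split=> -[e y] /=; rewrite /preimage /= V0E.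
have lchi : locmorph V0 chi.
  have lchi1' : locmorph V1 chi1.
    by apply: locmorph_restrict lchi1 => //; apply: subIsetl.
  have [o r] := @prod_locmorph E _ _ _ _ lchi1'.
  have pre (O : set Q') : q0 @^-1` (V0 `&` chi @^-1` O) =
      [set p : prod_space E S0 | V1 p.2] `&`
      (fun p : prod_space E S0 => (p.1, chi1 p.2) : prod_space E S') @^-1` (q' @^-1` O).
    apply/seteqP; split=> -[e y]; rewrite /preimage /= V0E => -[Vy]; rewrite chiE //.
  have o' O : opn O -> opn (V0 `&` chi @^-1` O).
    move=> oO; change (@opn C (prod_space E S0) (q0 @^-1` (V0 `&` chi @^-1` O))).
    by rewrite pre; apply: o.
  split=> // O f oO rf.
  change (@reg C (prod_space E S0) (q0 @^-1` (V0 `&` chi @^-1` O)) ((f \o chi) \o q0)).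
  apply: (@reg_ext _ _ ((f \o q') \o (fun p : prod_space E S0 => (p.1, chi1 p.2) : prod_space E S'))).
  - exact: ES_space.
  - by have := o' O oO.
  - by move=> [e y] [] /=; rewrite V0E => Vy _; rewrite chiE.
  - rewrite pre; exact: r.
(* A slice of an open set of E x S0 is open in S0, where V1 is dense. *)
have dV0 : dense_in V0.
  move=> N oN [c Nc]; have [e [y ce]] := q0surj c; rewrite ce in Nc.
  have oM := @slice_opn m n E S0 repE repS (q0 @^-1` N) e cE cS cES oN.
  have [|y' [Ny' Vy']] := dV1 _ oM; first by exists y.
  by exists (q0 (e, y')); split=> //; rewrite V0E.
(* A nonempty open subset of V0 has a nonempty open preimage in Q', which meets V'. *)
have dVD (N : set Q0) : opn N -> N !=set0 -> exists z, N (Pi (rho z)) /\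
    [/\ V0 (Pi (rho z)), D (Pi (rho z)) & V' (rho z)].
  move=> oN N0; have [c1 [Nc1 Dc1]] := dD oN N0.
  have oND : opn (N `&` D) by exact: opnI.
  have [|c2 [[Nc2 Dc2] Vc2]] := dV0 _ oND; first by exists c1.
  have oNDV : opn (Pi @^-1` (N `&` D `&` V0)) by apply: mPi.1; apply: opnI.
  have [|c3 [[[Nc3 Dc3] V0c3] V'c3]] := dV' _ oNDV.
    by exists (chi c2); rewrite /preimage /= Pi_chi.
  exists (psi2 (exist V' c3 V'c3)); rewrite rho_psi2 /=; split=> //.
pose chi2 := total psi2 z0.
have rho_chi2 c : V' c -> rho (chi2 c) = c.
  by move=> Vy; rewrite /chi2 -[c]/(sval (exist V' _ Vy)) totalE rho_psi2.
have chi2_rho x : V' (rho x) -> chi2 (rho x) = x.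
  by move=> Vx; rewrite /chi2 -[rho x]/(sval (exist V' _ Vx)) totalE; exact: psi2_rho.
have lchi2 := locmorph_total z0 Q0_space oV0 oV' lchi mpsi2.
have lback := locmorph_comp lpsi lchi2.
have mPirho : morphism (Pi \o rho).
  apply/morphism_locmorph.
  have := locmorph_comp ((morphism_locmorph rho).1 lrho) ((morphism_locmorph Pi).1 mPi).
  by rewrite setTI preimage_setT.
have lforth := locmorph_comp ((morphism_locmorph (Pi \o rho)).1 mPirho) lphi.
rewrite setTI in lforth.
pose UZ := rho @^-1` V' `&` (Pi \o rho) @^-1` (V0 `&` D).
have oUZ : opn UZ.
  by apply: opnI => //; [exact: lrho.1|apply: mPirho.1; exact: opnI].
pose UX := DX `&` psi @^-1` (V0 `&` chi @^-1` V').
have oUX : opn UX by apply: lpsi.1; apply: lchi.1.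
have oQT : opn (@setT Q0) by have [[]] := Q0_space.
apply: (@birational_intro _ _ UZ UX (phi \o (Pi \o rho)) ((chi2 \o chi) \o psi)) => //.
- apply: irreducible_dense => //.
  have [|z [_ [zV0 zD zV']]] := dVD setT oQT; first by exists (Pi (rho z0)).
  by exists z.
- move=> N oN N0; have [y [Ny DXy]] := dDX oN N0.
  have oN' : opn (D `&` phi @^-1` (N `&` DX)) by apply: lphi.1; exact: opnI.
  have [|z [[Dz [Nz DXz]] [V0z _ V'z]]] := dVD _ oN'.
    by exists (psi y); split; [exact: DX_D|rewrite /preimage /= psiK].
  exists (phi (Pi (rho z))); split=> //; split=> //.
  by rewrite /preimage /= phiK //; split=> //; rewrite /preimage /= chi_Pi.
- apply: locmorph_restrict lforth => //.
  by move=> x [_ []].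
- move=> x [V'x [V0x Dx]]; split; first exact: D_DX.
  by rewrite /preimage /= phiK //; split=> //; rewrite /preimage /= chi_Pi.
- move=> y [DXy [V0y V'y]]; split; rewrite /preimage /= rho_chi2 //.
  by rewrite Pi_chi //; split=> //; exact: DX_D.
- move=> x [V'x [V0x Dx]] /=; rewrite phiK // chi_Pi // chi2_rho //.
- move=> y [DXy [V0y V'y]] /=; rewrite rho_chi2 // Pi_chi // psiK //.
Qed.

End Assembly.
End LocalMorphisms.

(** * Quotients of weighted hypersurfaces by diagonal groups *)

Section WeightedHypersurfaces.
Variable C : fieldType.

Definition diag_group n (T : set 'rV[C]_n) : Prop :=
  diag_monoid T /\ forall t, T t -> exists2 s, T s & dmul s t = const_mx 1.

Definition wscale n (w : 'rV[nat]_n) (t : C) : 'rV[C]_n := \row_i t ^+ w 0 i.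

Lemma wscale1 n (w : 'rV[nat]_n) : wscale w 1 = const_mx 1.
Proof. by apply/rowP => i; rewrite !mxE expr1n. Qed.

Lemma wscaleM n (w : 'rV[nat]_n) s t : wscale w (s * t) = dmul (wscale w s) (wscale w t).
Proof. by apply/rowP => i; rewrite !mxE exprMn. Qed.

Lemma wscale_neq0 n (w : 'rV[nat]_n) t i : t != 0 -> wscale w t 0 i != 0.
Proof. by move=> t0; rewrite mxE expf_neq0. Qed.

Definition scalings n (w : 'rV[nat]_n) : set 'rV[C]_n :=
  [set s | exists2 t, t != 0 & s = wscale w t].

Lemma scalings_group n (w : 'rV[nat]_n) : diag_group (scalings w).
Proof.
split; first split.
- by exists 1; rewrite ?oner_eq0 ?wscale1.
- by move=> _ _ [s s0 ->] [t t0 ->]; exists (s * t); rewrite ?mulf_neq0 ?wscaleM.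
- by move=> _ [t t0 ->] i; exact: wscale_neq0.
- move=> _ [t t0 ->]; exists (wscale w t^-1); first by exists t^-1; rewrite ?invr_eq0.
  by rewrite -wscaleM mulVf // wscale1.
Qed.

Definition mulset n (S T : set 'rV[C]_n) : set 'rV[C]_n :=
  [set z | exists s t, [/\ S s, T t & z = dmul s t]].

Lemma mulset_group n (S T : set 'rV[C]_n) :
  diag_group S -> diag_group T -> diag_group (mulset S T).
Proof.
move=> [[S1 SM S0] SV] [[T1 TM T0] TV]; split; first split.
- by exists (const_mx 1), (const_mx 1); rewrite dmul1.
- move=> _ _ [s [t [Ss Tt ->]]] [s' [t' [Ss' Tt' ->]]].
  exists (dmul s s'), (dmul t t'); split; [exact: SM|exact: TM|].
  by apply/rowP => i; rewrite !mxE mulrACA.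
- by move=> _ [s [t [Ss Tt ->]]] i; rewrite dmulE mulf_neq0 //; [exact: S0|exact: T0].
- move=> _ [s [t [Ss Tt ->]]]; have [s' Ss' ss'] := SV s Ss; have [t' Tt' tt'] := TV t Tt.
  exists (dmul s' t'); first by exists s', t'.
  rewrite -[RHS](dmul1 (const_mx 1)) -{1}ss' -tt'.
  by apply/rowP => i; rewrite !mxE mulrACA.
Qed.

Lemma dmul_neq0 n (a x : 'rV[C]_n) : (forall i, a 0 i != 0) -> x != 0 -> dmul a x != 0.
Proof.
move=> a0; apply: contra_neq => /rowP e; apply/rowP => i.
have := e i; rewrite !mxE => /eqP.
by rewrite mulf_eq0 (negPf (a0 i)) => /eqP.
Qed.

Definition affine_rep n (x : 'rV[C]_n) (p : affine_space C n) : Prop := x = p.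

Definition punctured_rep n := sub_rep (@affine_rep n) (A := [set x | x != 0]).

Definition wproj_rep n (w : 'rV[nat]_n) (x : 'rV[C]_n) (c : wproj C w) : Prop :=
  quot_rep (@punctured_rep n) x c.

Lemma weighted_rel_eq n (w : 'rV[nat]_n) (p q : punctured C n) :
  weighted_rel w p = weighted_rel w q <-> weighted_rel w p q.
Proof.
split=> [->|[t t0 pq]]; first by exists 1; rewrite ?oner_eq0 // => i; rewrite expr1n mul1r.
apply/funext => r; apply/propext; split=> -[s s0 h].
  exists (s / t); first by rewrite mulf_neq0 ?invr_eq0.
  by move=> i; rewrite h pq mulrA expr_div_n divfK // expf_neq0.
exists (s * t); first by rewrite mulf_neq0.
by move=> i; rewrite h pq exprMn mulrA.
Qed.

Lemma weighted_relE n (w : 'rV[nat]_n) (p q : punctured C n) :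
  weighted_rel w p q <-> exists2 s, scalings w s & sval q = dmul s (sval p).
Proof.
split=> [[t t0 h]|[_ [t t0 ->] e]].
  exists (wscale w t); first by exists t.
  by apply/rowP => i; rewrite h !mxE.
by exists t => // i; rewrite e !mxE.
Qed.

Lemma wproj_repE n (w : 'rV[nat]_n) x (c : wproj C w) :
  wproj_rep x c <-> exists2 p : punctured C n, sval p = x & sval c p.
Proof.
split=> [[p xp ->]|[p xp cp]].
  by exists p => //=; apply/weighted_rel_eq.
exists p; first by [].
have [q cq] := qproj_surj c; rewrite cq in cp *.
by apply/qproj_eq/weighted_rel_eq.
Qed.

Lemma wproj_coordinates n (w : 'rV[nat]_n) :
  coordinates (@wproj_rep n w) /\ torus_orbits (scalings w) (@wproj_rep n w).
Proof.
have cP := coordinates_sub ([set x | x != 0] : set (affine_space C n))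
  (@coordinates_affine C n) (@torus_orbits_affine C n).
split; first exact: coordinates_quot cP.
apply: torus_orbits_quot; first exact: (scalings_group w).1.
  move=> t x p [s s0 ->] xp.
  have x0 : dmul (wscale w s) x != 0.
    apply: dmul_neq0 => [i|]; first exact: wscale_neq0.
    by move: xp; rewrite /punctured_rep /sub_rep /affine_rep => ->; exact: (svalP p).
  by exists (exist (fun x : 'rV[C]_n => is_true (x != 0)) _ x0).
move=> x p y q xp yq; rewrite qproj_eq weighted_rel_eq weighted_relE.
by rewrite -[sval p]xp -[sval q]yq.
Qed.

Section Hypersurface.
Variables (n : nat) (w : 'rV[nat]_n) (W : mpoly n C).
Hypothesis homW : forall t x, t != 0 -> ev W x = 0 -> ev W (dmul (wscale w t) x) = 0.

Definition whyp_rep (x : 'rV[C]_n) (p : whyp w W) : Prop := wproj_rep x (sval p).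

Lemma whyp_repE x p :
  whyp_rep x p <-> exists2 y : punctured C n, sval y = x & sval (sval p) y.
Proof. exact: wproj_repE. Qed.

Lemma whyp_coordinates :
  coordinates whyp_rep /\ torus_orbits (scalings w) whyp_rep.
Proof.
have [cw ow] := wproj_coordinates w.
split; [exact: coordinates_sub cw ow|exact: torus_orbits_sub ow].
Qed.

Lemma whyp_rep_zero x p : whyp_rep x p -> x != 0 /\ ev W x = 0.
Proof.
move/whyp_repE => [y yx py]; rewrite -yx; split; first exact: (svalP y).
exact: (svalP p).
Qed.

Lemma whyp_rep_ex x : x != 0 -> ev W x = 0 -> exists p, whyp_rep x p.
Proof.
move=> x0 Wx; pose y : punctured C n := exist (fun x : 'rV[C]_n => is_true (x != 0)) x x0.
have h : forall z, sval (qproj (weighted_rel w) y) z -> ev W (sval z) = 0.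
  move=> z /weighted_relE [_ [t t0 ->] ->]; exact: homW.
exists (exist _ (qproj (weighted_rel w) y) h).
by exists y.
Qed.

Lemma diag_actE a (p q : whyp w W) :
  diag_act a p q <-> exists2 x, whyp_rep x p & whyp_rep (dmul a x) q.
Proof.
split=> [[x [y [px qy e]]]|[x /whyp_repE [x' ex px'] /whyp_repE [y ey qy]]].
  by exists (sval x); apply/whyp_repE; [exists x|exists y].
by exists x', y; split=> //; rewrite ey ex.
Qed.

Variables (G : set (set 'rV[C]_n)) (H : set 'rV[C]_n).
Hypothesis HG : forall a, H a <-> exists2 P, G P & P a.
Hypothesis gH : diag_group H.
Hypothesis HW : forall a x, H a -> ev W x = 0 -> ev W (dmul a x) = 0.

Definition whyp_quot_rep (x : 'rV[C]_n) (c : whyp_quot w W G) : Prop :=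
  quot_rep whyp_rep x c.

Lemma orbit_relE (p q : whyp w W) :
  orbit_rel G p q <-> exists x a, [/\ H a, whyp_rep x p & whyp_rep (dmul a x) q].
Proof.
split=> [[P GP [a Pa /diag_actE [x xp xq]]]|[x [a [/HG [P GP Pa] xp xq]]]].
  by exists x, a; split=> //; apply/HG; exists P.
by exists P => //; exists a => //; apply/diag_actE; exists x.
Qed.

(** The orbits of the quotient are those of the group generated by the weighted
    scalings and by H, because diagonal matrices commute. *)
Lemma whyp_quot_coordinates : coordinates whyp_quot_rep /\
  torus_orbits (mulset (scalings w) H) whyp_quot_rep.
Proof.
have [cw [_ st orb]] := whyp_coordinates; split; first exact: coordinates_quot.
have gS := scalings_group w; have [[S1 SM S0] SV] := gS.
have [[H1 HM H0] HV] := gH; have [mT _] := mulset_group gS gH.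
apply: torus_orbits_quot => //.
  move=> _ x p [_ [a [[t t0 ->] Ha ->]]] xp; apply: whyp_rep_ex.
    apply: dmul_neq0; last by case: (whyp_rep_zero xp).
    by move=> i; rewrite dmulE mulf_neq0 ?wscale_neq0 //; exact: H0.
  by rewrite -dmulA; apply: homW => //; apply: HW => //; case: (whyp_rep_zero xp).
have half x p y q : whyp_rep x p -> whyp_rep y q ->
    (exists2 t, mulset (scalings w) H t & y = dmul t x) ->
    forall r, orbit_rel G p r -> orbit_rel G q r.
  move=> xp yq [_ [s [a [Ss Ha ->]]] yE] r /orbit_relE [x' [b [Hb x'p bx']]].
  have [a' Ha' aa'] := HV a Ha; have [s' Ss' x'E] := orb _ _ _ xp x'p.
  have [s'' Ss'' ss''] := SV s' Ss'.
  apply/orbit_relE; exists y, (dmul b a'); split=> //; first exact: HM.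
  have := st (dmul s s'') _ _ (SM _ _ Ss Ss'') bx'; congr whyp_rep.
  rewrite yE x'E; apply/rowP => i.
  have := congr1 (fun z : 'rV[C]_n => z 0 i) aa'.
  have := congr1 (fun z : 'rV[C]_n => z 0 i) ss''; rewrite !mxE => e1 e2.
  transitivity (s 0 i * b 0 i * x 0 i * (s'' 0 i * s' 0 i)).
    by ring.
  by rewrite e1 -e2; ring.
move=> x p y q xp yq; rewrite qproj_eq; split=> [pq|[t Tt yE]].
  have : orbit_rel G p q.
    by rewrite pq; apply/orbit_relE; exists y, (const_mx 1); rewrite dmul1.
  move/orbit_relE => [x' [a [Ha x'p ax'q]]].
  have [s Ss x'E] := orb _ _ _ xp x'p; have [s' Ss' yE] := orb _ _ _ ax'q yq.
  exists (dmul (dmul s' s) a); first by exists (dmul s' s), a; split=> //; exact: SM.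
  by rewrite yE x'E !dmulA -(dmulA s' a s) [dmul a s]dmulC dmulA.
apply/funext => r; apply/propext; split; first by apply: (half x p y q) => //; exists t.
apply: (half y q x p) => //; have [_ /(_ t Tt) [t' Tt' tt']] := mulset_group gS gH.
by exists t' => //; rewrite yE dmulA tt' dmul1.
Qed.

Lemma whyp_quot_rep_zero x c : whyp_quot_rep x c -> x != 0 /\ ev W x = 0.
Proof. by move=> [p /whyp_rep_zero]. Qed.

Lemma whyp_quot_rep_ex x : x != 0 -> ev W x = 0 -> exists c, whyp_quot_rep x c.
Proof.
move=> x0 Wx; have [p xp] := whyp_rep_ex x0 Wx.
by exists (qproj (@orbit_rel C n w W G) p), p.
Qed.

Lemma induced_by_rep (a : 'rV[C]_n) (s : whyp_quot w W G -> whyp_quot w W G) x c :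
  (forall i, a 0 i != 0) -> (forall x, ev W x = 0 -> ev W (dmul a x) = 0) ->
  induced_by a s -> whyp_quot_rep x c -> whyp_quot_rep (dmul a x) (s c).
Proof.
move=> a0 aW ind [p xp ->]; have [x0 Wx] := whyp_rep_zero xp.
have [q aq] := whyp_rep_ex (dmul_neq0 a0 x0) (aW _ Wx).
by exists q => //; apply: ind; apply/diag_actE; exists x.
Qed.

End Hypersurface.
End WeightedHypersurfaces.

(** * Density of the locus where both sides of F = G are nonzero *)

Section Density.
Variable C : numClosedFieldType.

Lemma poly_zero_everywhere (p : {poly C}) : (forall s, p.[s] = 0) -> p = 0.
Proof.
move=> h; apply: contrapT => /eqP p0.
suff : (size [seq i%:R : C | i <- iota 0 (size p)] < size p)%N.
  by rewrite size_map size_iota ltnn.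
apply: max_poly_roots => //.
  by apply/allP => _ /mapP[i _ ->]; apply/rootP.
by rewrite map_inj_uniq ?iota_uniq // => i j /eqP; rewrite eqr_nat => /eqP.
Qed.

Lemma mpoly_ring_ind n (P : mpoly n C -> Prop) :
  (forall c, P (mpolyC n c)) -> (forall i, P (mpolyX C (mnm1 i))) ->
  (forall p q, P p -> P q -> P (p + q)) -> (forall p q, P p -> P q -> P (p * q)) ->
  forall p, P p.
Proof.
move=> Pc Pv PD PM p; rewrite (mpolyE p).
elim: (msupp p) => [|m s IH]; first by rewrite big_nil -mpolyC0; exact: Pc.
rewrite big_cons; apply: (PD) => //; rewrite -mul_mpolyC; apply: (PM) => //.
rewrite mpolyXE_id; elim: (index_enum _) => [|i r IHr]; first by rewrite big_nil -mpolyC1; exact: Pc.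
rewrite big_cons; apply: (PM) => //.
elim: (m i) => [|k IHk]; first by rewrite expr0 -mpolyC1; exact: Pc.
by rewrite exprS; apply: PM.
Qed.

Lemma line_poly n (F : mpoly n C) (x d : 'rV[C]_n) :
  exists P : {poly C}, forall s, P.[s] = ev F (x + s *: d).
Proof.
elim/mpoly_ring_ind: F => [c|i|p q [P hP] [Q hQ]|p q [P hP] [Q hQ]].
- by exists c%:P => s; rewrite hornerC evC.
- exists ((x 0 i)%:P + d 0 i *: 'X) => s.
  by rewrite evV !mxE hornerD hornerC hornerZ hornerX mulrC.
- by exists (P + Q) => s; rewrite hornerD hP hQ evD.
- by exists (P * Q) => s; rewrite hornerM hP hQ evM.
Qed.

Lemma plane_poly m n (b : mpoly (m + n) C) (x d : 'rV[C]_m) (y e : 'rV[C]_n) :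
  exists B : {poly {poly C}}, forall s r,
    B.[r%:P].[s] = ev b (row_mx (x + s *: d) (y + r *: e)).
Proof.
elim/mpoly_ring_ind: b => [c|i|p q [P hP] [Q hQ]|p q [P hP] [Q hQ]].
- by exists c%:P%:P => s r; rewrite !hornerC evC.
- rewrite -(splitK i); case: (split i) => j /=.
    exists ((x 0 j)%:P + d 0 j *: 'X)%:P => s r.
    by rewrite evV row_mxEl !mxE hornerC hornerD hornerC hornerZ hornerX mulrC.
  exists ((y 0 j)%:P%:P + (e 0 j)%:P *: 'X) => s r.
  by rewrite evV row_mxEr !mxE !hornerE mulrC.
- by exists (P + Q) => s r; rewrite !hornerD hP hQ evD.
- by exists (P * Q) => s r; rewrite !hornerM hP hQ evM.
Qed.

(** A crude Nullstellensatz in one variable. *)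
Lemma dvdp_exp_roots (p q : {poly C}) : p != 0 ->
  (forall r, root p r -> root q r) -> p %| q ^+ (size p).-1.
Proof.
move=> p0 h; have [rs prs] := closed_field_poly_normal p.
have lp : lead_coef p != 0 by rewrite lead_coef_eq0.
have -> : (size p).-1 = size rs.
  by rewrite prs size_scale // size_prod_XsubC.
have hr : forall r, r \in rs -> root q r.
  by move=> r rin; apply: h; rewrite prs rootZ // root_prod_XsubC.
rewrite prs dvdpZl //; elim: rs hr {prs} => [|r rs IH] hr; first by rewrite big_nil dvd1p.
rewrite big_cons exprS dvdp_mul //; last by apply: IH => r' r'rs; apply: hr; rewrite inE r'rs orbT.
by rewrite dvdp_XsubCl; apply: hr; rewrite mem_head.
Qed.

(** On the plane curve gamma(r) = phi(s), a polynomial B that vanishes wherever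
    phi(s) <> 0 vanishes at every point: for such s all roots of gamma - phi(s)
    are roots of B(s,_), so that gamma - phi, which is monic in r, divides a
    power of B for infinitely many s, hence identically. *)
Lemma plane_curve_vanishing (phi gamma : {poly C}) (B : {poly {poly C}}) :
  phi != 0 -> gamma \is monic -> (1 < size gamma)%N ->
  (forall s r, phi.[s] = gamma.[r] -> phi.[s] != 0 -> B.[r%:P].[s] = 0) ->
  forall s r, phi.[s] = gamma.[r] -> B.[r%:P].[s] = 0.
Proof.
move=> phi0 mg sg vanish s0 r0 e0.
pose M : {poly {poly C}} := map_poly polyC gamma - phi%:P.
have sgm : size (map_poly (@polyC C) gamma) = size gamma.
  by rewrite size_map_inj_poly //; exact: polyC_inj.
have sphi : (size (- phi%:P : {poly {poly C}}) < size (map_poly (@polyC C) gamma))%N.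
  by rewrite sgm size_polyN; apply: leq_ltn_trans (size_polyC_leq1 _) sg.
have mM : M \is monic.
  rewrite monicE /M lead_coefDl // lead_coef_map_inj //; last exact: polyC_inj.
  by rewrite (monicP mg).
have sM : size M = size gamma by rewrite /M size_polyDl.
pose N := (size gamma).-1.
have divE := Pdiv.RingMonic.rdivp_eq mM (B ^+ N).
set Q := Pdiv.CommonRing.rdivp _ _ in divE; set Rm := Pdiv.CommonRing.rmodp _ _ in divE.
have sRm : (size Rm < size gamma)%N.
  by rewrite -sM Pdiv.CommonRing.ltn_rmodp monic_neq0.
pose evs (s : C) := map_poly (horner_eval s).
have evsM s : evs s M = gamma - (phi.[s])%:P.
  rewrite /evs /M rmorphB /= map_polyC /=; congr (_ - _).
  by apply/polyP => i; rewrite coef_map /= coef_map /= horner_evalE hornerC.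
have evsH s r (p : {poly {poly C}}) : (evs s p).[r] = p.[r%:P].[s].
  have -> : (evs s p).[r] = (evs s p).[horner_eval s r%:P].
    by rewrite horner_evalE hornerC.
  by rewrite /evs horner_map /= horner_evalE.
have evsE s : evs s B ^+ N = evs s Q * (gamma - (phi.[s])%:P) + evs s Rm.
  by rewrite -evsM -rmorphXn divE rmorphD rmorphM.
have Rm0 s : phi.[s] != 0 -> evs s Rm = 0.
  move=> ps; apply/eqP; apply: contraLR ps => Rs; rewrite negbK.
  apply: contrapT => /negP ps.
  have spg : size (gamma - (phi.[s])%:P) = size gamma.
    rewrite size_polyDl // size_polyN; apply: leq_ltn_trans (size_polyC_leq1 _) sg.
  have p0 : gamma - (phi.[s])%:P != 0 by rewrite -size_poly_eq0 spg -lt0n (ltn_trans _ sg).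
  have := dvdp_exp_roots p0 (q := evs s B); rewrite spg => d.
  have {}d : gamma - (phi.[s])%:P %| evs s B ^+ N.
    apply: d => r /rootP; rewrite hornerD hornerN hornerC => /eqP.
    rewrite subr_eq0 => /eqP h; apply/rootP; rewrite evsH; apply: vanish => //.
  move: d; rewrite evsE dvdp_addr ?dvdp_mull // => /dvdp_leq -/(_ Rs).
  by rewrite spg leqNgt (leq_ltn_trans _ sRm) // size_poly.
have R0 : Rm = 0.
  apply/polyP => i; rewrite coef0; apply: poly_zero_everywhere => s.
  have : Rm`_i * phi = 0.
    apply: poly_zero_everywhere => t; rewrite hornerM.
    have [->|/Rm0 h] := eqVneq phi.[t] 0; first by rewrite mulr0.
    have : (evs t Rm)`_i = 0 by rewrite h coef0.
    by rewrite coef_map /= horner_evalE => ->; rewrite mul0r.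
  by move/eqP; rewrite mulf_eq0 (negPf phi0) orbF => /eqP ->; rewrite horner0.
have : (evs s0 B).[r0] ^+ N = 0.
  rewrite -horner_exp evsE R0 {2}/evs map_poly0 addr0 hornerM.
  by rewrite hornerD hornerN hornerC e0 subrr mulr0.
by move/eqP; rewrite expf_eq0 evsH => /andP[_ /eqP].
Qed.

(** The plane curve is obtained by restricting F and G to lines that join x and
    y to points where F and G do not vanish. *)
Lemma nonzero_locus_dense m n (F : mpoly m C) (G : mpoly n C) (b : mpoly (m + n) C)
    (x x1 : 'rV[C]_m) (y y1 : 'rV[C]_n) :
  ev F x1 != 0 -> ev G y1 != 0 -> ev F x = ev G y -> ev b (row_mx x y) != 0 ->
  exists x' y', [/\ ev F x' = ev G y', ev F x' != 0 & ev b (row_mx x' y') != 0].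
Proof.
move=> Fx1 Gy1 FG bxy.
have [Fx|Fx] := eqVneq (ev F x) 0; last by exists x, y.
apply: contrapT => none.
have [phi hphi] := line_poly F x (x1 - x).
have [gam hgam] := line_poly G y (y1 - y).
have [B hB] := plane_poly b x (x1 - x) y (y1 - y).
have at1 k (z z1 : 'rV[C]_k) : z + 1 *: (z1 - z) = z1 by rewrite scale1r addrC subrK.
have at0 k (z z1 : 'rV[C]_k) : z + 0 *: (z1 - z) = z by rewrite scale0r addr0.
have g1 : gam.[1] != 0 by rewrite hgam at1.
have g0 : gam.[0] = 0 by rewrite hgam at0 -FG.
have gam0 : gam != 0 by apply: contraNneq g1 => ->; rewrite horner0.
have lg : lead_coef gam != 0 by rewrite lead_coef_eq0.
have lgV : (lead_coef gam)^-1 != 0 by rewrite invr_eq0.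
case/eqP: bxy; rewrite -[x](at0 _ _ x1) -[y in row_mx _ y](at0 _ _ y1) -hB.
apply: (@plane_curve_vanishing ((lead_coef gam)^-1 *: phi) ((lead_coef gam)^-1 *: gam)).
- rewrite scaler_eq0 negb_or lgV /=.
  by apply: contraNneq Fx1 => p0; rewrite -(at1 _ x x1) -hphi p0 horner0.
- by rewrite monicE lead_coefZ mulVf.
- rewrite size_scale // ltnNge; apply: contra g1 => /size1_polyC e.
  by move: g0; rewrite e !hornerC => ->.
- move=> s r; rewrite !hornerZ => /(mulfI lgV) e; rewrite mulf_eq0 negb_or => /andP[_ ps].
  apply: contrapT => /eqP Bn; apply: none.
  exists (x + s *: (x1 - x)), (y + r *: (y1 - y)).
  by rewrite -hphi -hgam -hB e; split=> //; rewrite -e.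
- by rewrite !hornerZ g0 hphi at0 Fx.
Qed.

End Density.

(** * The birational map of the quotients *)

Section Core.
Variable C : numClosedFieldType.

Definition dbl_pt n (z : C) (X : 'rV[C]_n) : 'rV[C]_(1 + n) := row_mx (const_mx z) X.

Lemma dbl_ptE n (x : 'rV[C]_(1 + n)) : x = dbl_pt (x 0 0) (rsubmx x).
Proof.
rewrite /dbl_pt -[LHS]hsubmxK; congr row_mx; apply/rowP => i; rewrite !mxE ord1.
by congr (x 0 _); apply: val_inj.
Qed.

Lemma dbl_pt_inj n z z' (X X' : 'rV[C]_n) : dbl_pt z X = dbl_pt z' X' -> z = z' /\ X = X'.
Proof.
by move=> /eq_row_mx [/rowP/(_ 0)]; rewrite !mxE.
Qed.

Lemma dmul_dbl_pt n a z (A X : 'rV[C]_n) :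
  dmul (dbl_pt a A) (dbl_pt z X) = dbl_pt (a * z) (dmul A X).
Proof. by rewrite /dbl_pt dmul_row_mx; congr row_mx; apply/rowP => i; rewrite !mxE. Qed.

Lemma flip0E n (x : 'rV[C]_(1 + n)) z X : x = dbl_pt z X ->
  dmul (flip0 C n) x = dbl_pt (- z) X.
Proof.
move=> ->; rewrite /flip0 -[row_mx _ _]/(dbl_pt (-1) (const_mx 1)) dmul_dbl_pt.
by rewrite mulN1r dmul1.
Qed.

Lemma dbl_pt_neq0 n z (X : 'rV[C]_n) : z != 0 -> dbl_pt z X != 0.
Proof.
apply: contra_neq => /(congr1 (fun x : 'rV[C]_(1 + n) => lsubmx x 0 0)).
by rewrite /dbl_pt row_mxKl !mxE.
Qed.

Lemma wscale_row_mx m n (u : 'rV[nat]_m) (v : 'rV[nat]_n) (t : C) :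
  wscale (row_mx u v) t = row_mx (wscale u t) (wscale v t).
Proof. by apply/rowP => i; rewrite !mxE; case: splitP => j _; rewrite mxE. Qed.

Lemma wscale_dbl n u0 (u : 'rV[nat]_n) (t : C) :
  wscale (row_mx (const_mx u0) u) t = dbl_pt (t ^+ u0) (wscale u t).
Proof. by rewrite wscale_row_mx; congr row_mx; apply/rowP => i; rewrite !mxE. Qed.

(** The pairs (t, s) with t ^ u0 = s ^ v0 form a one-parameter group since u0 and
    v0 are coprime: with a v0 = a' u0 + 1 the parameter is l = t ^ a / s ^ a'. *)
Lemma common_root (u0 v0 : nat) (t s : C) : (0 < u0)%N -> (0 < v0)%N ->
  coprime u0 v0 -> t != 0 -> s != 0 -> t ^+ u0 = s ^+ v0 ->
  exists l, [/\ l != 0, l ^+ v0 = t & l ^+ u0 = s].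
Proof.
move=> u1 v1 cop t0 s0 e.
case: (egcdnP u0 v1) => a a' ea _; rewrite gcdnC (eqP cop) in ea.
exists (t ^+ a / s ^+ a'); split.
- by rewrite mulf_neq0 ?invr_eq0 ?expf_neq0.
- rewrite expr_div_n -!exprM ea [(a' * v0)%N]mulnC exprM -e -exprM mulnC.
  by rewrite exprD expr1 mulrAC mulfV ?mul1r ?expf_neq0.
- rewrite expr_div_n -!exprM [(a * u0)%N]mulnC exprM e -exprM mulnC ea exprD expr1.
  by rewrite mulrAC mulfV ?mul1r ?expf_neq0.
Qed.

Variables (m n : nat) (f : mpoly m C) (g : mpoly n C).
Variables (WE : mpoly (1 + m) C) (WS : mpoly (1 + n) C) (WX : mpoly (m + n) C).
Hypothesis evWE : forall z X, ev WE (dbl_pt z X) = z ^+ 2 + ev f X.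
Hypothesis evWS : forall z X, ev WS (dbl_pt z X) = z ^+ 2 + ev g X.
Hypothesis evWX : forall X Y, ev WX (row_mx X Y) = ev f X - ev g Y.
Variables (u0 v0 : nat) (u : 'rV[nat]_m) (v : 'rV[nat]_n) (w : 'rV[nat]_(m + n)).
Hypotheses (u0_gt0 : (0 < u0)%N) (v0_gt0 : (0 < v0)%N) (cop : coprime u0 v0).
Hypothesis homf : forall t X, ev f (dmul (wscale u t) X) = t ^+ (2 * u0) * ev f X.
Hypothesis homg : forall t X, ev g (dmul (wscale v t) X) = t ^+ (2 * v0) * ev g X.
Hypothesis scalw : forall s, scalings w s <->
  exists2 l : C, l != 0 & s = row_mx (wscale u (l ^+ v0)) (wscale v (l ^+ u0)).
Hypothesis f_neq0 : exists X, ev f X != 0.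
Hypothesis g_neq0 : exists Y, ev g Y != 0.

Let wE : 'rV[nat]_(1 + m) := row_mx (const_mx u0) u.
Let wS : 'rV[nat]_(1 + n) := row_mx (const_mx v0) v.

Variables (GE : set (set 'rV[C]_(1 + m))) (GS : set (set 'rV[C]_(1 + n))).
Variables (GX : set (set 'rV[C]_(m + n))).
Variables (HE : set 'rV[C]_(1 + m)) (HS : set 'rV[C]_(1 + n)) (HX : set 'rV[C]_(m + n)).
Hypothesis HGE : forall a, HE a <-> exists2 P, GE P & P a.
Hypothesis HGS : forall a, HS a <-> exists2 P, GS P & P a.
Hypothesis HGX : forall a, HX a <-> exists2 P, GX P & P a.
Hypotheses (gHE : diag_group HE) (gHS : diag_group HS) (gHX : diag_group HX).
Hypothesis HEW : forall a x, HE a -> ev WE (dmul a x) = ev WE x.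
Hypothesis HSW : forall a x, HS a -> ev WS (dmul a x) = ev WS x.
Hypothesis HXW : forall a x, HX a -> ev WX (dmul a x) = ev WX x.
Hypothesis HE_split : forall a, HE a -> exists t al,
  [/\ t != 0, HE (dbl_pt 1 al) & a = dmul (wscale wE t) (dbl_pt 1 al)].
Hypothesis HS_split : forall a, HS a -> exists t al,
  [/\ t != 0, HS (dbl_pt 1 al) & a = dmul (wscale wS t) (dbl_pt 1 al)].
Hypothesis HX_split : forall a, HX a -> exists s al be,
  [/\ scalings w s, HE (dbl_pt 1 al), HS (dbl_pt 1 be) & a = dmul s (row_mx al be)].
Hypothesis HX_of : forall al be, HE (dbl_pt 1 al) -> HS (dbl_pt 1 be) ->
  exists2 s, scalings w s & HX (dmul s (row_mx al be)).

Lemma HE_f al X : HE (dbl_pt 1 al) -> ev f (dmul al X) = ev f X.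
Proof.
move=> Hal; have := HEW (dbl_pt 0 X) Hal; rewrite dmul_dbl_pt mulr0 !evWE expr0n /=.
by rewrite !add0r.
Qed.

Lemma homWE t x : ev WE (dmul (wscale wE t) x) = t ^+ (2 * u0) * ev WE x.
Proof.
rewrite [x]dbl_ptE /wE wscale_dbl dmul_dbl_pt !evWE homf mulrDr exprMn.
by rewrite -exprM [(u0 * 2)%N]mulnC.
Qed.

Lemma homWS t x : ev WS (dmul (wscale wS t) x) = t ^+ (2 * v0) * ev WS x.
Proof.
rewrite [x]dbl_ptE /wS wscale_dbl dmul_dbl_pt !evWS homg mulrDr exprMn.
by rewrite -exprM [(v0 * 2)%N]mulnC.
Qed.

Lemma homWE0 t x : t != 0 -> ev WE x = 0 -> ev WE (dmul (wscale wE t) x) = 0.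
Proof. by move=> _ h; rewrite homWE h mulr0. Qed.
Lemma homWS0 t x : t != 0 -> ev WS x = 0 -> ev WS (dmul (wscale wS t) x) = 0.
Proof. by move=> _ h; rewrite homWS h mulr0. Qed.

Lemma homWX0 t x : t != 0 -> ev WX x = 0 -> ev WX (dmul (wscale w t) x) = 0.
Proof.
move=> t0; have [l l0 ->] : exists2 l : C, l != 0 &
    wscale w t = row_mx (wscale u (l ^+ v0)) (wscale v (l ^+ u0)).
  by apply/scalw; exists t.
rewrite -[x]hsubmxK dmul_row_mx !evWX homf homg -!exprM mulnCA [(u0 * _)%N]mulnCA.
by rewrite [(u0 * v0)%N]mulnC -mulrBr => ->; rewrite mulr0.
Qed.

Let E := whyp_quot wE WE GE.
Let S0 := whyp_quot wS WS GS.
Let XG := whyp_quot w WX GX.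
Let repE := @whyp_quot_rep C _ wE WE GE.
Let repS := @whyp_quot_rep C _ wS WS GS.
Let repX := @whyp_quot_rep C _ w WX GX.

Let HEW0 a x : HE a -> ev WE x = 0 -> ev WE (dmul a x) = 0.
Proof. by move=> Ha h; rewrite HEW. Qed.
Let HSW0 a x : HS a -> ev WS x = 0 -> ev WS (dmul a x) = 0.
Proof. by move=> Ha h; rewrite HSW. Qed.
Let HXW0 a x : HX a -> ev WX x = 0 -> ev WX (dmul a x) = 0.
Proof. by move=> Ha h; rewrite HXW. Qed.

Let cE : coordinates repE := (whyp_quot_coordinates homWE0 HGE gHE HEW0).1.
Let oE : torus_orbits (mulset (scalings wE) HE) repE :=
  (whyp_quot_coordinates homWE0 HGE gHE HEW0).2.
Let cS : coordinates repS := (whyp_quot_coordinates homWS0 HGS gHS HSW0).1.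
Let oS : torus_orbits (mulset (scalings wS) HS) repS :=
  (whyp_quot_coordinates homWS0 HGS gHS HSW0).2.
Let cX : coordinates repX := (whyp_quot_coordinates homWX0 HGX gHX HXW0).1.
Let oX : torus_orbits (mulset (scalings w) HX) repX :=
  (whyp_quot_coordinates homWX0 HGX gHX HXW0).2.

Lemma TE_split t : mulset (scalings wE) HE t -> exists s al,
  [/\ s != 0, HE (dbl_pt 1 al) & t = dmul (wscale wE s) (dbl_pt 1 al)].
Proof.
move=> [_ [a [[s s0 ->] /HE_split [r [al [r0 Hal ->]]] ->]]].
by exists (s * r), al; rewrite mulf_neq0 // dmulA wscaleM.
Qed.

Lemma TS_split t : mulset (scalings wS) HS t -> exists s al,
  [/\ s != 0, HS (dbl_pt 1 al) & t = dmul (wscale wS s) (dbl_pt 1 al)].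
Proof.
move=> [_ [a [[s s0 ->] /HS_split [r [al [r0 Hal ->]]] ->]]].
by exists (s * r), al; rewrite mulf_neq0 // dmulA wscaleM.
Qed.

Lemma TX_split t : mulset (scalings w) HX t -> exists l al be,
  [/\ l != 0, HE (dbl_pt 1 al), HS (dbl_pt 1 be) &
      t = dmul (row_mx (wscale u (l ^+ v0)) (wscale v (l ^+ u0))) (row_mx al be)].
Proof.
move=> [s [a [Ss /HX_split [s' [al [be [Ss' Hal Hbe ->]]]] ->]]].
have : scalings w (dmul s s') by have [[_ h _] _] := scalings_group C w; apply: h.
move/scalw => [l l0 e]; exists l, al, be; split=> //.
by rewrite dmulA e.
Qed.

Lemma TX_of l al be : l != 0 -> HE (dbl_pt 1 al) -> HS (dbl_pt 1 be) ->
  mulset (scalings w) HX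
    (dmul (row_mx (wscale u (l ^+ v0)) (wscale v (l ^+ u0))) (row_mx al be)).
Proof.
move=> l0 Hal Hbe; have [s Ss Hs] := HX_of Hal Hbe.
have [[_ SM _] SV] := scalings_group C w; have [s' Ss' ss'] := SV s Ss.
have Sl : scalings w (row_mx (wscale u (l ^+ v0)) (wscale v (l ^+ u0))).
  by apply/scalw; exists l.
eexists; eexists; split; first exact: SM Sl Ss'.
  exact: Hs.
by rewrite -!dmulA; congr dmul; rewrite dmulA ss' dmul1.
Qed.

Section Involutions.
Variables (sE : E -> E) (s0 : S0 -> S0).
Hypotheses (sE_ind : induced_by (flip0 C m) sE) (s0_ind : induced_by (flip0 C n) s0).

Lemma flip_E x : ev WE (dmul (flip0 C m) x) = ev WE x.
Proof. by rewrite (flip0E (dbl_ptE x)) [in RHS](dbl_ptE x) !evWE sqrrN. Qed.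
Lemma flip_S x : ev WS (dmul (flip0 C n) x) = ev WS x.
Proof. by rewrite (flip0E (dbl_ptE x)) [in RHS](dbl_ptE x) !evWS sqrrN. Qed.

Lemma flip0_neq0 k i : flip0 C k 0 i != 0.
Proof. by rewrite !mxE; case: splitP => j _; rewrite mxE ?oppr_eq0 oner_eq0. Qed.

Lemma sE_rep z X c : repE (dbl_pt z X) c -> repE (dbl_pt (- z) X) (sE c).
Proof.
move=> h; rewrite -(flip0E (erefl (dbl_pt z X))).
apply: (induced_by_rep homWE0 _ _ sE_ind h); first exact: flip0_neq0.
by move=> x; rewrite flip_E.
Qed.

Lemma s0_rep z X c : repS (dbl_pt z X) c -> repS (dbl_pt (- z) X) (s0 c).
Proof.
move=> h; rewrite -(flip0E (erefl (dbl_pt z X))).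
apply: (induced_by_rep homWS0 _ _ s0_ind h); first exact: flip0_neq0.
by move=> x; rewrite flip_S.
Qed.

Lemma sEK : involutive sE.
Proof.
case: cE => sur fn _ _ c; have [x] := sur c; rewrite (dbl_ptE x) => xc.
by apply: fn (sE_rep (sE_rep xc)) _; rewrite opprK.
Qed.

Lemma s0K : involutive s0.
Proof.
case: cS => sur fn _ _ c; have [x] := sur c; rewrite (dbl_ptE x) => xc.
by apply: fn (s0_rep (s0_rep xc)) _; rewrite opprK.
Qed.

Lemma s0_open V : opn V -> opn (s0 @^-1` V).
Proof.
case: cS => sur fn oV _ /oV h; apply/oV => x p xp Vp.
have xp' := xp; rewrite (dbl_ptE x) in xp'; have := s0_rep xp'.
rewrite -(flip0E (dbl_ptE x)) => sxp; have [b [bx hb]] := h _ _ sxp Vp.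
have [b' hb'] := poly_subst b (fun i => flip0 C n 0 i *: mpolyX C (mnm1 i)).
have b'E y : ev b' y = ev b (dmul (flip0 C n) y).
  by rewrite hb'; congr ev; apply/rowP => i; rewrite mxE dmulE evZ evV.
exists b'; rewrite b'E; split=> // y q yq; rewrite b'E => by0; apply: hb by0.
by rewrite (flip0E (dbl_ptE y)); apply: s0_rep; rewrite -dbl_ptE.
Qed.

Notation Q0 := (quot (@pair_orbit C E S0 sE s0)).
Notation q0 := (qproj (@pair_orbit C E S0 sE s0)).
Let cES := coordinates_prod cE cS oE oS.
Let cQ : coordinates (@quot_rep C _ _ (prod_rep repE repS) (@pair_orbit C E S0 sE s0)) :=
  coordinates_quot _ cES.

Definition rep4 (z1 : C) (X : 'rV[C]_m) (z2 : C) (Y : 'rV[C]_n) (c : Q0) : Prop :=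
  exists e y, [/\ repE (dbl_pt z1 X) e, repS (dbl_pt z2 Y) y & c = q0 (e, y)].

Definition pt4 (z1 : C) (X : 'rV[C]_m) (z2 : C) (Y : 'rV[C]_n) :
  'rV[C]_((1 + m) + (1 + n)) := row_mx (dbl_pt z1 X) (dbl_pt z2 Y).

Lemma pt4E (x : 'rV[C]_((1 + m) + (1 + n))) : exists z1 X z2 Y, x = pt4 z1 X z2 Y.
Proof.
exists (lsubmx x 0 0), (rsubmx (lsubmx x)), (rsubmx x 0 0), (rsubmx (rsubmx x)).
by rewrite /pt4 -!dbl_ptE hsubmxK.
Qed.

Lemma quot_repE z1 X z2 Y c :
  quot_rep (prod_rep repE repS) (pt4 z1 X z2 Y) c <-> rep4 z1 X z2 Y c.
Proof.
split=> [[[e y] [/= xe xy] ->]|[e [y [xe xy ->]]]].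
  by exists e, y; move: xe xy; rewrite /pt4 row_mxKl row_mxKr.
by exists (e, y) => //; rewrite /prod_rep /pt4 row_mxKl row_mxKr.
Qed.

Lemma q0E e y e' y' : q0 (e, y) = q0 (e', y') <->
  (e', y') = (e, y) \/ (e', y') = (sE e, s0 y).
Proof. by apply: qproj_pair; [exact: sEK|exact: s0K]. Qed.

Lemma repE_eq z X z' X' e : repE (dbl_pt z X) e -> repE (dbl_pt z' X') e ->
  exists s al, [/\ s != 0, HE (dbl_pt 1 al), z' = s ^+ u0 * z &
                   X' = dmul (wscale u s) (dmul al X)].
Proof.
case: oE => _ _ orb xe xe'; have [t /TE_split [s [al [s0' Hal ->]]]] := orb _ _ _ xe xe'.
rewrite /wE wscale_dbl -dmulA !dmul_dbl_pt mul1r => /dbl_pt_inj [-> ->].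
by exists s, al.
Qed.

Lemma repS_eq z X z' X' e : repS (dbl_pt z X) e -> repS (dbl_pt z' X') e ->
  exists s al, [/\ s != 0, HS (dbl_pt 1 al), z' = s ^+ v0 * z &
                   X' = dmul (wscale v s) (dmul al X)].
Proof.
case: oS => _ _ orb xe xe'; have [t /TS_split [s [al [s0' Hal ->]]]] := orb _ _ _ xe xe'.
rewrite /wS wscale_dbl -dmulA !dmul_dbl_pt mul1r => /dbl_pt_inj [-> ->].
by exists s, al.
Qed.

Lemma repX_eq X Y X' Y' d : repX (row_mx X Y) d -> repX (row_mx X' Y') d ->
  exists l al be, [/\ l != 0, HE (dbl_pt 1 al), HS (dbl_pt 1 be),
    X' = dmul (wscale u (l ^+ v0)) (dmul al X) & Y' = dmul (wscale v (l ^+ u0)) (dmul be Y)].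
Proof.
case: oX => _ _ orb xe xe'; have [t /TX_split [l [al [be [l0 Hal Hbe ->]]]]] := orb _ _ _ xe xe'.
rewrite -dmulA !dmul_row_mx => /eq_row_mx [-> ->].
by exists l, al, be.
Qed.

Lemma repE_scale s al z X e : s != 0 -> HE (dbl_pt 1 al) -> repE (dbl_pt z X) e ->
  repE (dbl_pt (s ^+ u0 * z) (dmul (wscale u s) (dmul al X))) e.
Proof.
move=> s0' Hal xe; case: oE => _ st _.
have Ts : mulset (scalings wE) HE (dmul (wscale wE s) (dbl_pt 1 al)).
  by exists (wscale wE s), (dbl_pt 1 al); split=> //; exists s.
by have := st _ _ _ Ts xe; rewrite /wE wscale_dbl -dmulA !dmul_dbl_pt mul1r.
Qed.

Lemma repS_scale s al z X e : s != 0 -> HS (dbl_pt 1 al) -> repS (dbl_pt z X) e ->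
  repS (dbl_pt (s ^+ v0 * z) (dmul (wscale v s) (dmul al X))) e.
Proof.
move=> s0' Hal xe; case: oS => _ st _.
have Ts : mulset (scalings wS) HS (dmul (wscale wS s) (dbl_pt 1 al)).
  by exists (wscale wS s), (dbl_pt 1 al); split=> //; exists s.
by have := st _ _ _ Ts xe; rewrite /wS wscale_dbl -dmulA !dmul_dbl_pt mul1r.
Qed.

Lemma HE1 : HE (dbl_pt 1 (const_mx 1)).
Proof. by case: gHE => [[h _ _] _]; rewrite /dbl_pt row_mx_const. Qed.
Lemma HS1 : HS (dbl_pt 1 (const_mx 1)).
Proof. by case: gHS => [[h _ _] _]; rewrite /dbl_pt row_mx_const. Qed.

Lemma rep4_flip z1 X z2 Y c : rep4 z1 X z2 Y c -> rep4 (- z1) X (- z2) Y c.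
Proof.
move=> [e [y [xe xy ->]]]; exists (sE e), (s0 y); split.
- exact: sE_rep.
- exact: s0_rep.
- by apply/q0E; right.
Qed.

Lemma rep4_eqs z1 X z2 Y c : rep4 z1 X z2 Y c ->
  z1 ^+ 2 = - ev f X /\ z2 ^+ 2 = - ev g Y.
Proof.
move=> [e [y [/(whyp_quot_rep_zero (W:=WE)) [_ h1] /(whyp_quot_rep_zero (W:=WS)) [_ h2] _]]].
by split; apply/eqP; rewrite -subr_eq0 opprK -?evWE -?evWS ?h1 ?h2.
Qed.

Lemma rep4_ex z1 X z2 Y : dbl_pt z1 X != 0 -> dbl_pt z2 Y != 0 ->
  z1 ^+ 2 = - ev f X -> z2 ^+ 2 = - ev g Y -> exists c, rep4 z1 X z2 Y c.
Proof.
move=> n1 n2 h1 h2.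
have [e xe] : exists e, repE (dbl_pt z1 X) e.
  by apply: (whyp_quot_rep_ex homWE0) => //; rewrite evWE h1 addNr.
have [y xy] : exists e, repS (dbl_pt z2 Y) e.
  by apply: (whyp_quot_rep_ex homWS0) => //; rewrite evWS h2 addNr.
by exists (q0 (e, y)), e, y.
Qed.

Lemma repX_eqs X Y d : repX (row_mx X Y) d -> ev f X = ev g Y.
Proof.
by move=> /(whyp_quot_rep_zero (W:=WX)) [_ /eqP]; rewrite evWX subr_eq0 => /eqP.
Qed.

Lemma ev_f0 : ev f 0 = 0.
Proof.
have := homf 0 0; have -> : dmul (wscale u 0) 0 = 0 :> 'rV[C]_m.
  by apply/rowP => i; rewrite !mxE mulr0.
by move=> {1}->; rewrite expr0n muln_eq0 /= (gtn_eqF u0_gt0) mul0r.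
Qed.

Lemma repX_ex X Y : ev f X = ev g Y -> ev f X != 0 -> exists d, repX (row_mx X Y) d.
Proof.
move=> fg f0; apply: (whyp_quot_rep_ex homWX0).
  apply: contraNneq f0; rewrite -(@row_mx0 _ 1 m n) => /eq_row_mx [-> _].
  by rewrite ev_f0.
by rewrite evWX fg subrr.
Qed.

(** On the slice of vectors (z, X, z, Y) the two quotients are the same: an
    element of the torus of E x S that maps one such vector to another scales
    the two blocks by t and s with t^u0 = s^v0, that is by l^v0 and l^u0; the
    sign of z is absorbed by the paired involution. *)
Lemma slice_quotients z X Y z' X' Y' c c' d d' : z != 0 -> z' != 0 ->
  rep4 z X z Y c -> rep4 z' X' z' Y' c' ->
  repX (row_mx X Y) d -> repX (row_mx X' Y') d' -> c = c' <-> d = d'.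
Proof.
move=> z0 z'0 rc rc' rd rd'; have [[zf zg] [z'f z'g]] := (rep4_eqs rc, rep4_eqs rc').
have [fnX stX] : (forall x p q, repX x p -> repX x q -> p = q) /\
  forall t x p, mulset (scalings w) HX t -> repX x p -> repX (dmul t x) p.
  by case: cX oX => ? ? ? ? [].
split=> [cc'|dd'].
  have [z1 [z1z rc1]] : exists z1, (z1 = z \/ z1 = - z) /\
      exists e y, [/\ repE (dbl_pt z1 X) e, repS (dbl_pt z1 Y) y,
                      repE (dbl_pt z' X') e & repS (dbl_pt z' Y') y].
    case: rc rc' => e [y [xe xy cE']] [e' [y' [xe' xy' c'E]]].
    have := cc'; rewrite cE' c'E => /q0E [[e1 e2]|[e1 e2]]; subst e' y'.
      by exists z; split; [left|exists e, y].
    exists (- z); split; first by right.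
    by exists (sE e), (s0 y); split=> //; [exact: sE_rep|exact: s0_rep].
  have z10 : z1 != 0 by case: z1z => ->; rewrite ?oppr_eq0.
  have [e [y [xe xy xe' xy']]] := rc1.
  have [s [al [s_0 Hal e1 eX]]] := repE_eq xe xe'.
  have [r [be [r_0 Hbe e2 eY]]] := repS_eq xy xy'.
  have [l [l0 el er]] : exists l, [/\ l != 0, l ^+ v0 = s & l ^+ u0 = r].
    by apply: common_root => //; apply: (mulIf z10); rewrite -e1 -e2.
  have := stX _ _ _ (TX_of l0 Hal Hbe) rd; rewrite -dmulA !dmul_row_mx el er.
  by rewrite -eX -eY => rd1; exact: fnX rd1 rd'.
have [l [al [be [l0 Hal Hbe eX eY]]]] : exists l al be, [/\ l != 0, HE (dbl_pt 1 al),
    HS (dbl_pt 1 be), X' = dmul (wscale u (l ^+ v0)) (dmul al X) &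
    Y' = dmul (wscale v (l ^+ u0)) (dmul be Y)].
  by apply: repX_eq rd _; rewrite dd'.
have : z' ^+ 2 == (l ^+ (u0 * v0) * z) ^+ 2.
  rewrite z'f eX homf HE_f // exprMn zf -!exprM mulrN; apply/eqP; congr (- (l ^+ _ * _)).
  by rewrite mulnCA mulnC [(v0 * u0)%N]mulnC.
have half z1 c1 : z' = l ^+ (u0 * v0) * z1 -> rep4 z1 X z1 Y c1 -> c1 = c'.
  move=> z1z [e [y [xe xy ->]]]; case: rc' => e' [y' [xe' xy' ->]].
  have lv0 : l ^+ v0 != 0 by rewrite expf_neq0.
  have lu0 : l ^+ u0 != 0 by rewrite expf_neq0.
  have := repE_scale lv0 Hal xe; rewrite -exprM mulnC -z1z -eX => xe1.
  have := repS_scale lu0 Hbe xy; rewrite -exprM -z1z -eY => xy1.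
  case: cE cS => _ fE _ _ [_ fS _ _].
  by rewrite (fE _ _ _ xe1 xe') (fS _ _ _ xy1 xy').
rewrite eqf_sqr => /orP[/eqP e|/eqP e]; first exact: half e rc.
by apply: half (rep4_flip rc); rewrite mulrN.
Qed.

(** The graph of the birational map between Q0 and XG, which is a partial
    bijection by [slice_quotients]. *)
Definition Rel (c : Q0) (d : XG) : Prop :=
  exists z X Y, [/\ z != 0, rep4 z X z Y c & repX (row_mx X Y) d].

Lemma Rel_inj c c' d d' : Rel c d -> Rel c' d' -> c = c' <-> d = d'.
Proof.
move=> [z [X [Y [z0 xc xd]]]] [z' [X' [Y' [z'0 xc' xd']]]].
exact: slice_quotients z0 z'0 xc xc' xd xd'.
Qed.

Variables a a' b b' : nat.
Hypotheses (ab_a : (a * v0 = a' * u0 + 1)%N) (ab_b : (b * u0 = b' * v0 + 1)%N).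

Definition scaleX (z1 z2 : C) := z1 ^+ a' * z2 ^+ b.
Definition scaleY (z1 z2 : C) := z1 ^+ a * z2 ^+ b'.
Definition Fmap z1 X z2 Y : 'rV[C]_(m + n) :=
  row_mx (dmul (wscale u (scaleX z1 z2)) X) (dmul (wscale v (scaleY z1 z2)) Y).

Lemma scale_slice z1 z2 : scaleX z1 z2 ^+ u0 * z1 = scaleY z1 z2 ^+ v0 * z2.
Proof.
rewrite /scaleX /scaleY !exprMn -!exprM ab_a ab_b !exprD !expr1; ring.
Qed.

(** A point with coordinates (z1, X, z2, Y) is moved into the slice by the
    scalings by scaleX and scaleY. *)
Lemma Rel_Fmap z1 X z2 Y c : z1 != 0 -> z2 != 0 -> rep4 z1 X z2 Y c ->
  exists d, Rel c d /\ repX (Fmap z1 X z2 Y) d.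
Proof.
move=> z10 z20 [e [y [xe xy ->]]].
have sX0 : scaleX z1 z2 != 0 by rewrite mulf_neq0 ?expf_neq0.
have sY0 : scaleY z1 z2 != 0 by rewrite mulf_neq0 ?expf_neq0.
have := repE_scale sX0 HE1 xe; have := repS_scale sY0 HS1 xy.
rewrite !dmul1 scale_slice => xy1 xe1.
have rc : rep4 (scaleY z1 z2 ^+ v0 * z2) (dmul (wscale u (scaleX z1 z2)) X)
    (scaleY z1 z2 ^+ v0 * z2) (dmul (wscale v (scaleY z1 z2)) Y) (q0 (e, y)).
  by exists e, y.
have z0 : scaleY z1 z2 ^+ v0 * z2 != 0 by rewrite mulf_neq0 ?expf_neq0.
have [zf zg] := rep4_eqs rc.
have [||d xd] := @repX_ex (dmul (wscale u (scaleX z1 z2)) X) (dmul (wscale v (scaleY z1 z2)) Y).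
- by apply: oppr_inj; rewrite -zf -zg.
- by rewrite -oppr_eq0 -zf expf_neq0.
by exists d; split=> //; do 3 eexists; split; [exact: z0|exact: rc|].
Qed.

Lemma Rel_neq0 c d z1 X z2 Y : Rel c d -> rep4 z1 X z2 Y c -> z1 != 0 /\ z2 != 0.
Proof.
move=> [z [X' [Y' [z0 [e [y [xe xy ->]]] _]]]] [e' [y' [xe' xy' /q0E eq]]].
have half z' X1 Y1 : z' != 0 -> repE (dbl_pt z' X1) e' -> repS (dbl_pt z' Y1) y' ->
    z1 != 0 /\ z2 != 0.
  move=> z'0 xe1 xy1; have [s [al [s_0 _ -> _]]] := repE_eq xe1 xe'.
  have [r [be [r_0 _ -> _]]] := repS_eq xy1 xy'.
  by rewrite !mulf_neq0 ?expf_neq0.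
case: eq => -[e1 e2]; subst; first exact: half z0 xe xy.
by apply: half (sE_rep xe) (s0_rep xy); rewrite oppr_eq0.
Qed.

Lemma Rel_rep c d X Y : Rel c d -> repX (row_mx X Y) d ->
  ev f X != 0 /\ forall z, z ^+ 2 = - ev f X -> rep4 z X z Y c.
Proof.
move=> cd xd; have [z [X' [Y' [z0 xc xd']]]] := cd.
have [zf zg] := rep4_eqs xc.
have fX : ev f X != 0.
  have [l [al [be [l0 Hal Hbe -> _]]]] := repX_eq xd' xd.
  by rewrite homf HE_f // mulf_neq0 ?expf_neq0 // -oppr_eq0 -zf expf_neq0.
split=> // z1 z1f; have z10 : z1 != 0.
  by apply: contraNneq fX => z10; rewrite -oppr_eq0 -z1f z10 expr0n.
have [c1 xc1] : exists c1, rep4 z1 X z1 Y c1.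
  by apply: rep4_ex => //; rewrite ?dbl_pt_neq0 // -(repX_eqs xd).
have cd1 : Rel c1 d by exists z1, X, Y.
by have [_ /(_ erefl) ->] := Rel_inj cd cd1.
Qed.

Lemma Rel_ex X Y d : repX (row_mx X Y) d -> ev f X != 0 -> exists c, Rel c d.
Proof.
move=> xd fX; pose z := sqrtC (- ev f X).
have zf : z ^+ 2 = - ev f X by rewrite sqrtCK.
have z0 : z != 0 by rewrite sqrtC_eq0 oppr_eq0.
have [c xc] : exists c, rep4 z X z Y c.
  by apply: rep4_ex => //; rewrite ?dbl_pt_neq0 // -(repX_eqs xd).
by exists c, z, X, Y.
Qed.

Definition Dset : set Q0 := [set c | exists d, Rel c d].
Definition DXset : set XG := [set d | exists c, Rel c d].

Lemma Dset_rep z1 X z2 Y c : rep4 z1 X z2 Y c -> Dset c <-> z1 != 0 /\ z2 != 0.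
Proof.
move=> xc; split=> [[d cd]|[z10 z20]]; first exact: Rel_neq0 cd xc.
by have [d [cd _]] := Rel_Fmap z10 z20 xc; exists d.
Qed.

Lemma DXset_rep X Y d : repX (row_mx X Y) d -> DXset d <-> ev f X != 0.
Proof.
move=> xd; split=> [[c cd]|fX]; first by case: (Rel_rep cd xd).
exact: Rel_ex xd fX.
Qed.

Lemma Fmap_poly (p : mpoly (m + n) C) : exists p' : mpoly ((1 + m) + (1 + n)) C,
  forall z1 X z2 Y, ev p' (pt4 z1 X z2 Y) = ev p (Fmap z1 X z2 Y).
Proof.
pose Z1 : mpoly ((1 + m) + (1 + n)) C := mpolyX C (mnm1 (lshift (1 + n) (lshift m 0))).
pose Z2 : mpoly ((1 + m) + (1 + n)) C := mpolyX C (mnm1 (rshift (1 + m) (lshift n 0))).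
have [p' hp'] := poly_subst p (fun i => match split i with
  | inl j => (Z1 ^+ a' * Z2 ^+ b) ^+ u 0 j * mpolyX C (mnm1 (lshift (1 + n) (rshift 1 j)))
  | inr j => (Z1 ^+ a * Z2 ^+ b') ^+ v 0 j * mpolyX C (mnm1 (rshift (1 + m) (rshift 1 j)))
  end).
exists p' => z1 X z2 Y; rewrite hp'; congr ev; apply/rowP => i; rewrite mxE.
rewrite /Fmap -[in RHS](splitK i); case: (split i) => j /=.
  rewrite row_mxEl dmulE mxE /scaleX evM evXn evM !evXn !evV /pt4 /dbl_pt.
  by rewrite !row_mxEl !row_mxEr !row_mxEl !mxE.
rewrite row_mxEr dmulE mxE /scaleY evM evXn evM !evXn !evV /pt4 /dbl_pt.
by rewrite !row_mxEl !row_mxEr !row_mxEl !mxE.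
Qed.

(** On the slice z^2 = - f, so that every power of z reduces to 1 or z. *)
Lemma parity_parts (p : mpoly ((1 + m) + (1 + n)) C) :
  exists p0 p1 : mpoly (m + n) C, forall z X Y, z ^+ 2 = - ev f X ->
    ev p (pt4 z X z Y) = ev p0 (row_mx X Y) + z * ev p1 (row_mx X Y).
Proof.
have [fl hfl] := @poly_lsubmx C m n f.
elim/mpoly_ring_ind: p => [c|i|p q [p0 [p1 hp]] [r0 [r1 hr]]|p q [p0 [p1 hp]] [r0 [r1 hr]]].
- by exists (mpolyC _ c), 0 => z X Y _; rewrite ev0 !evC mulr0 addr0.
- rewrite -(splitK i); case: (split i) => j /=; rewrite -(splitK j); case: (split j) => k /=.
  + exists 0, 1 => z X Y _; rewrite evV ev0 ev1 add0r mulr1 /pt4 /dbl_pt.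
    by rewrite !row_mxEl mxE.
  + exists (mpolyX C (mnm1 (lshift n k))), 0 => z X Y _.
    by rewrite !evV ev0 mulr0 addr0 /pt4 /dbl_pt row_mxEl row_mxEr row_mxEl.
  + exists 0, 1 => z X Y _; rewrite evV ev0 ev1 add0r mulr1 /pt4 /dbl_pt.
    by rewrite row_mxEr row_mxEl mxE.
  + exists (mpolyX C (mnm1 (rshift m k))), 0 => z X Y _.
    by rewrite !evV ev0 mulr0 addr0 /pt4 /dbl_pt !row_mxEr.
- exists (p0 + r0), (p1 + r1) => z X Y zf.
  by rewrite !evD hp // hr //; ring.
- exists (p0 * r0 - fl * (p1 * r1)), (p0 * r1 + p1 * r0) => z X Y zf.
  rewrite evM hp // hr // evD -mulN1r !evM !evD !evM hfl row_mxKl.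
  rewrite (_ : ev (-1) _ = -1); last by rewrite /ev rmorphN1.
  by have -> : ev f X = - z ^+ 2; [rewrite zf opprK|ring].
Qed.

Lemma sign_split (h r0 r1 p0 p1 z : C) : z != 0 ->
  h * (r0 + z * r1) = p0 + z * p1 -> h * (r0 + - z * r1) = p0 + - z * p1 ->
  h * r0 = p0 /\ h * r1 = p1.
Proof.
move=> z0 e1 e2; have two : 2%:R != 0 :> C by rewrite pnatr_eq0.
split.
  apply: (mulfI two); transitivity (h * (r0 + z * r1) + h * (r0 + - z * r1)); first by ring.
  by rewrite e1 e2; ring.
apply: (mulfI z0); apply: (mulfI two).
transitivity (h * (r0 + z * r1) - h * (r0 + - z * r1)); first by ring.
by rewrite e1 e2; ring.
Qed.

Section Maps.
Variables (c0 : Q0) (d0 : XG).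

Definition phi_map (c : Q0) : XG :=
  if pselect (exists d, Rel c d) is left h then projT1 (cid h) else d0.
Definition psi_map (d : XG) : Q0 :=
  if pselect (exists c, Rel c d) is left h then projT1 (cid h) else c0.

Lemma phi_mapE c d : Rel c d -> phi_map c = d.
Proof.
move=> cd; rewrite /phi_map; case: pselect => [h|[]]; last by exists d.
exact: (Rel_inj (projT2 (cid h)) cd).1 erefl.
Qed.

Lemma psi_mapE c d : Rel c d -> psi_map d = c.
Proof.
move=> cd; rewrite /psi_map; case: pselect => [h|[]]; last by exists c.
exact: (Rel_inj (projT2 (cid h)) cd).2 erefl.
Qed.

Let z12 : mpoly ((1 + m) + (1 + n)) C :=
  mpolyX C (mnm1 (lshift (1 + n) (lshift m 0))) * mpolyX C (mnm1 (rshift (1 + m) (lshift n 0))).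
Let z12E z1 X z2 Y : ev z12 (pt4 z1 X z2 Y) = z1 * z2.
Proof. by rewrite evM !evV /pt4 /dbl_pt !row_mxEl row_mxEr row_mxEl !mxE. Qed.

Lemma phi_rep z1 X z2 Y c : z1 != 0 -> z2 != 0 -> rep4 z1 X z2 Y c ->
  Dset c /\ repX (Fmap z1 X z2 Y) (phi_map c).
Proof.
move=> z10 z20 xc; have [d [cd Fd]] := Rel_Fmap z10 z20 xc.
by rewrite (phi_mapE cd); split=> //; exists d.
Qed.

Lemma locmorph_phi : locmorph Dset phi_map.
Proof.
case: (cQ) (cX) => _ _ oQ rQ [_ _ oXG rXG].
have op O : opn O -> opn (Dset `&` phi_map @^-1` O).
  move=> oO; apply/oQ => x c; have [z1 [X [z2 [Y ->]]]] := pt4E x.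
  move/quot_repE => xc [Dc Oc]; have [z10 z20] := (Dset_rep xc).1 Dc.
  have [_ Fx] := phi_rep z10 z20 xc.
  have [p [px hp]] := (oXG O).1 oO _ _ Fx Oc; have [p' hp'] := Fmap_poly p.
  exists (z12 * p'); rewrite evM z12E hp' !mulf_neq0 //; split=> // y c'.
  have [z1' [X' [z2' [Y' ->]]]] := pt4E y; move/quot_repE => xc'.
  rewrite evM z12E hp' !mulf_eq0 !negb_or => /andP[/andP[z1'0 z2'0] p'y].
  have [Dc' Fx'] := phi_rep z1'0 z2'0 xc'.
  by split=> //; apply: hp Fx' p'y.
split=> // O h oO rh; apply/(rQ _ _ (op O oO)) => x c.
have [z1 [X [z2 [Y ->]]]] := pt4E x.
move/quot_repE => xc [Dc Oc]; have [z10 z20] := (Dset_rep xc).1 Dc.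
have [_ Fx] := phi_rep z10 z20 xc.
have [p [r [rx hp]]] := (rXG O h oO).1 rh _ _ Fx Oc.
have [p' hp'] := Fmap_poly p; have [r' hr'] := Fmap_poly r.
exists p', r'; rewrite hr'; split=> // y c'.
have [z1' [X' [z2' [Y' ->]]]] := pt4E y; move/quot_repE => xc' [Dc' Oc'].
have [z1'0 z2'0] := (Dset_rep xc').1 Dc'; have [_ Fx'] := phi_rep z1'0 z2'0 xc'.
by rewrite hr' hp'; apply: hp.
Qed.

Lemma psi_rep X Y d : repX (row_mx X Y) d -> ev f X != 0 ->
  DXset d /\ forall z, z ^+ 2 = - ev f X -> rep4 z X z Y (psi_map d).
Proof.
move=> xd fX; have [c cd] := Rel_ex xd fX; split; first by exists c.
by rewrite (psi_mapE cd); case: (Rel_rep cd xd).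
Qed.

(** The square root z is not a polynomial in (X, Y), but a function of the class
    of (z, X, z, Y) takes the same value at z and - z, so that the even and the odd
    part of a local fraction both represent it; their denominators do not both
    vanish. *)
Lemma locmorph_psi : locmorph DXset psi_map.
Proof.
case: (cQ) (cX) => _ _ oQ rQ [_ _ oXG rXG].
(* Multiplying by f cuts out the locus where the inverse map is defined. *)
have [fl hfl] := @poly_lsubmx C m n f.
have flE X Y : ev fl (row_mx X Y) = ev f X by rewrite hfl row_mxKl.
have op O : opn O -> opn (DXset `&` psi_map @^-1` O).
  move=> oO; apply/oXG => x d; rewrite -[x]hsubmxK.
  move: (lsubmx x) (rsubmx x) => X Y xd [DXd Od].
  have fX := (DXset_rep xd).1 DXd; have [_ /(_ _ (sqrtCK _))] := psi_rep xd fX.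
  set z := sqrtC _ => xc; have zf : z ^+ 2 = - ev f X := sqrtCK _.
  have [p [px hp]] := (oQ O).1 oO _ _ ((quot_repE _ _ _ _ _).2 xc) Od.
  have [p0 [p1 hpp]] := parity_parts p.
  have good (p' : mpoly (m + n) C) : ev p' (row_mx X Y) != 0 ->
      (forall z' X' Y', z' ^+ 2 = - ev f X' -> ev p (pt4 z' X' z' Y') = 0 ->
         ev p (pt4 (- z') X' (- z') Y') = 0 -> z' != 0 -> ev p' (row_mx X' Y') = 0) ->
      zariski_nbhs repX (DXset `&` psi_map @^-1` O) (row_mx X Y).
    move=> p'x hp'; exists (fl * p'); rewrite evM flE mulf_neq0 //; split=> // x' d'.
    rewrite -[x']hsubmxK; move: (lsubmx x') (rsubmx x') => X' Y' xd'.
    rewrite evM flE mulf_eq0 negb_or => /andP[fX' p'x'].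
    have [DXd' psid'] := psi_rep xd' fX'; split=> //.
    pose z' := sqrtC (- ev f X'); have z'f : z' ^+ 2 = - ev f X' := sqrtCK _.
    have z'0 : z' != 0 by rewrite sqrtC_eq0 oppr_eq0.
    apply: contrapT => nO; case/eqP: p'x'.
    apply: (hp' _ X' Y' z'f) => //; apply: contrapT => /eqP px'; apply: nO.
      exact: hp _ (psi_map d') ((quot_repE _ _ _ _ _).2 (psid' _ z'f)) px'.
    have z''f : (- z') ^+ 2 = - ev f X' by rewrite sqrrN.
    exact: hp _ (psi_map d') ((quot_repE _ _ _ _ _).2 (psid' _ z''f)) px'.
  have parts z' X' Y' : z' ^+ 2 = - ev f X' -> ev p (pt4 z' X' z' Y') = 0 ->
      ev p (pt4 (- z') X' (- z') Y') = 0 -> z' != 0 ->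
      ev p0 (row_mx X' Y') = 0 /\ ev p1 (row_mx X' Y') = 0.
    move=> z'f; rewrite !hpp ?sqrrN // => e1 e2 z'0.
    rewrite -[ev p0 _]mul1r -[ev p1 _]mul1r; apply: (sign_split z'0).
      by rewrite mul1r e1 mulr0 addr0.
    by rewrite mul1r e2 mulr0 addr0.
  have [p0x|p0x] := eqVneq (ev p0 (row_mx X Y)) 0; last first.
    by apply: good p0x _ => z' X' Y' z'f e1 e2 z'0; case: (parts z' X' Y').
  apply: (good p1).
    by apply: contraNneq px => p1x; rewrite hpp // p0x p1x mulr0 addr0.
  by move=> z' X' Y' z'f e1 e2 z'0; case: (parts z' X' Y').
split=> // O h oO rh; apply/(rXG _ _ (op O oO)) => x d; rewrite -[x]hsubmxK.
move: (lsubmx x) (rsubmx x) => X Y xd [DXd Od].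
have fX := (DXset_rep xd).1 DXd; have [_ /(_ _ (sqrtCK _))] := psi_rep xd fX.
set z := sqrtC _ => xc; have zf : z ^+ 2 = - ev f X := sqrtCK _.
have [p [r [rx hpr]]] := (rQ O h oO).1 rh _ _ ((quot_repE _ _ _ _ _).2 xc) Od.
(* The equation h r = p is multiplied by r so as to hold also where r vanishes. *)
have [p0 [p1 hp]] := parity_parts (p * r); have [r0 [r1 hr]] := parity_parts (r * r).
have main X' Y' d' z' : repX (row_mx X' Y') d' -> (DXset `&` psi_map @^-1` O) d' ->
    z' ^+ 2 = - ev f X' ->
    h (psi_map d') * (ev r0 (row_mx X' Y') + z' * ev r1 (row_mx X' Y')) =
      ev p0 (row_mx X' Y') + z' * ev p1 (row_mx X' Y').
  move=> xd' [DXd' Od'] z'f; rewrite -hr // -hp // !evM.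
  have [r00|r'0] := eqVneq (ev r (pt4 z' X' z' Y')) 0; first by rewrite r00 !mulr0.
  have [_ /(_ _ z'f) xc'] := psi_rep xd' ((DXset_rep xd').1 DXd').
  have := hpr _ _ ((quot_repE _ _ _ _ _).2 xc') Od' r'0; move=> ->.
  by rewrite mulrA divfK.
have main2 X' Y' d' : repX (row_mx X' Y') d' -> (DXset `&` psi_map @^-1` O) d' ->
    h (psi_map d') * ev r0 (row_mx X' Y') = ev p0 (row_mx X' Y') /\
    h (psi_map d') * ev r1 (row_mx X' Y') = ev p1 (row_mx X' Y').
  move=> xd' Dd'; have fX' := (DXset_rep xd').1 Dd'.1.
  pose z' := sqrtC (- ev f X'); have z'f : z' ^+ 2 = - ev f X' := sqrtCK _.
  have z'0 : z' != 0 by rewrite sqrtC_eq0 oppr_eq0.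
  have e1 := main _ _ _ _ xd' Dd' z'f.
  have z''f : (- z') ^+ 2 = - ev f X' by rewrite sqrrN.
  have e2 := main _ _ _ _ xd' Dd' z''f.
  exact: sign_split z'0 e1 e2.
have z0 : z != 0 by rewrite sqrtC_eq0 oppr_eq0.
have [r0x|r0x] := eqVneq (ev r0 (row_mx X Y)) 0; last first.
  exists p0, r0; split=> // x' d'; rewrite -[x']hsubmxK => xd' Dd' r0x'.
  by have [<- _] := main2 _ _ _ xd' Dd'; rewrite mulfK.
exists p1, r1; split.
  have : ev (r * r) (pt4 z X z Y) != 0 by rewrite evM mulf_neq0.
  by apply: contraNneq => r1x; rewrite hr // r0x r1x mulr0 addr0.
move=> x' d'; rewrite -[x']hsubmxK => xd' Dd' r1x'.
by have [_ <-] := main2 _ _ _ xd' Dd'; rewrite mulfK.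
Qed.

End Maps.

(** The equation z ^ 2 = - h is one between polynomials in separate variables, as
    in [nonzero_locus_dense]. *)
Lemma double_cover_dense k (h : mpoly k C) (p : mpoly (1 + k) C) z X :
  (exists X, ev h X != 0) -> z ^+ 2 = - ev h X -> ev p (dbl_pt z X) != 0 ->
  exists z' X', [/\ z' ^+ 2 = - ev h X', z' != 0 & ev p (dbl_pt z' X') != 0].
Proof.
move=> [X1 hX1] zh pz.
pose sq : mpoly 1 C := mpolyX C (mnm1 0) ^+ 2; pose G := mpolyC 1 (-1) * sq.
have GE' y : ev G y = - y 0 0 ^+ 2 by rewrite evM evC evXn evV mulN1r.
have G1 : ev G (const_mx 1) != 0 by rewrite GE' mxE expr1n oppr_eq0 oner_eq0.
have [|z' [X' [e z'0 pz']]] := nonzero_locus_dense (x := const_mx z) (y := X) (b := p) G1 hX1 _ pz.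
  by rewrite GE' mxE zh opprK.
exists (z' 0 0), X'; have ez : z' = const_mx (z' 0 0) by apply/rowP => i; rewrite mxE ord1.
split; first by rewrite -e GE' opprK.
  by apply: contraNneq z'0 => z0; rewrite GE' z0 expr0n oppr0.
by rewrite /dbl_pt -ez.
Qed.

Lemma Dset_dense : dense_in Dset.
Proof.
move=> N oN [c Nc]; case: cQ => sur _ oQ _; have [x] := sur c.
have [z1 [X [z2 [Y ->]]]] := pt4E x => xc.
have [p [px hp]] := (oQ N).1 oN _ _ xc Nc.
have [z1f z2g] := rep4_eqs ((quot_repE _ _ _ _ _).1 xc).
have [p1 hp1] := poly_slice_l p (dbl_pt z2 Y).
have [|z1' [X' [z1f' z1'0 p1x]]] := double_cover_dense (p := p1) f_neq0 z1f.
  by rewrite hp1.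
rewrite hp1 in p1x; have [p2 hp2] := poly_slice_r p (dbl_pt z1' X').
have [|z2' [Y' [z2g' z2'0 p2x]]] := double_cover_dense (p := p2) g_neq0 z2g.
  by rewrite hp2.
rewrite hp2 in p2x.
have [c' xc'] := rep4_ex (dbl_pt_neq0 X' z1'0) (dbl_pt_neq0 Y' z2'0) z1f' z2g'.
exists c'; split; last by apply/(Dset_rep xc').
by apply: hp p2x; apply/quot_repE.
Qed.

Lemma DXset_dense : dense_in DXset.
Proof.
move=> N oN [d Nd]; case: cX => sur _ oXG _; have [x] := sur d.
rewrite -[x]hsubmxK; move: (lsubmx x) (rsubmx x) => X Y xd.
have [p [px hp]] := (oXG N).1 oN _ _ xd Nd.
case: f_neq0 g_neq0 => X1 fX1 [Y1 gY1].
have [X' [Y' [e fX' px']]] := nonzero_locus_dense fX1 gY1 (repX_eqs xd) px.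
have [d' xd'] := repX_ex e fX'.
by exists d'; split; [exact: hp px'|apply/(DXset_rep xd')].
Qed.

Lemma birational_of_involutions (S' Z : fspace C) (pi : S' -> S0) (sS : S' -> S')
    (rho : Z -> quot (@pair_orbit C E S' sE sS)) :
  involutive sS -> (forall x, pi (sS x) = s0 (pi x)) ->
  birational_morphism pi -> birational_morphism rho -> is_variety Z ->
  birational Z XG.
Proof.
move=> sSK pis bpi brho [Z_space _ _ Z_irr].
have [z0 _] := Z_irr.1.
pose x0 : E * S' := pick_pt (rho z0).
have Q_space := coordinates_space cQ; have X_space := coordinates_space cX.
have [[oQT _ _] _ _] := Q_space; have [[oXT _ _] _ _] := X_space.
have [|c0 [_ [d0 cd0]]] := Dset_dense oQT; first by exists (q0 (x0.1, pi x0.2)).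
have lphi := locmorph_phi d0; have lpsi := locmorph_psi c0.
have oD : opn Dset by have := lphi.1 _ oXT; rewrite preimage_setT setIT.
have oDX : opn DXset by have := lpsi.1 _ oQT; rewrite preimage_setT setIT.
apply: (birational_assembly cE cS cES sEK s0K sSK s0_open bpi brho pis Z_space Z_irr
  X_space oD Dset_dense oDX DXset_dense lphi lpsi).
- by move=> c [d cd]; rewrite (phi_mapE _ cd); exists c.
- by move=> d [c cd]; rewrite (psi_mapE _ cd); exists d.
- by move=> c [d cd]; rewrite (phi_mapE _ cd) (psi_mapE _ cd).
- by move=> d [c cd]; rewrite (psi_mapE _ cd) (phi_mapE _ cd).
Qed.

End Involutions.

(** HE, HS and HX are the unions of the classes in GE, GS and GX. The hypotheses
    on them say that, up to scalings, HX consists of the pairs of an element of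
    HE and an element of HS with first entry one. *)
Theorem borcea_voisin_birational (Z : fspace C) :
  is_Z_quotients wE WE GE wS WS GS Z -> birational Z XG.
Proof.
move=> [sE [s0 [S' [pi [sS [sEi s0i [[_ _ _ bpi] _] [[_ sSK] pis] [rho [[vZ _ _ brho] _]]]]]]]].
have [a a' ab_a _] := egcdnP u0 v0_gt0; have [b b' ab_b _] := egcdnP v0 u0_gt0.
rewrite gcdnC (eqP cop) in ab_a; rewrite (eqP cop) in ab_b.
exact: (birational_of_involutions sEi s0i ab_a ab_b sSK pis bpi brho vZ).
Qed.

End Core.

(** * Roots of unity *)

Section RootsOfUnity.
Variable R : realType.
Local Notation C := R[i].

Lemma expi0 : expi R 0 = 1.
Proof. by rewrite /expi rmorph0 mulr0 cos0 sin0. Qed.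

Lemma expiD p q : expi R (p + q) = expi R p * expi R q.
Proof.
rewrite /expi rmorphD mulrDr cosD sinD; apply/eqP; rewrite eq_complex /=.
by rewrite eqxx /= addrC.
Qed.

Lemma expi_neq0 q : expi R q != 0.
Proof.
apply/eqP => e; have := expi0; rewrite -(subrr q) expiD e mul0r => /esym/eqP.
by rewrite oner_eq0.
Qed.

Lemma expiN q : expi R (- q) = (expi R q)^-1.
Proof.
by apply: (mulfI (expi_neq0 q)); rewrite -expiD subrr expi0 mulfV ?expi_neq0.
Qed.

Lemma expiMn q k : expi R (q *+ k) = expi R q ^+ k.
Proof.
by elim: k => [|k IH]; rewrite ?mulr0n ?expi0 // mulrS expiD IH exprS.
Qed.

Lemma expiMz q (k : int) : expi R (k%:~R * q) = expi R q ^ k.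
Proof.
rewrite mulrzl; case: k => k; first by rewrite -pmulrn expiMn.
by rewrite NegzE mulrNz expiN -pmulrn expiMn.
Qed.

Lemma expi1 : expi R 1 = 1.
Proof.
rewrite /expi rmorph1 mulr1 mulrC mulr_natr cos_mulr2n sin_mulr2n cospi sinpi.
by rewrite mulr0 mul0rn sqrrN expr1n mulr2n addrK.
Qed.

Lemma expi_sum (I : finType) (F : I -> rat) : expi R (\sum_i F i) = \prod_i expi R (F i).
Proof. by apply: (big_morph _ expiD expi0). Qed.

Lemma int_subr1 (q : rat) : exists z : int, 0 <= q - z%:~R < 1.
Proof.
exists (Num.floor q); have /andP[h1 h2] := floor_itv q.
by rewrite subr_ge0 h1 ltrBlDl (lt_le_trans h2) // intrD.
Qed.

Lemma expi_eq1 q : expi R q = 1 <-> q \is a Num.int.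
Proof.
split=> [e|/intrP[z ->]]; last by rewrite -[_%:~R]mulr1 expiMz expi1 exp1rz.
have [z /andP[r0 r1]] := int_subr1 q.
pose r := q - z%:~R; have er : expi R r = 1.
  by rewrite expiD e mul1r expiN -[_%:~R]mulr1 expiMz expi1 exp1rz invr1.
(* The fractional part r satisfies cos (2 pi r) = 1 - 2 sin (pi r) ^ 2 = 1. *)
suff : r = 0 by move/eqP; rewrite subr_eq0 => /eqP ->; apply/intrP; exists z.
apply: contrapT => /eqP rn0; have rp : 0 < r by rewrite lt_def rn0.
have : 0 < sin (pi * ratr r : R).
  apply: sin_gt0_pi; rewrite mulr_gt0 ?pi_gt0 ?ltr0q //=.
  by rewrite -[X in _ < X]mulr1 ltr_pM2l ?pi_gt0 // -(rmorph1 (ratr : rat -> R)) ltr_rat.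
move: er; rewrite /expi -mulrA mulrC mulr_natr => /eqP; rewrite eq_complex /= => /andP[/eqP c1 _].
move: c1; rewrite cos_mulr2n cos2sin2; set s := sin _ => c1 spos.
have : 2%:R * s ^+ 2 = 0.
  have -> : 2%:R * s ^+ 2 = 1 - ((1 - s ^+ 2) *+ 2 - 1) by ring.
  by rewrite c1 subrr.
by move/eqP; rewrite mulf_eq0 pnatr_eq0 expf_eq0 /= => /eqP s0; rewrite s0 ltxx in spos.
Qed.

Lemma expi_eq p q : expi R p = expi R q <-> p - q \is a Num.int.
Proof.
rewrite -expi_eq1 expiD expiN; split=> [->|e]; first by rewrite mulfV ?expi_neq0.
by apply: (mulIf (invr_neq0 (expi_neq0 q))); rewrite e mulfV ?expi_neq0.
Qed.

(** The number e(1/N) is a primitive N-th root of unity. *)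
Lemma root_of_unity_expi (N : nat) (z : C) : (0 < N)%N -> z ^+ N = 1 ->
  exists q, z = expi R q.
Proof.
move=> N0 zN; have Nq : N%:R != 0 :> rat by rewrite pnatr_eq0 -lt0n.
have prim : N.-primitive_root (expi R (N%:R^-1)).
  rewrite /primitive_root_of_unity N0 /=; apply/forallP => i; apply/eqP.
  rewrite unity_rootE -expiMn; apply/eqP/eqP => [/expi_eq1/intrP[k e]|->].
    have {}e : i.+1%:R / N%:R = k%:~R :> rat by rewrite mulr_natl.
    have Np : 0 < N%:R :> rat by rewrite ltr0n.
    have k1 : k = 1.
      apply/eqP; rewrite eq_le -gtz0_ge1 -(lerz1 rat) -(ltr0z rat) -e.
      by rewrite ler_pdivrMr // mul1r ler_nat ltn_ord divr_gt0 ?ltr0n.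
    move: e; rewrite k1 => /(canRL (divfK Nq)); rewrite mul1r => /eqP.
    by rewrite eqr_nat => /eqP.
  have -> : N%:R^-1 *+ N = 1 :> rat by rewrite -[LHS]mulr_natl mulfV.
  exact: expi1.
have [i ->] := prim_rootP prim zN.
by exists (N%:R^-1 *+ i); rewrite expiMn.
Qed.

Lemma diag_expE n (v : 'cV[rat]_n) i : diag_exp R v 0 i = expi R (v i 0).
Proof. by rewrite mxE. Qed.

Lemma diag_expD n (v w : 'cV[rat]_n) :
  diag_exp R (v + w) = dmul (diag_exp R v) (diag_exp R w).
Proof. by apply/rowP => i; rewrite !mxE expiD. Qed.

Lemma diag_exp0 n : diag_exp R (0 : 'cV[rat]_n) = const_mx 1.
Proof. by apply/rowP => i; rewrite !mxE expi0. Qed.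

Definition int_col n (v : 'cV[rat]_n) : Prop := forall i, v i 0 \is a Num.int.

Lemma diag_exp_eq n (v w : 'cV[rat]_n) : diag_exp R v = diag_exp R w <-> int_col (v - w).
Proof.
split=> [/rowP e i|e].
  by have := e i; rewrite !mxE => /expi_eq.
by apply/rowP => i; rewrite !mxE; apply/expi_eq; have := e i; rewrite !mxE.
Qed.

Lemma diag_exp_col_mx m n (v : 'cV[rat]_m) (w : 'cV[rat]_n) :
  diag_exp R (col_mx v w) = row_mx (diag_exp R v) (diag_exp R w).
Proof. by apply/rowP => i; rewrite !mxE; case: splitP => j _; rewrite !mxE. Qed.

End RootsOfUnity.

(** * Symmetries of Delsarte polynomials *)

Section Symmetries.
Variable R : realType.
Local Notation C := R[i].

(** The symmetries of a Delsarte polynomial with invertible exponent matrix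
    fix each of its monomials, so that they do not depend on the coefficients. *)
Definition monAut n (A : 'M[nat]_n) : set 'rV[C]_n :=
  [set a | (forall i, a 0 i != 0) /\ forall i, \prod_j a 0 j ^+ A i j = 1].

Definition monSL n (A : 'M[nat]_n) : set 'rV[C]_n :=
  [set a | monAut A a /\ \prod_i a 0 i = 1].

Definition row_mnm n (A : 'M[nat]_n) (i : 'I_n) : multinom n :=
  Multinom [tuple A i j | j < n].

Lemma mon_row n (A : 'M[nat]_n) i (x : 'rV[C]_n) :
  mon (row_mnm A i) x = \prod_j x 0 j ^+ A i j.
Proof. by apply: eq_bigr => j _; rewrite mnmE. Qed.

Lemma ev_delsarte n (c : 'rV[C]_n) (A : 'M[nat]_n) x :
  ev (delsarte c A) x = \sum_i c 0 i * \prod_j x 0 j ^+ A i j.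
Proof.
rewrite ev_sum; apply: eq_bigr => i _; rewrite evZ; congr (_ * _).
rewrite /ev rmorph_prod; apply: eq_bigr => j _; rewrite rmorphXn.
by congr (_ ^+ _); exact: evV.
Qed.

Lemma unit_rows_inj n (A : 'M[nat]_n) i k : mxQ A \in unitmx ->
  (forall j, A i j = A k j) -> i = k.
Proof.
move=> uA e; have : delta_mx 0 i *m mxQ A = delta_mx 0 k *m mxQ A :> 'rV_n.
  by rewrite -!rowE; apply/rowP => j; rewrite !mxE e.
move/(congr1 (mulmx^~ (invmx (mxQ A)))); rewrite /= !mulmxK // => /rowP/(_ i).
rewrite !mxE !eqxx /=; by case: (i =P k).
Qed.

Lemma torus_monoid n : diag_monoid [set t : 'rV[C]_n | forall i, t 0 i != 0].
Proof.
split=> //= [i|s t hs ht i]; first by rewrite mxE oner_eq0.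
by rewrite dmulE mulf_neq0.
Qed.

Lemma torus_char_inj n (m m' : multinom n) :
  same_char [set t : 'rV[C]_n | forall i, t 0 i != 0] m m' -> forall i, m i = m' i.
Proof.
move=> h i; pose t : 'rV[C]_n := \row_j (if j == i then 2%:R else 1).
have mt (mm : multinom n) : mon mm t = 2%:R ^+ mm i.
  rewrite /mon (bigD1 i) //= mxE eqxx big1 ?mulr1 // => j /negPf ji.
  by rewrite mxE ji expr1n.
have t0 j : t 0 j != 0 by rewrite mxE; case: ifP; rewrite ?oner_eq0 ?pnatr_eq0.
have := h t t0; rewrite !mt; apply: ieexprIn; first by rewrite ltr0n.
by rewrite -subr_eq0 -[1]/(1%:R) -natrB // pnatr_eq0.
Qed.

(** The monomials of a Delsarte polynomial are distinct because its exponent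
    matrix is invertible, hence linearly independent on the torus. *)
Lemma delsarte_coef0 n (A : 'M[nat]_n) (d : 'I_n -> C) : mxQ A \in unitmx ->
  (forall x : 'rV[C]_n, \sum_i d i * \prod_j x 0 j ^+ A i j = 0) -> forall i, d i = 0.
Proof.
move=> uA h i.
have := @char_independence C n _ _ (row_mnm A) d (row_mnm A i) (torus_monoid n).
rewrite (bigD1 i) /=; last by apply/asboolP.
rewrite big1 ?addr0 => [|k /andP[/asboolP/torus_char_inj e /eqP ki]].
  by apply=> t _; rewrite -[RHS](h t); apply: eq_bigr => k _; rewrite mon_row.
by case: ki; apply: (unit_rows_inj uA) => j; have := e j; rewrite !mnmE.
Qed.

Lemma delsarte_neq0 n (c : 'rV[C]_n) (A : 'M[nat]_n) : (0 < n)%N ->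
  mxQ A \in unitmx -> (forall i, c 0 i != 0) -> exists x, ev (delsarte c A) x != 0.
Proof.
move=> n0 uA c0; apply: contrapT => none.
have := c0 (Ordinal n0); rewrite (@delsarte_coef0 n A (c 0)) ?eqxx // => x.
by rewrite -ev_delsarte; apply: contrapT => /eqP h; apply: none; exists x.
Qed.

Lemma prod_dmul_row n (A : 'M[nat]_n) i (a x : 'rV[C]_n) :
  \prod_j dmul a x 0 j ^+ A i j = \prod_j a 0 j ^+ A i j * \prod_j x 0 j ^+ A i j.
Proof. by rewrite -!mon_row mon_dmul. Qed.

Lemma SL_monSL n (c : 'rV[C]_n) (A : 'M[nat]_n) a : mxQ A \in unitmx ->
  (forall i, c 0 i != 0) -> SL (delsarte c A) a <-> monSL A a.
Proof.
move=> uA c0; split=> -[[a0 h] det]; split=> //; split=> //.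
  move=> i; have := @delsarte_coef0 n A (fun i => c 0 i * (\prod_j a 0 j ^+ A i j - 1)) uA.
  move=> /(_ _ i) e; apply/eqP; rewrite -subr_eq0; apply/eqP.
  apply: (mulfI (c0 i)); rewrite mulr0; apply: e => x.
  have /eqP := h x; rewrite -subr_eq0 !ev_delsarte -sumrB => /eqP e.
  rewrite -[RHS]e; apply: eq_bigr => k _; rewrite prod_dmul_row; ring.
move=> x; rewrite !ev_delsarte; apply: eq_bigr => k _.
by rewrite prod_dmul_row h mul1r.
Qed.

Lemma monSL_ev n (c : 'rV[C]_n) (A : 'M[nat]_n) a x : monSL A a ->
  ev (delsarte c A) (dmul a x) = ev (delsarte c A) x.
Proof.
move=> [[_ h] _]; rewrite !ev_delsarte; apply: eq_bigr => i _.
by rewrite prod_dmul_row h mul1r.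
Qed.

Lemma monSL_group n (A : 'M[nat]_n) : diag_group (monSL A).
Proof.
split; first split.
- split; last by rewrite big1 // => i _; rewrite mxE.
  split=> i; first by rewrite mxE oner_eq0.
  by rewrite big1 // => j _; rewrite mxE expr1n.
- move=> s t [[s0 sA] sd] [[t0 tA] td]; split; first split=> i.
  + by rewrite dmulE mulf_neq0.
  + by rewrite prod_dmul_row sA tA mulr1.
  + rewrite (eq_bigr (fun i => s 0 i * t 0 i)) => [|i _]; last by rewrite dmulE.
    by rewrite big_split /= sd td mulr1.
- by move=> t [[t0 _] _].
- move=> t [[t0 tA] td]; exists (map_mx GRing.inv t).
    split; first split=> i.
    + by rewrite mxE invr_eq0.
    + rewrite (eq_bigr (fun j => (t 0 j ^+ A i j)^-1)) => [|j _]; last by rewrite mxE exprVn.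
      by rewrite -[LHS]mulr1 -[X in _ * X](tA i) -big_split /= big1 // => j _; rewrite mulVf ?expf_neq0.
    + rewrite (eq_bigr (fun j => (t 0 j)^-1)) => [|j _]; last by rewrite mxE.
      by rewrite -[LHS]mulr1 -[X in _ * X]td -big_split /= big1 // => j _; rewrite mulVf.
  by apply/rowP => i; rewrite !mxE mulVf.
Qed.

Lemma prod_diag_exp n (v : 'cV[rat]_n) : \prod_i diag_exp R v 0 i = expi R (\sum_i v i 0).
Proof. by rewrite expi_sum; apply: eq_bigr => i _; rewrite diag_expE. Qed.

Lemma monAut_diag_exp n (A : 'M[nat]_n) (v : 'cV[rat]_n) :
  monAut A (diag_exp R v) <-> int_col (mxQ A *m v).
Proof.
have e i : \prod_j diag_exp R v 0 j ^+ A i j = expi R ((mxQ A *m v) i 0).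
  rewrite mxE expi_sum; apply: eq_bigr => j _.
  by rewrite diag_expE -expiMn !mxE mulr_natl.
split=> [[_ h] i|h]; first by apply/(expi_eq1 R); rewrite -e h.
split=> i; first by rewrite diag_expE expi_neq0.
by rewrite e; apply/expi_eq1.
Qed.

Lemma monSL_diag_exp n (A : 'M[nat]_n) (v : 'cV[rat]_n) :
  monSL A (diag_exp R v) <-> int_col (mxQ A *m v) /\ \sum_i v i 0 \is a Num.int.
Proof.
split=> [[/monAut_diag_exp h]|[/monAut_diag_exp h h']].
  by rewrite prod_diag_exp => /expi_eq1.
by split=> //; rewrite prod_diag_exp; apply/expi_eq1.
Qed.

(** The adjugate shows that the entries of a symmetry are roots of unity of
    order dividing det A. *)
Lemma monAut_lift n (A : 'M[nat]_n) a : mxQ A \in unitmx -> monAut A a ->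
  exists v, a = diag_exp R v.
Proof.
move=> uA [a0 aA]; pose Z : 'M[int]_n := map_mx Posz A.
have detE : \det (mxQ A) = (\det Z)%:~R.
  rewrite -det_map_mx; congr (\det _); apply/matrixP => i j; rewrite !mxE.
  by rewrite pmulrn.
have d0 : \det Z != 0.
  by move: uA; rewrite unitmxE unitfE detE intr_eq0.
have aj j : a 0 j ^ (\det Z) = 1.
  have e k : (\det Z) *+ (j == k) = \sum_i (\adj Z j i * A i k).
    have := congr1 (fun M : 'M[int]_n => M j k) (mul_adj_mx Z).
    rewrite [X in X = _]mxE [X in _ = X]mxE => <-.
    by apply: eq_bigr => i _; rewrite [Z i k]mxE.
  transitivity (\prod_k a 0 k ^ ((\det Z) *+ (j == k))).
    rewrite (bigD1 j) //= eqxx mulr1n big1 ?mulr1 // => k /negPf.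
    by rewrite eq_sym => ->.
  under eq_bigr => k _ do rewrite e.
  transitivity (\prod_k \prod_i (a 0 k ^ (\adj Z j i * A i k))).
    apply: eq_bigr => k _; apply: (big_morph (fun z : int => a 0 k ^ z)) => //.
    by move=> x y; rewrite expfzDr.
  rewrite exchange_big /= big1 // => i _.
  transitivity ((\prod_k a 0 k ^+ A i k) ^ (\adj Z j i)); last by rewrite aA exp1rz.
  rewrite (big_morph (fun z : C => z ^ \adj Z j i) (id1 := 1) (op1 := *%R)) ?exp1rz //.
    by apply: eq_bigr => k _; rewrite mulrC -exprz_exp exprnP.
  by move=> x y; rewrite expfzMl.
have N0 : (0 < `|\det Z|)%N by rewrite absz_gt0.
have ajN j : a 0 j ^+ `|\det Z|%N = 1.
  have := aj j; case: (\det Z) => // k /=.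
  by rewrite NegzE -exprnN => /eqP; rewrite invr_eq1 => /eqP.
have [v hv] := choice (fun j => root_of_unity_expi N0 (ajN j)).
by exists (\col_j v j); apply/rowP => j; rewrite diag_expE mxE hv.
Qed.

End Symmetries.

(** * Classes modulo J and transposed groups *)

Section Cosets.
Variable R : realType.
Local Notation C := R[i].

Lemma scale_colE n (k : rat) (v : 'cV[rat]_n) i : (k *: v) i 0 = k * v i 0.
Proof. by rewrite mxE. Qed.

Lemma diag_exp_eqD n (v w : 'cV[rat]_n) : diag_exp R v = diag_exp R w ->
  exists2 z, int_col z & v = z + w.
Proof. by move=> /diag_exp_eq h; exists (v - w); rewrite // subrK. Qed.

Lemma J_diag_exp n (A : 'M[nat]_n) (a : 'rV[C]_n) :
  J A a <-> exists k : int, a = diag_exp R (k%:~R *: charges A).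
Proof.
split=> -[k h]; exists k; first by apply/rowP => i; rewrite h !diag_expE scale_colE expiMz.
by move=> i; rewrite h !diag_expE scale_colE expiMz.
Qed.

Lemma J_group n (A : 'M[nat]_n) : diag_group (@J R n A).
Proof.
split; first split.
- by apply/J_diag_exp; exists 0; rewrite scale0r diag_exp0.
- move=> _ _ /J_diag_exp[k ->] /J_diag_exp[l ->]; apply/J_diag_exp.
  by exists (k + l); rewrite intrD scalerDl diag_expD.
- by move=> _ /J_diag_exp[k ->] i; rewrite diag_expE expi_neq0.
- move=> _ /J_diag_exp[k ->]; exists (diag_exp R ((- k)%:~R *: charges A)).
    by apply/J_diag_exp; exists (- k).
  by rewrite -diag_expD -scalerDl -intrD addNr scale0r diag_exp0.
Qed.

Lemma mxQ_charges n (A : 'M[nat]_n) : mxQ A \in unitmx ->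
  mxQ A *m charges A = const_mx 1.
Proof. by move=> uA; rewrite mulmxA mulmxV // mul1mx. Qed.

(** The Calabi-Yau condition. *)
Definition charges_sum1 n (A : 'M[nat]_n) : Prop := \sum_i charges A i 0 = 1.

Lemma charges_sum_tr n (A : 'M[nat]_n) :
  \sum_i charges A^T i 0 = \sum_i charges A i 0.
Proof.
have sumE (v : 'cV[rat]_n) : \sum_i v i 0 = ((const_mx 1 : 'rV_n) *m v) 0 0.
  by rewrite mxE; apply: eq_bigr => i _; rewrite mxE mul1r.
rewrite !sumE /charges -[in RHS](trmxK (_ *m (_ *m _))) [in RHS]mxE !trmx_mul.
rewrite !trmx_const trmx_inv mulmxA; congr ((_ *m invmx _ *m _) _ _).
by apply/matrixP => i j; rewrite !mxE.
Qed.

Lemma J_monSL n (A : 'M[nat]_n) (a : 'rV[C]_n) : mxQ A \in unitmx -> charges_sum1 A ->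
  J A a -> monSL A a.
Proof.
move=> uA cy /J_diag_exp[k ->]; apply/monSL_diag_exp; split.
  by move=> i; rewrite -scalemxAr mxQ_charges // !mxE mulr1 intr_int.
rewrite (eq_bigr (fun i => k%:~R * charges A i 0)) => [|i _]; last by rewrite scale_colE.
by rewrite -mulr_sumr cy mulr1 intr_int.
Qed.

Lemma coset_self n (A : 'M[nat]_n) (a : 'rV[C]_n) : coset A a a.
Proof. by have [[J1 _ _] _] := J_group A; exists (const_mx 1); rewrite // dmulC dmul1. Qed.

Lemma coset_eq n (A : 'M[nat]_n) (a b : 'rV[C]_n) : coset A a b -> coset A b = coset A a.
Proof.
have [[J1 JM J0] JV] := J_group A; move=> [j Jj ->].
apply/seteqP; split=> c [k Jk ->].
  by exists (dmul j k); [exact: JM|rewrite dmulA].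
have [j' Jj' jj'] := JV j Jj; exists (dmul j' k); first exact: JM.
by rewrite !dmulA -(dmulA a j j') [dmul j j']dmulC jj' [dmul a (const_mx 1)]dmulC dmul1.
Qed.

Lemma coset_monSL n (A : 'M[nat]_n) (a b : 'rV[C]_n) : mxQ A \in unitmx ->
  charges_sum1 A -> monSL A a -> coset A a b -> monSL A b.
Proof.
move=> uA cy ha [j Jj ->]; have [[_ SM _] _] := monSL_group R A.
by apply: SM => //; exact: J_monSL.
Qed.

Lemma SLt_coset n (c : 'rV[C]_n) (A : 'M[nat]_n) P : mxQ A \in unitmx ->
  (forall i, c 0 i != 0) -> charges_sum1 A -> SLt c A P ->
  forall a, P a -> monSL A a /\ P = coset A a.
Proof.
move=> uA c0 cy [b /(SL_monSL b uA c0) hb ->] a ab; split; last by rewrite (coset_eq ab).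
exact: coset_monSL hb ab.
Qed.

Section Union.
Variables (n : nat) (c : 'rV[C]_n) (A : 'M[nat]_n) (G : set (set 'rV[C]_n)).
Hypotheses (uA : mxQ A \in unitmx) (c0 : forall i, c 0 i != 0) (cy : charges_sum1 A).

Definition union_set : set 'rV[C]_n := [set a | exists2 P, G P & P a].

Lemma union_coset a : G `<=` SLt c A -> union_set a <-> G (coset A a).
Proof.
move=> GS; split=> [[P GP Pa]|h]; last by exists (coset A a) => //; exact: coset_self.
by have [_ <-] := SLt_coset uA c0 cy (GS _ GP) Pa.
Qed.

Lemma union_monSL a : G `<=` SLt c A -> union_set a -> monSL A a.
Proof. by move=> GS [P GP Pa]; have [] := SLt_coset uA c0 cy (GS _ GP) Pa. Qed.

Lemma union_group : SLt_subgroup c A G -> diag_group union_set.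
Proof.
move=> [GS G1 GM GV]; have H := union_coset _ GS.
split; first split.
- by apply/H.
- by move=> s t /H hs /H ht; apply/H; exact: GM.
- by move=> t /(union_monSL GS) [[]].
- move=> t ht; have [[t0 _] _] := union_monSL GS ht; exists (map_mx GRing.inv t).
    by apply/H; apply: GV; apply/H.
  by apply/rowP => i; rewrite !mxE mulVf.
Qed.

Lemma union_J a j : G `<=` SLt c A -> union_set a -> J A j -> union_set (dmul a j).
Proof.
move=> GS [P GP Pa] Jj; exists P => //.
have [_ ->] := SLt_coset uA c0 cy (GS _ GP) Pa; by exists j.
Qed.

End Union.

(** The bilinear form of the duality on logarithms, before reduction modulo the
    integers. *)
Definition pairing n (A : 'M[nat]_n) (v w : 'cV[rat]_n) : rat :=
  (v^T *m mxQ A *m w) 0 0.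

Lemma pairingDl n (A : 'M[nat]_n) v v' w :
  pairing A (v + v') w = pairing A v w + pairing A v' w.
Proof. by rewrite /pairing linearD /= !mulmxDl mxE. Qed.

Lemma pairingDr n (A : 'M[nat]_n) v w w' :
  pairing A v (w + w') = pairing A v w + pairing A v w'.
Proof. by rewrite /pairing mulmxDr mxE. Qed.

Lemma pairingZl n (A : 'M[nat]_n) k v w : pairing A (k *: v) w = k * pairing A v w.
Proof. by rewrite /pairing linearZ /= -!scalemxAl mxE. Qed.

Lemma pairingZr n (A : 'M[nat]_n) k v w : pairing A v (k *: w) = k * pairing A v w.
Proof. by rewrite /pairing -scalemxAr mxE. Qed.

Lemma pairing_tr n (A : 'M[nat]_n) v w : pairing A v w = pairing A^T w v.
Proof.
rewrite /pairing -[in LHS](trmxK (_ *m _)) mxE !trmx_mul trmxK mulmxA.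
by congr ((_ *m _ *m _) _ _); apply/matrixP => i j; rewrite !mxE.
Qed.

Lemma pairing_int_l n (A : 'M[nat]_n) v w : int_col v -> int_col (mxQ A *m w) ->
  pairing A v w \is a Num.int.
Proof.
move=> iv iw; rewrite /pairing -mulmxA mxE; apply: rpred_sum => i _.
by apply: rpredM; rewrite ?mxE; [exact: iv|have := iw i; rewrite mxE].
Qed.

Lemma pairing_int_r n (A : 'M[nat]_n) v w : int_col (mxQ A^T *m v) -> int_col w ->
  pairing A v w \is a Num.int.
Proof. by move=> iv iw; rewrite pairing_tr; apply: pairing_int_l. Qed.

Lemma pairing_charges_r n (A : 'M[nat]_n) v : mxQ A \in unitmx ->
  pairing A v (charges A) = \sum_i v i 0.
Proof.
move=> uA; rewrite /pairing -mulmxA mxQ_charges // mxE.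
by apply: eq_bigr => i _; rewrite !mxE mulr1.
Qed.

Lemma unit_tr n (A : 'M[nat]_n) : mxQ A \in unitmx -> mxQ A^T \in unitmx.
Proof.
by rewrite -unitmx_tr; congr (_ \in unitmx); apply/matrixP => i j; rewrite !mxE.
Qed.

Lemma pairing_charges_l n (A : 'M[nat]_n) w : mxQ A \in unitmx ->
  pairing A (charges A^T) w = \sum_i w i 0.
Proof.
move=> uA; have -> : pairing A (charges A^T) w = pairing A^T w (charges A^T).
  by rewrite pairing_tr.
by rewrite pairing_charges_r // unit_tr.
Qed.

(** The pairing in Q/Z does not depend on the representatives: they differ by
    integral vectors and by multiples of the charges, whose pairing with the
    logarithm of an element of determinant one is integral. *)
Lemma pairing_coset n (A : 'M[nat]_n) v v' w w' : mxQ A \in unitmx -> charges_sum1 A ->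
  monSL A^T (diag_exp R v) -> monSL A (diag_exp R w) ->
  coset A^T (diag_exp R v) (diag_exp R v') -> coset A (diag_exp R w) (diag_exp R w') ->
  pairing A v w \is a Num.int -> pairing A v' w' \is a Num.int.
Proof.
move=> uA cy hv hw cv cw i0.
have uT := unit_tr uA; have cyT : charges_sum1 A^T by rewrite /charges_sum1 charges_sum_tr.
have hv' := coset_monSL uT cyT hv cv; have hw' := coset_monSL uA cy hw cw.
have step1 : pairing A v' w \is a Num.int.
  case: cv => j /J_diag_exp[k ->]; rewrite -diag_expD => /diag_exp_eqD[z iz ->].
  rewrite !pairingDl pairingZl pairing_charges_l //.
  have [iw sw] := (monSL_diag_exp _ _ _).1 hw.
  apply: rpredD; first exact: pairing_int_l.
  by apply: rpredD => //; apply: rpredM => //; exact: intr_int.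
case: cw => j /J_diag_exp[k ->]; rewrite -diag_expD => /diag_exp_eqD[z iz ->].
rewrite !pairingDr pairingZr pairing_charges_r //.
have [iv sv] := (monSL_diag_exp _ _ _).1 hv'.
apply: rpredD; first exact: pairing_int_r.
by apply: rpredD => //; apply: rpredM => //; exact: intr_int.
Qed.

(** The union of the classes in the transposed group, see [union_transposed],
    when H is the union of the classes in a group. Quantifying over all
    logarithms amounts to choosing some, by [pairing_coset]. *)
Definition perp n (A : 'M[nat]_n) (H : set 'rV[C]_n) : set 'rV[C]_n :=
  [set a | monSL A^T a /\ forall v w, a = diag_exp R v -> H (diag_exp R w) ->
     pairing A v w \is a Num.int].

Lemma perp_group n (A : 'M[nat]_n) H : mxQ A \in unitmx -> H `<=` monSL A ->
  diag_group (perp A H).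
Proof.
move=> uA HS; have [[S1 SM S0] SV] := monSL_group R A^T.
have Hint w : H (diag_exp R w) -> int_col (mxQ A *m w).
  by move/HS/monSL_diag_exp => -[].
split; first split.
- split=> // v w; rewrite -diag_exp0 => /esym/diag_exp_eq; rewrite subr0 => iv Hw.
  by apply: pairing_int_l => //; exact: Hint.
- move=> s t [Ss hs] [St ht]; split=> [|v w e Hw]; first exact: SM.
  have [v1 e1] := monAut_lift (unit_tr uA) Ss.1; have [v2 e2] := monAut_lift (unit_tr uA) St.1.
  move: e; rewrite e1 e2 -diag_expD => /esym/diag_exp_eqD[z iz ->].
  rewrite !pairingDl.
  apply: rpredD; first by apply: pairing_int_l => //; exact: Hint.
  by apply: rpredD; [exact: hs|exact: ht].
- by move=> t [[[]]].
- move=> t [St ht]; have [s Ss st] := SV t St; exists s => //.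
  split=> // v w e Hw; have [v1 e1] := monAut_lift (unit_tr uA) St.1.
  move: st; rewrite e e1 -diag_expD -diag_exp0 => /diag_exp_eq; rewrite subr0 => iz.
  have -> : v = (v + v1) + (-1) *: v1 by rewrite scaleN1r addrK.
  move: (v + v1) iz => z iz; rewrite pairingDl pairingZl mulN1r.
  apply: rpredB; last exact: ht.
  by apply: pairing_int_l => //; exact: Hint.
Qed.

Lemma perp_J n (A : 'M[nat]_n) H a j : mxQ A \in unitmx -> charges_sum1 A ->
  H `<=` monSL A -> perp A H a -> J A^T j -> perp A H (dmul a j).
Proof.
move=> uA cy HS [Sa ha] Jj; have uT := unit_tr uA.
have cyT : charges_sum1 A^T by rewrite /charges_sum1 charges_sum_tr.
have ca : coset A^T a (dmul a j) by exists j.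
split=> [|v w e Hw]; first exact: coset_monSL Sa ca.
have [v1 e1] := monAut_lift uT Sa.1; subst a.
apply: (pairing_coset (v := v1) (w := w) uA cy Sa (HS _ Hw)).
- by rewrite -e.
- exact: coset_self.
- exact: ha.
Qed.

Lemma union_transposed n (c cT : 'rV[C]_n) (A : 'M[nat]_n) (G : set (set 'rV[C]_n)) a :
  mxQ A \in unitmx -> charges_sum1 A ->
  (forall i, c 0 i != 0) -> (forall i, cT 0 i != 0) -> G `<=` SLt c A ->
  union_set (transposed cT A G) a <-> perp A (union_set G) a.
Proof.
move=> uA cy c0 cT0 GS; have uT := unit_tr uA.
have cyT : charges_sum1 A^T by rewrite /charges_sum1 charges_sum_tr.
split=> [[P [SP hP] Pa]|[Sa ha]].
  have [Sa Pc] := SLt_coset uT cT0 cyT SP Pa; split=> // v w e [Q GQ Qw].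
  have [v' [w' [Pv' Qw' iz]]] := hP Q GQ.
  have [Sv' Pc'] := SLt_coset uT cT0 cyT SP Pv'.
  have [Sw' Qc'] := SLt_coset uA c0 cy (GS _ GQ) Qw'.
  by apply: (pairing_coset uA cy Sv' Sw') iz; rewrite -?Pc' -?Qc' // -e.
exists (coset A^T a); last exact: coset_self; split.
  by exists a => //; apply/SL_monSL.
move=> Q GQ; have [b Sb Qb] := GS _ GQ.
have Qb' : Q b by rewrite Qb; exact: coset_self.
have [Sb' _] := SLt_coset uA c0 cy (GS _ GQ) Qb'.
have [v e1] := monAut_lift uT Sa.1; have [w e2] := monAut_lift uA Sb'.1.
exists v, w; split; first by rewrite -e1; exact: coset_self.
  by rewrite -e2.
by apply: ha => //; exists Q; rewrite // -e2.
Qed.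

End Cosets.

(** * Block exponent matrices *)

Section Blocks.
Variable R : realType.
Local Notation C := R[i].

Lemma exp_doubleE n (B : 'M[nat]_n) : exp_double B = exp_sum (const_mx 2%N : 'M_1) B.
Proof. by []. Qed.

Lemma exp_sum_tr m n (A : 'M[nat]_m) (B : 'M[nat]_n) :
  (exp_sum A B)^T = exp_sum A^T B^T.
Proof. by rewrite /exp_sum tr_block_mx !trmx_const. Qed.

Lemma exp_double_tr n (B : 'M[nat]_n) : (exp_double B)^T = exp_double B^T.
Proof. by rewrite !exp_doubleE exp_sum_tr trmx_const. Qed.

Lemma mxQ_exp_sum m n (A : 'M[nat]_m) (B : 'M[nat]_n) :
  mxQ (exp_sum A B) = block_mx (mxQ A) 0 0 (mxQ B).
Proof.
rewrite /mxQ /exp_sum map_block_mx; congr block_mx;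
by apply/matrixP => i j; rewrite !mxE.
Qed.

Lemma unit_exp_sum m n (A : 'M[nat]_m) (B : 'M[nat]_n) :
  (mxQ (exp_sum A B) \in unitmx) = (mxQ A \in unitmx) && (mxQ B \in unitmx).
Proof.
by rewrite mxQ_exp_sum !unitmxE det_ublock !unitfE mulf_eq0 negb_or.
Qed.

Lemma charges_exp_sum m n (A : 'M[nat]_m) (B : 'M[nat]_n) :
  mxQ A \in unitmx -> mxQ B \in unitmx ->
  charges (exp_sum A B) = col_mx (charges A) (charges B).
Proof.
move=> uA uB; have uS : mxQ (exp_sum A B) \in unitmx by rewrite unit_exp_sum uA.
apply: (can_inj (mulKmx uS)); rewrite mxQ_charges // mxQ_exp_sum.
by rewrite mul_block_col !mul0mx addr0 add0r !mxQ_charges // col_mx_const.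
Qed.

Lemma unit_two : mxQ (const_mx 2%N : 'M_1) \in unitmx.
Proof. by rewrite unitmxE det_mx11 !mxE unitfE pnatr_eq0. Qed.

Lemma charges_two : charges (const_mx 2%N : 'M_1) = const_mx 2%:R^-1.
Proof.
apply: (can_inj (mulKmx unit_two)); rewrite mxQ_charges ?unit_two //.
by apply/colP => i; rewrite !mxE big_ord1 !mxE mulfV // pnatr_eq0.
Qed.

Lemma unit_exp_double n (B : 'M[nat]_n) :
  (mxQ (exp_double B) \in unitmx) = (mxQ B \in unitmx).
Proof. by rewrite exp_doubleE unit_exp_sum unit_two. Qed.

Lemma charges_exp_double n (B : 'M[nat]_n) : mxQ B \in unitmx ->
  charges (exp_double B) = col_mx (const_mx 2%:R^-1) (charges B).
Proof. by move=> uB; rewrite exp_doubleE charges_exp_sum ?unit_two // charges_two. Qed.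

Lemma sum_col_mx m n (v : 'cV[rat]_m) (w : 'cV[rat]_n) :
  \sum_i col_mx v w i 0 = \sum_i v i 0 + \sum_i w i 0.
Proof.
by rewrite big_split_ord; congr (_ + _); apply: eq_bigr => i _; rewrite ?col_mxEu ?col_mxEd.
Qed.

Lemma charges_half n (B : 'M[nat]_n) : mxQ B \in unitmx ->
  charges_sum1 (exp_double B) <-> \sum_i charges B i 0 = 2%:R^-1.
Proof.
move=> uB; rewrite /charges_sum1 charges_exp_double // sum_col_mx big_ord1 mxE.
have two : 2%:R^-1 + 2%:R^-1 = 1 :> rat by [].
by split=> [e|->]; [apply: (addrI 2%:R^-1); rewrite e|].
Qed.

Lemma charges_sum1_exp_sum m n (A : 'M[nat]_m) (B : 'M[nat]_n) :
  mxQ A \in unitmx -> mxQ B \in unitmx ->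
  charges_sum1 (exp_double A) -> charges_sum1 (exp_double B) -> charges_sum1 (exp_sum A B).
Proof.
move=> uA uB /(charges_half uA) hA /(charges_half uB) hB.
by rewrite /charges_sum1 charges_exp_sum // sum_col_mx hA hB.
Qed.

Lemma prod_row_l m n (A : 'M[nat]_m) (B : 'M[nat]_n) (x : 'rV[C]_m) (y : 'rV[C]_n) i :
  \prod_j row_mx x y 0 j ^+ exp_sum A B (lshift n i) j = \prod_j x 0 j ^+ A i j.
Proof.
rewrite big_split_ord /= [X in _ * X]big1 ?mulr1.
  by apply: eq_bigr => j _; rewrite row_mxEl block_mxEul.
by move=> j _; rewrite block_mxEur [X in _ ^+ X]mxE expr0.
Qed.

Lemma prod_row_r m n (A : 'M[nat]_m) (B : 'M[nat]_n) (x : 'rV[C]_m) (y : 'rV[C]_n) i :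
  \prod_j row_mx x y 0 j ^+ exp_sum A B (rshift m i) j = \prod_j y 0 j ^+ B i j.
Proof.
rewrite big_split_ord /= [X in X * _]big1 ?mul1r.
  by apply: eq_bigr => j _; rewrite row_mxEr block_mxEdr.
by move=> j _; rewrite block_mxEdl [X in _ ^+ X]mxE expr0.
Qed.

Lemma ev_exp_sum m n (c : 'rV[C]_m) (c' : 'rV[C]_n) (A : 'M[nat]_m) (B : 'M[nat]_n) X Y :
  ev (delsarte (row_mx c c') (exp_sum A B)) (row_mx X Y) =
  ev (delsarte c A) X + ev (delsarte c' B) Y.
Proof.
rewrite !ev_delsarte big_split_ord /=; congr (_ + _); apply: eq_bigr => i _.
  by rewrite row_mxEl prod_row_l.
by rewrite row_mxEr prod_row_r.
Qed.

Lemma ev_double n (c : 'rV[C]_n) (B : 'M[nat]_n) z X :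
  ev (delsarte (coef_double c) (exp_double B)) (dbl_pt z X) =
  z ^+ 2 + ev (delsarte c B) X.
Proof.
rewrite exp_doubleE /coef_double /dbl_pt ev_exp_sum; congr (_ + _).
by rewrite ev_delsarte big_ord1 big_ord1 !mxE mul1r.
Qed.

Lemma ev_diff m n (c : 'rV[C]_m) (c' : 'rV[C]_n) (A : 'M[nat]_m) (B : 'M[nat]_n) X Y :
  ev (delsarte (coef_diff c c') (exp_sum A B)) (row_mx X Y) =
  ev (delsarte c A) X - ev (delsarte c' B) Y.
Proof.
rewrite /coef_diff ev_exp_sum; congr (_ + _).
by rewrite !ev_delsarte -sumrN; apply: eq_bigr => i _; rewrite mxE mulNr.
Qed.

Lemma coef_double_neq0 n (c : 'rV[C]_n) : (forall i, c 0 i != 0) ->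
  forall i, coef_double c 0 i != 0.
Proof. by move=> h i; rewrite mxE; case: splitP => j _; rewrite ?mxE ?oner_eq0. Qed.

Lemma coef_diff_neq0 m n (c : 'rV[C]_m) (c' : 'rV[C]_n) :
  (forall i, c 0 i != 0) -> (forall i, c' 0 i != 0) -> forall i, coef_diff c c' 0 i != 0.
Proof. by move=> h h' i; rewrite mxE; case: splitP => j _; rewrite ?mxE ?oppr_eq0. Qed.

Lemma monSL_exp_sum m n (A : 'M[nat]_m) (B : 'M[nat]_n) (x : 'rV[C]_m) (y : 'rV[C]_n) :
  monSL A x -> monSL B y -> monSL (exp_sum A B) (row_mx x y).
Proof.
move=> [[x0 xA] xd] [[y0 yB] yd]; split; first split=> i.
- by rewrite mxE; case: splitP.
- by rewrite -(splitK i); case: (split i) => j /=; rewrite ?prod_row_l ?prod_row_r.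
- rewrite big_split_ord /= (eq_bigr (fun i => x 0 i)) => [|i _]; last by rewrite row_mxEl.
  by rewrite xd (eq_bigr (fun i => y 0 i)) ?yd ?mulr1 // => i _; rewrite row_mxEr.
Qed.

Lemma monSL_dbl n (B : 'M[nat]_n) (x : 'rV[C]_n) :
  monSL (exp_double B) (dbl_pt 1 x) <-> monSL B x.
Proof.
split=> [[[x0 xA] xd]|h].
  split; first split=> i.
  - by have := x0 (rshift 1 i); rewrite row_mxEr.
  - by have := xA (rshift 1 i); rewrite exp_doubleE prod_row_r.
  - rewrite -[RHS]xd big_split_ord /= big_ord1 row_mxEl mxE mul1r.
    by apply: eq_bigr => i _; rewrite row_mxEr.
apply: monSL_exp_sum => //; split; last by rewrite big_ord1 mxE.
by split=> i; rewrite ?mxE ?oner_eq0 // big_ord1 !mxE expr1n.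
Qed.

Section Weights.
Variables (n : nat) (B : 'M[nat]_n) (u0 : nat) (u : 'rV[nat]_n).
Hypothesis uB : mxQ B \in unitmx.
Hypothesis hu : weights_sequence (exp_double B) (row_mx (const_mx u0) u).

Lemma weights_double : (0 < u0)%N /\ forall j, (u 0 j)%:R = (2 * u0)%:R * charges B j 0.
Proof.
case: hu => d [d0 hd _]; rewrite charges_exp_double // in hd.
have e : u0%:R = d%:R / 2%:R :> rat.
  by have := hd (lshift n 0); rewrite row_mxEl col_mxEu !mxE.
have ed : d = (2 * u0)%N.
  by apply/eqP; rewrite -(eqr_nat rat) natrM e mulrCA mulfV ?mulr1 // pnatr_eq0.
split=> [|j]; first by rewrite ed in d0; case: (u0) d0.
by have := hd (rshift 1 j); rewrite row_mxEr col_mxEd ed.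
Qed.

Lemma weights_row i : (\sum_j B i j * u ord0 j = 2 * u0)%N.
Proof.
have [_ hj] := weights_double; apply/eqP; rewrite -(eqr_nat rat) natr_sum; apply/eqP.
transitivity ((2 * u0)%:R * (mxQ B *m charges B) i 0); last by rewrite mxQ_charges // mxE mulr1.
by rewrite mxE mulr_sumr; apply: eq_bigr => j _; rewrite natrM hj [mxQ B i j]mxE mulrCA.
Qed.

Lemma weights_homogeneous (c : 'rV[C]_n) t X :
  ev (delsarte c B) (dmul (wscale u t) X) = t ^+ (2 * u0) * ev (delsarte c B) X.
Proof.
rewrite !ev_delsarte mulr_sumr; apply: eq_bigr => i _; rewrite prod_dmul_row mulrCA.
congr (_ * (_ * _)); rewrite -(weights_row i) expr_sum.
by apply: eq_bigr => j _; rewrite mxE -exprM mulnC.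
Qed.

End Weights.

(** The generator of J is the scaling by e(1/N) for the weights N q. *)
Lemma J_scalings n (A : 'M[nat]_n) (w : 'rV[nat]_n) (N : nat) a : (0 < N)%N ->
  (forall i, (w 0 i)%:R = N%:R * charges A i 0) -> J A a -> scalings w (a : 'rV[C]_n).
Proof.
move=> N0 hw /J_diag_exp[k ->]; exists (expi R (k%:~R / N%:R)); first exact: expi_neq0.
apply/rowP => i; rewrite diag_expE [RHS]mxE -expiMn -[X in _ = expi R X]mulr_natr hw scale_colE.
by rewrite mulrA divfK // pnatr_eq0 -lt0n.
Qed.

Lemma double_J n (B : 'M[nat]_n) u0 (u : 'rV[nat]_n) a : mxQ B \in unitmx ->
  weights_sequence (exp_double B) (row_mx (const_mx u0) u) ->
  J (exp_double B) a -> scalings (row_mx (const_mx u0) u) (a : 'rV[C]_(1 + n)).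
Proof.
move=> uB [d [d0 hd _]]; exact: J_scalings d0 hd.
Qed.

Lemma expi_half : expi R 2%:R^-1 = -1.
Proof.
have : expi R 2%:R^-1 ^+ 2 == 1.
  by rewrite -expiMn -[_ *+ 2]mulr_natl mulfV ?pnatr_eq0 // expi1.
rewrite sqrf_eq1 => /orP[/eqP/expi_eq1/intrP[k e]|/eqP //].
have k0 : 0 < k by rewrite -(ltr0z rat) -e.
have : k < 1 by rewrite -(ltrz1 rat) -e.
by rewrite ltNge -gtz0_ge1 k0.
Qed.

(** The first entry of a symmetry of x_0 ^ 2 + f is 1 or -1, and that of the
    generator of J is e(1/2) = -1, so that every class has a representative with
    first entry one. *)
Lemma double_split_J n (B : 'M[nat]_n) (a : 'rV[C]_(1 + n)) : mxQ B \in unitmx ->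
  monSL (exp_double B) a -> exists j al, [/\ J (exp_double B) j,
    coset (exp_double B) a (dbl_pt 1 al) & a = dmul j (dbl_pt 1 al)].
Proof.
move=> uB [[a0 aA] _]; have [[J1 _ _] _] := J_group R (exp_double B).
pose z := a 0 0; have aE : a = dbl_pt z (rsubmx a) := dbl_ptE a.
have : z ^+ 2 == 1.
  by have := aA (lshift n 0); rewrite exp_doubleE aE prod_row_l big_ord1 !mxE => ->.
rewrite sqrf_eq1 => /orP[] /eqP z1.
  have e : dbl_pt 1 (rsubmx a) = a by rewrite [RHS]aE z1.
  exists (const_mx 1), (rsubmx a); rewrite dmul1 e; split=> //.
  exact: coset_self.
pose j k := diag_exp R (k%:~R *: charges (exp_double B)).
have Jj k : J (exp_double B) (j k) by apply/J_diag_exp; exists k.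
have jj : dmul (j 1) (j (- 1)) = const_mx 1.
  by rewrite -diag_expD -scalerDl -intrD addrN scale0r diag_exp0.
exists (j 1), (rsubmx (dmul a (j (-1)))).
have jh : j (- 1) 0 0 = -1.
  rewrite diag_expE scale_colE charges_exp_double // mxE; case: splitP => // k _.
  by rewrite mxE mulN1r expiN expi_half invrN1.
have e : dbl_pt 1 (rsubmx (dmul a (j (-1)))) = dmul a (j (-1)).
  by rewrite [RHS]dbl_ptE; congr dbl_pt; rewrite dmulE jh -/z z1 mulrNN mulr1.
rewrite e; split=> //; first by exists (j (-1)).
by rewrite [dmul a _]dmulC dmulA jj dmul1.
Qed.

End Blocks.

(** * The groups of the two quotients *)

Section Groups.
Variable R : realType.
Local Notation C := R[i].
Variables m n : nat.

Definition pair_set (HE : set 'rV[C]_(1 + m)) (HS : set 'rV[C]_(1 + n)) :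
  set 'rV[C]_(m + n) :=
  [set c | exists al be, [/\ HE (dbl_pt 1 al), HS (dbl_pt 1 be) & c = row_mx al be]].

Lemma dbl_group_inv k (H : set 'rV[C]_(1 + k)) al : diag_group H -> H (dbl_pt 1 al) ->
  exists al', H (dbl_pt 1 al') /\ dmul al' al = const_mx 1.
Proof.
move=> [_ HV] /HV [s]; rewrite (dbl_ptE s) dmul_dbl_pt mulr1.
move=> Hs; rewrite const_row_mx => /dbl_pt_inj [e1 e2].
by rewrite e1 in Hs; exists (rsubmx s).
Qed.

Lemma pair_group HE HS : diag_group HE -> diag_group HS -> diag_group (pair_set HE HS).
Proof.
move=> gE gS; have [[E1 EM E0] _] := gE; have [[S1 SM S0] _] := gS.
split; first split.
- exists (const_mx 1), (const_mx 1); split; last exact: const_row_mx.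
    by rewrite /dbl_pt -const_row_mx.
  by rewrite /dbl_pt -const_row_mx.
- move=> _ _ [al [be [Ha Hb ->]]] [al' [be' [Ha' Hb' ->]]].
  exists (dmul al al'), (dmul be be'); split; last exact: dmul_row_mx.
    by have := EM _ _ Ha Ha'; rewrite dmul_dbl_pt mulr1.
  by have := SM _ _ Hb Hb'; rewrite dmul_dbl_pt mulr1.
- move=> _ [al [be [Ha Hb ->]]] i; rewrite mxE; case: splitP => j _.
    by have := E0 _ Ha (rshift 1 j); rewrite row_mxEr.
  by have := S0 _ Hb (rshift 1 j); rewrite row_mxEr.
- move=> _ [al [be [Ha Hb ->]]].
  have [al' [Ha' ea]] := dbl_group_inv gE Ha; have [be' [Hb' eb]] := dbl_group_inv gS Hb.
  exists (row_mx al' be'); first by exists al', be'.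
  by rewrite dmul_row_mx ea eb -const_row_mx.
Qed.

Variables (Af : 'M[nat]_m) (Ag : 'M[nat]_n).
Hypotheses (uf : mxQ Af \in unitmx) (ug : mxQ Ag \in unitmx).
Hypotheses (cyf : charges_sum1 (exp_double Af)) (cyg : charges_sum1 (exp_double Ag)).

Let uE : mxQ (exp_double Af) \in unitmx. Proof. by rewrite unit_exp_double. Qed.
Let uS : mxQ (exp_double Ag) \in unitmx. Proof. by rewrite unit_exp_double. Qed.
Let uX : mxQ (exp_sum Af Ag) \in unitmx. Proof. by rewrite unit_exp_sum uf. Qed.
Let cyX : charges_sum1 (exp_sum Af Ag). Proof. exact: charges_sum1_exp_sum. Qed.

Section Pairs.
Variables (HE : set 'rV[C]_(1 + m)) (HS : set 'rV[C]_(1 + n)).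
Hypotheses (HEs : HE `<=` monSL (exp_double Af)) (HSs : HS `<=` monSL (exp_double Ag)).

(** The union of the classes in the preimage of GE x GS under theta, when HE and
    HS are the unions of the classes in GE and GS, see [union_theta_preimage]. *)
Definition sum_group : set 'rV[C]_(m + n) := mulset (J (exp_sum Af Ag)) (pair_set HE HS).

Lemma pair_monSL : pair_set HE HS `<=` monSL (exp_sum Af Ag).
Proof.
by move=> _ [al [be [/HEs/monSL_dbl Ha /HSs/monSL_dbl Hb ->]]]; exact: monSL_exp_sum.
Qed.

Lemma sum_group_monSL : sum_group `<=` monSL (exp_sum Af Ag).
Proof.
move=> _ [j [t [/(J_monSL uX cyX) Jj /pair_monSL Ht ->]]].
by have [[_ SM _] _] := monSL_group R (exp_sum Af Ag); exact: SM.
Qed.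

End Pairs.

Lemma union_theta_preimage (cf : 'rV[C]_m) (cg : 'rV[C]_n) GE GS c :
  (forall i, cf 0 i != 0) -> (forall i, cg 0 i != 0) ->
  GE `<=` SLt (coef_double cf) (exp_double Af) ->
  GS `<=` SLt (coef_double cg) (exp_double Ag) ->
  union_set (theta_preimage cf Af cg Ag GE GS) c <->
  sum_group (union_set GE) (union_set GS) c.
Proof.
move=> cf0 cg0 hE hS; have cE0 := coef_double_neq0 cf0; have cS0 := coef_double_neq0 cg0.
have cX0 := coef_diff_neq0 cf0 cg0; split.
  move=> [P [SP [Q [Q' [[al [be [Pab _ _ -> ->]]] GQ GQ']]]] Pc].
  have [_ PE] := SLt_coset uX cX0 cyX SP Pab.
  move: Pc; rewrite PE => -[j Jj ->]; exists j, (row_mx al be); rewrite dmulC; split=> //.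
  exists al, be; split=> //; [exists (coset (exp_double Af) (dbl_pt 1 al)) => //|
    exists (coset (exp_double Ag) (dbl_pt 1 be)) => //]; exact: coset_self.
move=> [j [_ [Jj [al [be [Ha Hb ->]]] ->]]].
have Sa := union_monSL uE cE0 cyf hE Ha; have Sb := union_monSL uS cS0 cyg hS Hb.
exists (coset (exp_sum Af Ag) (row_mx al be)); last by exists j; rewrite // dmulC.
split.
  exists (row_mx al be) => //; apply/(SL_monSL _ uX cX0).
  by apply: monSL_exp_sum; apply/monSL_dbl.
exists (coset (exp_double Af) (dbl_pt 1 al)), (coset (exp_double Ag) (dbl_pt 1 be)); split.
- exists al, be; split=> //; first exact: coset_self.
    by have /monSL_dbl [] := Sa.
  by have /monSL_dbl [] := Sb.
- exact/(union_coset uE cE0 cyf _ hE).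
- exact/(union_coset uS cS0 cyg _ hS).
Qed.

Lemma pairing_exp_sum k l (A : 'M[nat]_k) (B : 'M[nat]_l) v1 v2 w1 w2 :
  pairing (exp_sum A B) (col_mx v1 v2) (col_mx w1 w2) =
  pairing A v1 w1 + pairing B v2 w2.
Proof.
rewrite /pairing mxQ_exp_sum tr_col_mx mul_row_block !mulmx0 addr0 add0r.
by rewrite mul_row_col mxE.
Qed.

Lemma pairing0l k (A : 'M[nat]_k) w : pairing A 0 w = 0.
Proof. by rewrite /pairing trmx0 !mul0mx mxE. Qed.

Lemma pairing_dbl k (B : 'M[nat]_k) v w :
  pairing (exp_double B) (col_mx 0 v) (col_mx 0 w) = pairing B v w.
Proof. by rewrite exp_doubleE pairing_exp_sum pairing0l add0r. Qed.

Lemma diag_exp_dbl k (v : 'cV[rat]_k) :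
  diag_exp R (col_mx 0 v : 'cV_(1 + k)) = dbl_pt 1 (diag_exp R v).
Proof. by rewrite diag_exp_col_mx diag_exp0. Qed.

(** Membership of (1, e(v)) in a transposed group only has to be tested on the
    elements (1, e(w)): every class contains such an element. *)
Lemma perp_dbl k (B : 'M[nat]_k) (H : set 'rV[C]_(1 + k)) v :
  mxQ B \in unitmx -> charges_sum1 (exp_double B) -> H `<=` monSL (exp_double B) ->
  (forall a b, H a -> coset (exp_double B) a b -> H b) ->
  perp (exp_double B) H (dbl_pt 1 (diag_exp R v)) <->
  monSL B^T (diag_exp R v) /\
  forall w, H (dbl_pt 1 (diag_exp R w)) -> pairing B v w \is a Num.int.
Proof.
move=> uB cy HSL HJ; have uB2 : mxQ (exp_double B) \in unitmx by rewrite unit_exp_double.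
split=> [[S1 h]|[S1 h]].
  split=> [|w Hw]; first by apply/monSL_dbl; rewrite -exp_double_tr.
  rewrite -pairing_dbl; apply: h; first by rewrite diag_exp_dbl.
  by rewrite diag_exp_dbl.
have S2 : monSL (exp_double B)^T (dbl_pt 1 (diag_exp R v)).
  by rewrite exp_double_tr; apply/monSL_dbl.
split=> // v' w' e Hw'; have Sw' := HSL _ Hw'.
have [j [al [_ cw _]]] := double_split_J uB Sw'.
have Hal := HJ _ _ Hw' cw; have /monSL_dbl Sal := HSL _ Hal.
have [w ew] := monAut_lift uB Sal.1; rewrite ew in cw Hal.
have ev := diag_exp_dbl v; have ew0 := diag_exp_dbl w.
apply: (pairing_coset (R := R) (v := (col_mx 0 v : 'cV_(1 + k)))
  (w := (col_mx 0 w : 'cV_(1 + k))) uB2 cy).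
- by rewrite ev.
- by rewrite ew0; exact: HSL.
- by rewrite -e ev; exact: coset_self.
- by rewrite ew0 (coset_eq cw); exact: coset_self.
- by rewrite pairing_dbl; exact: h.
Qed.

Section Perp.
Variables (HE : set 'rV[C]_(1 + m)) (HS : set 'rV[C]_(1 + n)).
Hypotheses (gE : diag_group HE) (gS : diag_group HS).
Hypotheses (HEs : HE `<=` monSL (exp_double Af)) (HSs : HS `<=` monSL (exp_double Ag)).
Hypothesis HEJ : forall a b, HE a -> coset (exp_double Af) a b -> HE b.
Hypothesis HSJ : forall a b, HS a -> coset (exp_double Ag) a b -> HS b.
Variables (u0 v0 : nat) (u : 'rV[nat]_m) (v : 'rV[nat]_n).
Hypothesis hu : weights_sequence (exp_double Af) (row_mx (const_mx u0) u).
Hypothesis hv : weights_sequence (exp_double Ag) (row_mx (const_mx v0) v).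
Hypothesis cop : coprime u0 v0.

Lemma perp_of_pair al be :
  perp (exp_double Af) HE (dbl_pt 1 al) -> perp (exp_double Ag) HS (dbl_pt 1 be) ->
  perp (exp_sum Af Ag) (sum_group HE HS) (row_mx al be).
Proof.
move=> pa pb; have := pa.1; rewrite exp_double_tr => /monSL_dbl Sa.
have := pb.1; rewrite exp_double_tr => /monSL_dbl Sb.
have [v1 e1] := monAut_lift (unit_tr uf) Sa.1; have [v2 e2] := monAut_lift (unit_tr ug) Sb.1.
rewrite e1 in pa Sa *; rewrite e2 in pb Sb *.
have [_ ha] := (perp_dbl _ uf cyf HEs HEJ).1 pa.
have [_ hb] := (perp_dbl _ ug cyg HSs HSJ).1 pb.
have SX : monSL (exp_sum Af Ag)^T (row_mx (diag_exp R v1) (diag_exp R v2)).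
  by rewrite exp_sum_tr; exact: monSL_exp_sum.
split=> // v' w' e Hw'; have Sw' := sum_group_monSL HEs HSs Hw'.
case: Hw' => j [_ [Jj [al' [be' [Ha' Hb' ->]]] ew']].
have /monSL_dbl Sa' := HEs Ha'; have /monSL_dbl Sb' := HSs Hb'.
have [w1 f1] := monAut_lift uf Sa'.1; have [w2 f2] := monAut_lift ug Sb'.1.
rewrite f1 in Ha' Sa' ew'; rewrite f2 in Hb' Sb' ew'.
apply: (pairing_coset (R := R) (v := col_mx v1 v2) (w := col_mx w1 w2) uX cyX).
- by rewrite diag_exp_col_mx.
- by rewrite diag_exp_col_mx; exact: monSL_exp_sum.
- by rewrite -e diag_exp_col_mx; exact: coset_self.
- by rewrite diag_exp_col_mx; exists j; rewrite // ew' dmulC.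
- by rewrite pairing_exp_sum; apply: rpredD; [exact: ha|exact: hb].
Qed.

Lemma pairing_weights k (B : 'M[nat]_k) t0 (t : 'rV[nat]_k) x : mxQ B \in unitmx ->
  weights_sequence (exp_double B) (row_mx (const_mx t0) t) ->
  int_col (mxQ B^T *m x) -> (2 * t0)%:R * (\sum_i x i 0) \is a Num.int.
Proof.
move=> uB ht ix; have [_ hj] := weights_double uB ht.
rewrite -(pairing_charges_r x uB) -pairingZr; apply: pairing_int_r => // i.
by rewrite scale_colE -hj; exact: rpred_nat.
Qed.

(** The determinant of the first block of a symmetry of the transposed sum is
    e(s) with 2 u0 s and 2 v0 s integral, where u0 and v0 are the weights for the
    potentials that are transposed. Since they are coprime it is 1 or -1, and
    multiplying by j, whose blocks have determinant -1, makes it 1. *)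
Lemma perp_split_pair c : perp (exp_sum Af Ag) (sum_group HE HS) c ->
  exists j al be, [/\ J (exp_sum Af Ag)^T j, perp (exp_double Af) HE (dbl_pt 1 al),
    perp (exp_double Ag) HS (dbl_pt 1 be) & c = dmul j (row_mx al be)].
Proof.
move=> pc; have [x0 e0] := monAut_lift (unit_tr uX) pc.1.1.
have perpJ := perp_J uX cyX (sum_group_monSL HEs HSs).
pose q := charges (exp_sum Af Ag)^T.
have uft := unit_tr uf; have ugt := unit_tr ug.
have qE : q = col_mx (charges Af^T) (charges Ag^T).
  by rewrite /q exp_sum_tr charges_exp_sum.
have hqf : \sum_i charges Af^T i 0 = 2%:R^-1 by rewrite charges_sum_tr; apply/charges_half.
(* k is chosen such that x0 + k q has integral sum over the first block; there
   the charges sum to 1/2. *)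
have [k ek] : exists k : int, \sum_i (usubmx (x0 + k%:~R *: q)) i 0 \is a Num.int.
  have /monSL_diag_exp [ix sx] : monSL (exp_sum Af Ag)^T (diag_exp R x0) by rewrite -e0; exact: pc.1.
  have := ix; rewrite exp_sum_tr mxQ_exp_sum -{1}[x0]vsubmxK mul_block_col !mul0mx addr0 add0r => ixb.
  have i1 : (2 * u0)%:R * (\sum_i usubmx x0 i 0) \is a Num.int.
    by apply: pairing_weights hu _ => // i; have := ixb (lshift n i); rewrite col_mxEu.
  have i2 : (2 * v0)%:R * (\sum_i dsubmx x0 i 0) \is a Num.int.
    by apply: pairing_weights hv _ => // i; have := ixb (rshift m i); rewrite col_mxEd.
  move: sx; rewrite -[x0]vsubmxK sum_col_mx vsubmxK => sx.
  set s1 := \sum_i usubmx x0 i 0 in i1 sx *; set s2 := \sum_i dsubmx x0 i 0 in i2 sx.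
  have i3 : (2 * v0)%:R * s1 \is a Num.int.
    have -> : (2 * v0)%:R * s1 = (2 * v0)%:R * (s1 + s2) - (2 * v0)%:R * s2 by ring.
    by apply: rpredB => //; apply: rpredM => //; exact: rpred_nat.
  have [u0_gt0 _] := weights_double uf hu.
  have i4 : 2%:R * s1 \is a Num.int.
    case: (egcdnP v0 u0_gt0) => a a' ea _; rewrite (eqP cop) in ea.
    have -> : 2%:R * s1 = a%:R * ((2 * u0)%:R * s1) - a'%:R * ((2 * v0)%:R * s1).
      have : a%:R * u0%:R = a'%:R * v0%:R + 1 :> rat by rewrite -!natrM ea natrD.
      move=> e; transitivity (2%:R * s1 * (a%:R * u0%:R - a'%:R * v0%:R)); last by rewrite !natrM; ring.
      by rewrite e [_ + 1]addrC addrK mulr1.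
    by apply: rpredB; apply: rpredM => //; exact: rpred_nat.
  case/intrP: i4 => z ez.
  exists (- z); rewrite (eq_bigr (fun i => usubmx x0 i 0 + (- z)%:~R * charges Af^T i 0)).
    rewrite big_split /= -/s1 -mulr_sumr hqf.
    have -> : s1 = z%:~R / 2%:R by rewrite -ez mulrAC mulfV ?mul1r // pnatr_eq0.
    by rewrite intrN mulNr subrr; exact: rpred0.
  have us : usubmx (x0 + (- z)%:~R *: q) = usubmx x0 + (- z)%:~R *: charges Af^T.
    by rewrite qE linearD linearZ /= col_mxKu.
  by move=> i _; rewrite us [LHS]mxE scale_colE.
pose x := x0 + k%:~R *: q; pose j := diag_exp R ((- k)%:~R *: q).
have jx : c = dmul j (diag_exp R x).
  rewrite -diag_expD e0 /x; congr diag_exp.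
  by rewrite addrCA -scalerDl -intrD addNr scale0r addr0.
have xE : diag_exp R x = dmul c (diag_exp R (k%:~R *: q)) by rewrite diag_expD e0.
have px : perp (exp_sum Af Ag) (sum_group HE HS) (diag_exp R x).
  by rewrite xE; apply: perpJ pc _; apply/J_diag_exp; exists k.
have /monSL_diag_exp [ix sx] := px.1.
have xb : x = col_mx (usubmx x) (dsubmx x) by rewrite vsubmxK.
move: ix; rewrite exp_sum_tr mxQ_exp_sum {1}xb mul_block_col !mul0mx addr0 add0r => ix.
have s2 : \sum_i (dsubmx x) i 0 \is a Num.int.
  have -> : \sum_i (dsubmx x) i 0 = \sum_i x i 0 - \sum_i (usubmx x) i 0.
    by rewrite {2}xb sum_col_mx addrC addKr.
  exact: rpredB.
have [[S1 _ _] _] := gS; have [[E1 _ _] _] := gE; have [[J1 _ _] _] := J_group R (exp_sum Af Ag).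
have one k' : dbl_pt 1 (const_mx 1) = const_mx 1 :> 'rV[C]_(1 + k') by rewrite /dbl_pt -const_row_mx.
have key w1 w2 : sum_group HE HS (row_mx (diag_exp R w1) (diag_exp R w2)) ->
    pairing Af (usubmx x) w1 + pairing Ag (dsubmx x) w2 \is a Num.int.
  by rewrite -diag_exp_col_mx -pairing_exp_sum -xb; exact: px.2.
exists j, (diag_exp R (usubmx x)), (diag_exp R (dsubmx x)); split.
- by apply/J_diag_exp; exists (- k); rewrite -exp_sum_tr.
- apply/(perp_dbl _ uf cyf HEs HEJ); split=> [|w Hw].
    by apply/monSL_diag_exp; split=> // i; have := ix (lshift n i); rewrite col_mxEu.
  have := key w 0; rewrite [pairing Ag _ _]pairing_tr pairing0l addr0 diag_exp0.
  apply; exists (const_mx 1); eexists; split; first exact: J1.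
    by exists (diag_exp R w), (const_mx 1); split; rewrite ?one.
  by rewrite dmul1.
- apply/(perp_dbl _ ug cyg HSs HSJ); split=> [|w Hw].
    by apply/monSL_diag_exp; split=> // i; have := ix (rshift m i); rewrite col_mxEd.
  have := key 0 w; rewrite [pairing Af _ _]pairing_tr pairing0l add0r diag_exp0.
  apply; exists (const_mx 1); eexists; split; first exact: J1.
    by exists (const_mx 1), (diag_exp R w); split; rewrite ?one.
  by rewrite dmul1.
- by rewrite jx {1}xb diag_exp_col_mx.
Qed.

End Perp.

End Groups.

(** * Birational models of Delsarte type *)

Section Main.
Variable R : realType.
Local Notation C := R[i].

(** If u and v are weights of f and g of degrees 2 u0 and 2 v0, these are weights
    of f - g of degree 2 u0 v0, possibly a proper multiple of the smallest ones. *)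
Definition sum_weights m n (u0 v0 : nat) (u : 'rV[nat]_m) (v : 'rV[nat]_n) : 'rV[nat]_(m + n) :=
  row_mx (\row_i (v0 * u ord0 i)%N) (\row_i (u0 * v ord0 i)%N).

Lemma scalings_sum_weights m n u0 v0 (u : 'rV[nat]_m) (v : 'rV[nat]_n) (s : 'rV[C]_(m + n)) :
  scalings (sum_weights u0 v0 u v) s <->
  exists2 l : C, l != 0 & s = row_mx (wscale u (l ^+ v0)) (wscale v (l ^+ u0)).
Proof.
have e l : wscale (sum_weights u0 v0 u v) l =
    row_mx (wscale u (l ^+ v0)) (wscale v (l ^+ u0)) :> 'rV[C]_(m + n).
  by rewrite wscale_row_mx; congr row_mx; apply/rowP => i; rewrite !mxE exprM.
by split=> -[l l0 ->]; exists l.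
Qed.

(** Since N is a multiple of the minimal degree d, the vector N q is a multiple
    k w of the weights, and every scalar is a k-th power. *)
Lemma scalings_weights n (A : 'M[nat]_n) w d (w' : 'rV[nat]_n) N (s : 'rV[C]_n) :
  is_weights A w d -> (0 < N)%N -> (forall i, (w' 0 i)%:R = N%:R * charges A i 0) ->
  scalings w s <-> scalings w' s.
Proof.
move=> [d0 hw dmin] N0 hw'.
have dN : (d %| N)%N.
  rewrite /dvdn; apply: contraT; rewrite -lt0n => r0.
  have := dmin (N %% d)%N%:R; rewrite ltr0n r0 => /(_ isT).
  rewrite ler_nat leqNgt ltn_mod d0; apply => i.
  have -> : (N %% d)%N%:R = N%:R - (N %/ d)%N%:R * d%:R :> rat.
    by rewrite {2}(divn_eq N d) natrD natrM addrAC subrr add0r.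
  by rewrite mulrBl -mulrA -hw -hw' -natrM; apply: rpredB; exact: rpred_nat.
pose k := (N %/ d)%N; have k0 : (0 < k)%N by rewrite divn_gt0 // dvdn_leq.
have w'E i : w' ord0 i = (k * w ord0 i)%N.
  apply/eqP; rewrite -(eqr_nat rat) hw' natrM hw mulrA -natrM /k divnK //.
have e t : wscale w' t = wscale w (t ^+ k) :> 'rV[C]_n.
  by apply/rowP => i; rewrite !mxE w'E exprM.
split=> -[t t0 ->]; last by exists (t ^+ k); rewrite ?expf_neq0.
exists (k.-root t); first by rewrite rootC_eq0.
by rewrite e rootCK.
Qed.

Section Delsarte.
Variables (m n : nat) (Af : 'M[nat]_m) (Ag : 'M[nat]_n).
Hypotheses (m_gt0 : (0 < m)%N) (n_gt0 : (0 < n)%N).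
Hypotheses (uf : mxQ Af \in unitmx) (ug : mxQ Ag \in unitmx).
Variables (cf : 'rV[C]_m) (cg : 'rV[C]_n).
Hypotheses (cf0 : forall i, cf 0 i != 0) (cg0 : forall i, cg 0 i != 0).
Variables (u0 v0 : nat) (u : 'rV[nat]_m) (v : 'rV[nat]_n).
Hypothesis hu : weights_sequence (exp_double Af) (row_mx (const_mx u0) u).
Hypothesis hv : weights_sequence (exp_double Ag) (row_mx (const_mx v0) v).
Hypothesis cop : coprime u0 v0.

Lemma sum_weights_charges i :
  (sum_weights u0 v0 u v 0 i)%:R = (2 * (u0 * v0))%:R * charges (exp_sum Af Ag) i 0.
Proof.
have [_ hf] := weights_double uf hu; have [_ hg] := weights_double ug hv.
rewrite charges_exp_sum // -(splitK i); case: (split i) => j /=.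
  by rewrite row_mxEl col_mxEu mxE natrM hf !natrM; ring.
by rewrite row_mxEr col_mxEd mxE natrM hg !natrM; ring.
Qed.

Variables (w : 'rV[nat]_(m + n)).
Hypothesis scalw : forall s : 'rV[C]_(m + n),
  scalings w s <-> scalings (sum_weights u0 v0 u v) s.
Variables (GE : set (set 'rV[C]_(1 + m))) (GS : set (set 'rV[C]_(1 + n))).
Variables (GX : set (set 'rV[C]_(m + n))).
Variables (HE : set 'rV[C]_(1 + m)) (HS : set 'rV[C]_(1 + n)) (HX : set 'rV[C]_(m + n)).
Hypothesis HGE : forall a, HE a <-> union_set GE a.
Hypothesis HGS : forall a, HS a <-> union_set GS a.
Hypothesis HGX : forall a, HX a <-> union_set GX a.
Hypotheses (gHE : diag_group HE) (gHS : diag_group HS) (gHX : diag_group HX).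
Hypotheses (HEs : HE `<=` monSL (exp_double Af)) (HSs : HS `<=` monSL (exp_double Ag)).
Hypothesis HXs : HX `<=` monSL (exp_sum Af Ag).
Hypothesis HEJ : forall a b, HE a -> coset (exp_double Af) a b -> HE b.
Hypothesis HSJ : forall a b, HS a -> coset (exp_double Ag) a b -> HS b.
Hypothesis HX_split : forall c, HX c -> exists j al be,
  [/\ J (exp_sum Af Ag) j, HE (dbl_pt 1 al), HS (dbl_pt 1 be) & c = dmul j (row_mx al be)].
Hypothesis HX_of : forall al be, HE (dbl_pt 1 al) -> HS (dbl_pt 1 be) -> HX (row_mx al be).

(** Both parts of the theorem are instances: the first one with the unions of the
    classes in the given groups, the second one with their transposes. *)
Lemma birational_delsarte (Z : fspace C) :
  is_Z_quotients (row_mx (const_mx u0) u) (delsarte (coef_double cf) (exp_double Af)) GE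
    (row_mx (const_mx v0) v) (delsarte (coef_double cg) (exp_double Ag)) GS Z ->
  birational Z (whyp_quot w (delsarte (coef_diff cf cg) (exp_sum Af Ag)) GX).
Proof.
have [u0_gt0 _] := weights_double uf hu; have [v0_gt0 _] := weights_double ug hv.
have dbl_split k (B : 'M[nat]_k) t0 (t : 'rV[nat]_k) (H : set 'rV[C]_(1 + k)) :
    mxQ B \in unitmx -> weights_sequence (exp_double B) (row_mx (const_mx t0) t) ->
    H `<=` monSL (exp_double B) -> (forall a b, H a -> coset (exp_double B) a b -> H b) ->
    forall a, H a -> exists r al, [/\ r != 0, H (dbl_pt 1 al) &
      a = dmul (wscale (row_mx (const_mx t0) t) r) (dbl_pt 1 al)].
  move=> uB ht Hs HJ a Ha; have [j [al [Jj cal ->]]] := double_split_J uB (Hs _ Ha).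
  have [r r0 ->] := double_J uB ht Jj; exists r, al; split=> //; exact: HJ Ha cal.
have scalX s : scalings w s <->
    exists2 l : C, l != 0 & s = row_mx (wscale u (l ^+ v0)) (wscale v (l ^+ u0)).
  by rewrite scalw; exact: scalings_sum_weights.
apply: (@borcea_voisin_birational _ m n _ _ _ _ _ (ev_double cf Af) (ev_double cg Ag)
  (ev_diff cf cg Af Ag) u0 v0 u v w u0_gt0 v0_gt0 cop
  (weights_homogeneous uf hu cf) (weights_homogeneous ug hv cg) scalX
  (delsarte_neq0 m_gt0 uf cf0) (delsarte_neq0 n_gt0 ug cg0)
  GE GS GX HE HS HX HGE HGS HGX gHE gHS gHX).
- by move=> a x /HEs; exact: monSL_ev.
- by move=> a x /HSs; exact: monSL_ev.
- by move=> a x /HXs; exact: monSL_ev.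
- exact: dbl_split uf hu HEs HEJ.
- exact: dbl_split ug hv HSs HSJ.
- move=> a /HX_split [j [al [be [Jj Hal Hbe ->]]]]; exists j, al, be; split=> //.
  apply/scalw; apply: (J_scalings _ sum_weights_charges Jj).
  by rewrite !muln_gt0 u0_gt0 v0_gt0.
- move=> al be Hal Hbe; exists (const_mx 1); last by rewrite dmul1; exact: HX_of.
  by have [[S1 _ _] _] := scalings_group C w.
Qed.

End Delsarte.

Lemma admissible_charges n (c : 'rV[C]_n) (A : 'M[nat]_n) :
  admissible c A -> mxQ A \in unitmx /\ charges_sum1 A.
Proof.
move=> [uA [w [d [[d0 hw _] _ _ sw]]]]; split=> //.
have dn : d%:R != 0 :> rat by rewrite pnatr_eq0 -lt0n.
apply: (mulfI dn); rewrite mulr1 mulr_sumr -[in RHS]sw natr_sum.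
by apply: eq_bigr => i _; rewrite -hw.
Qed.

End Main.

Theorem theorem4p10 (R : realType)
  (* f and g: coefficients and exponent matrices *)
  (cf : 'rV[R[i]]_2) (Af : 'M[nat]_2) (cg : 'rV[R[i]]_3) (Ag : 'M[nat]_3)
  (hcf : forall i, cf 0 i != 0) (hcg : forall i, cg 0 i != 0)
  (admE : admissible (coef_double cf) (exp_double Af))
  (admS : admissible (coef_double cg) (exp_double Ag))
  (u0 : nat) (u : 'rV[nat]_2) (v0 : nat) (v : 'rV[nat]_3)
  (hu : weights_sequence (exp_double Af) (row_mx (const_mx u0) u))
  (hv : weights_sequence (exp_double Ag) (row_mx (const_mx v0) v))
  (u0T : nat) (uT : 'rV[nat]_2) (v0T : nat) (vT : 'rV[nat]_3)
  (huT : weights_sequence (exp_double Af)^T (row_mx (const_mx u0T) uT))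
  (hvT : weights_sequence (exp_double Ag)^T (row_mx (const_mx v0T) vT))
  (wT : 'rV[nat]_(2 + 3))
  (hwT : weights_sequence (exp_sum Af Ag)^T wT)
  (cop : coprime u0 v0) (copT : coprime u0T v0T)
  (GE : set (set 'rV[R[i]]_(1 + 2))) (GS : set (set 'rV[R[i]]_(1 + 3)))
  (hGE : SLt_subgroup (coef_double cf) (exp_double Af) GE)
  (hGS : SLt_subgroup (coef_double cg) (exp_double Ag) GS) :
  let GES := theta_preimage cf Af cg Ag GE GS in
  (* coefficients of the transposed potentials *)
  let cET : 'rV[R[i]]_(1 + 2) := coef_double (const_mx 1) in
  let cST : 'rV[R[i]]_(1 + 3) := coef_double (const_mx 1) in
  let cEST : 'rV[R[i]]_(2 + 3) := coef_diff (const_mx 1) (const_mx 1) in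
  (forall Z : fspace R[i],
     is_Z_quotients
       (row_mx (const_mx u0) u) (delsarte (coef_double cf) (exp_double Af)) GE
       (row_mx (const_mx v0) v) (delsarte (coef_double cg) (exp_double Ag)) GS Z ->
     birational Z
       (whyp_quot
          (row_mx (\row_i (v0 * u ord0 i)%N) (\row_i (u0 * v ord0 i)%N) : 'rV[nat]_(2 + 3))
          (delsarte (coef_diff cf cg) (exp_sum Af Ag)) GES))
  /\
  (forall Z : fspace R[i],
     is_Z_quotients
       (row_mx (const_mx u0T) uT) (delsarte cET (exp_double Af)^T)
       (transposed cET (exp_double Af) GE)
       (row_mx (const_mx v0T) vT) (delsarte cST (exp_double Ag)^T)
       (transposed cST (exp_double Ag) GS) Z ->
     birational Z
       (whyp_quot wT (delsarte cEST (exp_sum Af Ag)^T)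
          (transposed cEST (exp_sum Af Ag) GES))).
Proof.
move=> GES cET cST cEST.
have [uE cyE] := admissible_charges admE; have [uS cyS] := admissible_charges admS.
have uf : mxQ Af \in unitmx by rewrite -unit_exp_double.
have ug : mxQ Ag \in unitmx by rewrite -unit_exp_double.
have cE0 := coef_double_neq0 hcf; have cS0 := coef_double_neq0 hcg.
have cX0 := coef_diff_neq0 hcf hcg.
have one0 k : forall i, (const_mx 1 : 'rV[R[i]]_k) 0 i != 0 by move=> i; rewrite mxE oner_eq0.
have uX : mxQ (exp_sum Af Ag) \in unitmx by rewrite unit_exp_sum uf.
have cyX := charges_sum1_exp_sum uf ug cyE cyS.
have sE : GE `<=` SLt (coef_double cf) (exp_double Af) by case: hGE.
have sS : GS `<=` SLt (coef_double cg) (exp_double Ag) by case: hGS.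
have sX : GES `<=` SLt (coef_diff cf cg) (exp_sum Af Ag) by move=> P [].
have gE := union_group uE cE0 cyE hGE; have gS := union_group uS cS0 cyS hGS.
have HEs : union_set GE `<=` monSL (exp_double Af) by move=> a; exact: union_monSL sE.
have HSs : union_set GS `<=` monSL (exp_double Ag) by move=> a; exact: union_monSL sS.
have HEJ a b : union_set GE a -> coset (exp_double Af) a b -> union_set GE b.
  by move=> Ha [j Jj ->]; exact: (union_J uE cE0 cyE sE).
have HSJ a b : union_set GS a -> coset (exp_double Ag) a b -> union_set GS b.
  by move=> Ha [j Jj ->]; exact: (union_J uS cS0 cyS sS).
have HXE c := union_theta_preimage uf ug cyE cyS c hcf hcg sE sS.
have [[J1 _ _] _] := J_group R (exp_sum Af Ag).
split=> Z.
  apply: (@birational_delsarte R 2 3 Af Ag isT isT uf ug cf cg hcf hcg u0 v0 u v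
    hu hv cop _ (fun s => iff_refl _) GE GS GES (union_set GE) (union_set GS)
    (sum_group Af Ag (union_set GE) (union_set GS))) => //.
  - by move=> a; rewrite HXE.
  - by apply: mulset_group; [exact: J_group|exact: pair_group].
  - exact: sum_group_monSL.
  - by move=> c [j [_ [Jj [al [be [Ha Hb ->]]] ->]]]; exists j, al, be.
  - move=> al be Ha Hb; exists (const_mx 1), (row_mx al be); rewrite dmul1; split=> //.
    by exists al, be.
have uTf := unit_tr uf; have uTg := unit_tr ug.
have cET0 := coef_double_neq0 (one0 2); have cST0 := coef_double_neq0 (one0 3).
have cEST0 := coef_diff_neq0 (one0 2) (one0 3).
have HX_eq : union_set GES = sum_group Af Ag (union_set GE) (union_set GS).
  by apply/seteqP; split=> c /HXE.
have HXs : union_set GES `<=` monSL (exp_sum Af Ag) by move=> a; exact: union_monSL sX.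
have perp_coset k (A : 'M[nat]_k) H a b : mxQ A \in unitmx -> charges_sum1 A ->
    H `<=` monSL A -> perp A H a -> coset A^T a b -> perp A H b :> Prop.
  by move=> uA cyA Hs Ha [j Jj ->]; exact: perp_J.
rewrite !exp_double_tr exp_sum_tr; rewrite !exp_double_tr in huT hvT.
rewrite exp_sum_tr in hwT; have [d hd] := hwT.
have [u0T_gt0 _] := weights_double uTf huT; have [v0T_gt0 _] := weights_double uTg hvT.
have scalw s : scalings wT s <-> scalings (sum_weights u0T v0T uT vT) (s : 'rV[R[i]]_(2 + 3)).
  apply: (scalings_weights s hd _ (sum_weights_charges uTf uTg huT hvT)).
  by rewrite !muln_gt0 u0T_gt0 v0T_gt0.
apply: (@birational_delsarte R 2 3 Af^T Ag^T isT isT uTf uTg _ _ (one0 2) (one0 3)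
  u0T v0T uT vT huT hvT copT wT scalw _ _ _ (perp (exp_double Af) (union_set GE))
  (perp (exp_double Ag) (union_set GS)) (perp (exp_sum Af Ag) (union_set GES))) => //.
- by move=> a; rewrite (union_transposed a uE cyE cE0 cET0 sE).
- by move=> a; rewrite (union_transposed a uS cyS cS0 cST0 sS).
- by move=> a; rewrite (union_transposed a uX cyX cX0 cEST0 sX).
- exact: perp_group.
- exact: perp_group.
- exact: perp_group.
- by rewrite -exp_double_tr => a [].
- by rewrite -exp_double_tr => a [].
- by rewrite -exp_sum_tr => a [].
- by rewrite -exp_double_tr => a b; exact: perp_coset.
- by rewrite -exp_double_tr => a b; exact: perp_coset.
- rewrite -exp_sum_tr HX_eq => c.
  exact: (perp_split_pair uf ug cyE cyS gE gS HEs HSs HEJ HSJ hu hv cop).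
- move=> al be; rewrite HX_eq.
  exact: (perp_of_pair uf ug cyE cyS HEs HSs HEJ HSJ).
Qed.
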